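(* Given an $n$-node $m$-edge directed graph $G$ with edge weights in $\{1,\ldots,M\}$ and a constant $\varepsilon>0$, there is a randomized algorithm that computes, for every vertex $v$, an estimate $\hat c_v$ with $SC(v)\le \hat c_v\le (2+\varepsilon)SC(v)$, in $\tilde O(m\sqrt n\log M)$ time with high probability.
   Context: For a vertex $v$ of a directed graph, $SC(v)$ is the minimum total weight of a directed cycle containing $v$. $\tilde O$ hides polylogarithmic factors; ''with high probability'' means with probability $1-1/\mathrm{poly}(n)$. *)

(* Defs.v *)
From mathcomp Require Import all_boot all_order all_algebra.
From mathcomp Require Import all_classical all_reals all_analysis.

Set Implicit Arguments.
Unset Strict Implicit.
Unset Printing Implicit Defensive.

Import Order.TTheory GRing.Theory Num.Theory.

Local Open Scope ring_scope.

(* A digraph on n nodes is an edge relation e : rel 'I_n, so antiparallel edges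
   and loops are allowed, parallel edges are not. The values wt u v at pairs
   with ~~ e u v are irrelevant. *)

Definition edge_listing n (e : rel 'I_n) (es : seq ('I_n * 'I_n)) : Prop :=
  uniq es /\ forall u v, ((u, v) \in es) = e u v.

(* A directed cycle is a nonempty duplicate-free vertex sequence with an edge
   from each vertex to the cyclically next one; [:: v] is a cycle iff v has a
   loop, [:: u; v] iff both (u, v) and (v, u) are edges. *)
Definition cycles_through n (e : rel 'I_n) (v : 'I_n) : set (seq 'I_n) :=
  [set p | ucycle e p /\ v \in p].

Definition cycle_weight n (wt : 'I_n -> 'I_n -> nat) (p : seq 'I_n) : nat :=
  (\sum_(x <- p) wt x (next p x))%N.

(* The weights are natural numbers, so the infimum is attained unless v lies on
   no cycle, and then it is +oo. *)
Definition SC (R : realType) n (e : rel 'I_n) (wt : 'I_n -> 'I_n -> nat)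
    (v : 'I_n) : \bar R :=
  ereal_inf [set (cycle_weight wt p)%:R%:E | p in cycles_through e v].

(* Computation model: a unit-cost randomized word RAM with w-bit words,
   presented as a structured language over word variables and zero-initialized
   word arrays. A program is a finite piece of syntax, hence mentions finitely
   many variables and arrays, which can be interleaved in a single memory at
   constant overhead. Randomness comes from a sequence of fair coins. *)

Inductive binop := OpAdd | OpSub | OpMul | OpDiv | OpMod | OpEq | OpLt.

Inductive expr :=
| ELit of nat
| EVar of nat
| EGet of nat & expr
| EBin of binop & expr & expr.

Inductive cmd :=
| CSkip
| CAssign of nat & expr
| CPut of nat & expr & expr
| CFlip of nat
| CSeq of cmd & cmd
| CIf of expr & cmd & cmd
| CWhile of expr & cmd.

Record state := State {
  vars : nat -> nat;
  arrs : nat -> nat -> nat;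
  coins : seq bool }.

Definition set_var (s : state) x a : state :=
  State (fun y => if y == x then a else vars s y) (arrs s) (coins s).

Definition set_arr (s : state) x i a : state :=
  State (vars s)
        (fun y j => if (y == x) && (j == i) then a else arrs s y j)
        (coins s).

Definition binop_sem (o : binop) (a b : nat) : nat :=
  match o with
  | OpAdd => a + b
  | OpSub => a - b
  | OpMul => a * b
  | OpDiv => a %/ b
  | OpMod => a %% b
  | OpEq => a == b
  | OpLt => (a < b)%N
  end%N.

(* Literals and results of operations are reduced modulo 2 ^ w; OpSub is
   truncated at 0. *)
Fixpoint eval_expr (w : nat) (s : state) (a : expr) : nat :=
  match a with
  | ELit k => k %% 2 ^ w
  | EVar x => vars s x
  | EGet x i => arrs s x (eval_expr w s i)
  | EBin o a1 a2 => binop_sem o (eval_expr w s a1) (eval_expr w s a2) %% 2 ^ w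
  end%N.

Fixpoint ecost (a : expr) : nat :=
  match a with
  | ELit _ | EVar _ => 1
  | EGet _ i => (ecost i).+1
  | EBin _ a1 a2 => (ecost a1 + ecost a2).+1
  end%N.

(* exec w P s t s' : with w-bit words, P started in s terminates in s' after
   exactly t steps. A CFlip on an exhausted coin sequence is stuck. *)
Inductive exec (w : nat) : cmd -> state -> nat -> state -> Prop :=
| ExSkip s : exec w CSkip s 1 s
| ExAssign x a s :
    exec w (CAssign x a) s (ecost a).+1 (set_var s x (eval_expr w s a))
| ExPut x i a s :
    exec w (CPut x i a) s (ecost i + ecost a).+1
      (set_arr s x (eval_expr w s i) (eval_expr w s a))
| ExFlip x s b r : coins s = b :: r ->
    exec w (CFlip x) s 1 (set_var (State (vars s) (arrs s) r) x b)
| ExSeq P Q s1 t1 s2 t2 s3 : exec w P s1 t1 s2 -> exec w Q s2 t2 s3 ->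
    exec w (CSeq P Q) s1 (t1 + t2) s3
| ExIf a P Q s t s' :
    exec w (if eval_expr w s a != 0%N then P else Q) s t s' ->
    exec w (CIf a P Q) s (ecost a + t).+1 s'
| ExWhileF a P s : eval_expr w s a = 0%N ->
    exec w (CWhile a P) s (ecost a).+1 s
| ExWhileT a P s1 t1 s2 t2 s3 : eval_expr w s1 a != 0%N ->
    exec w P s1 t1 s2 -> exec w (CWhile a P) s2 t2 s3 ->
    exec w (CWhile a P) s1 (ecost a + t1 + t2).+1 s3.

(* A constant number of times the bit length of n * M; the constant is at least
   2 so that n, M, the number of edges (at most n ^ 2) and the weights always
   fit in a word. *)
Definition word_size (K n M : nat) : nat := (K.+2 * (trunc_log 2 (n * M)).+1)%N.

(* Input: n, the number of edges m and M in variables 0, 1, 2; the tail, head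
   and weight of the i-th listed edge at index i of arrays 0, 1, 2. *)
Definition input_state n (wt : 'I_n -> 'I_n -> nat) (M : nat)
    (es : seq ('I_n * 'I_n)) (r : seq bool) : state :=
  State (fun x => nth 0%N [:: n; size es; M] x)
        (fun a i => nth 0%N (nth [::]
           [:: [seq nat_of_ord uv.1 | uv <- es];
               [seq nat_of_ord uv.2 | uv <- es];
               [seq wt uv.1 uv.2 | uv <- es]] a) i)
        r.

(* Output: entry v of array 3 is the estimate for v, where 0 (which is never the
   weight of a cycle) encodes +oo. *)
Definition estimate (R : realType) (s : state) (v : nat) : \bar R :=
  if arrs s 3 v == 0%N then +oo%E else (arrs s 3 v)%:R%:E.

(* The bound C * m * sqrt n * log M * (log n) ^ k, with m + 1, M + 1 and n + 1
   in place of m, M and n so that no factor vanishes at m = 0, M = 1, n = 1. *)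
Definition time_bound (R : realType) (C k n m M : nat) : nat :=
  Num.truncn (C%:R * m.+1%:R * Num.sqrt n%:R * ln M.+1%:R * ln n.+1%:R ^+ k : R).

(* Probability of an event over N independent fair coins. Since every flip costs
   a step, N = T coins suffice for events about runs of at most T steps. *)
Definition coin_prob (R : realType) (N : nat) (E : N.-tuple bool -> Prop) : R :=
  #|[set r : N.-tuple bool | `[< E r >]]|%:R / 2 ^+ N.

(* Main.v *)
(* Sample about sqrt n (log n) edges at random and compute, by Dijkstra's
   algorithm in the graph and in its reverse, the distances between the tails r
   of these edges and all vertices. For a vertex u let D be the least round trip
   d(u,r) + d(r,u) with r <> u, and g the largest integer with 2 g < D. If
   D <= 2 SC(u), then D is a 2-approximation of SC(u). Otherwise SC(u) <= g, and
   a vertex v on a lightest cycle through u satisfies, for all r <> u,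
     d(u,v) + d(v,r) <= g + d(u,r)  and  g + d(u,v) < d(u,r) + d(r,v),
   because d(u,v) + d(v,u) <= g and 2 g < d(u,r) + d(r,u). Say that v survives r.
   All the vertices on a shortest path from u to v then survive r as well, so
   that a Dijkstra search from u which expands only the vertices surviving a
   given set of pivots r computes SC(u) exactly.
   The two conditions also show that v and r cannot survive each other. Scan the
   samples and keep as a pivot each one that survives the pivots kept so far:
   a new pivot eliminates on average half of the edges with a surviving tail.
   With high probability this leaves O(log n) pivots and O(m / sqrt n) edges
   with a surviving tail, which bounds the cost of the search from u. *)

Require Import Defs.
From mathcomp Require Import all_boot all_order all_algebra.
From mathcomp Require Import all_classical all_reals all_analysis.
From mathcomp Require Import zify lra.

Set Implicit Arguments.
Unset Strict Implicit.
Unset Printing Implicit Defensive.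

Import Order.TTheory GRing.Theory Num.Theory.

(** * Program logic *)

(** Correctness does not depend on the coins: every run that has enough coins for its draws outputs
    valid estimates, and chance only decides the running time. All coins are spent on the initial
    draws, so the good event is a set of draw sequences, and failures are counted by sums over
    sequences in the natural numbers. Three constraints shape the program. The time bound has a
    factor m but no factor n, so no work may be done once per vertex: the main loop runs over edges,
    and no array is ever cleared; each search gets a fresh region of zeros instead. Distances both
    to and from the samples are needed, so the graph is stored with a disjoint reversed copy, and
    one search procedure serves both directions. Distances are truncated at INF = 2 n M + 2, which
    exceeds twice the weight of any cycle, so unreachable vertices need no separate arithmetic. The
    threshold sqrt n balances two costs: testing about sqrt n samples against O(log n) pivots for
    each of at most m tails, and at most n searches over about m / sqrt n edges each. *)

Fixpoint ev (s : state) (a : expr) : nat :=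
  match a with
  | ELit k => k
  | EVar x => vars s x
  | EGet x i => arrs s x (ev s i)
  | EBin o a1 a2 => binop_sem o (ev s a1) (ev s a2)
  end.

(** The no-overflow condition under which the modular [eval_expr] coincides with [ev]. Comparisons
    yield 0 or 1 and so fit in any nonempty word; variables and array entries are read without
    reduction. *)
Fixpoint fits (W : nat) (s : state) (a : expr) : Prop :=
  match a with
  | ELit k => k < W
  | EVar x => True
  | EGet x i => fits W s i
  | EBin o a1 a2 =>
      fits W s a1 /\ fits W s a2 /\
      match o with
      | OpEq | OpLt => True
      | _ => binop_sem o (ev s a1) (ev s a2) < W
      end
  end.

Lemma eval_ev w s a : 0 < w -> fits (2 ^ w) s a -> eval_expr w s a = ev s a.
Proof.
move=> w0; have W1 : 1 < 2 ^ w by rewrite -{1}(expn0 2) ltn_exp2l.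
elim: a => [k|x|x i IH|o a1 IH1 a2 IH2] //=.
- exact: modn_small.
- by move=> /IH ->.
- move=> [/IH1 -> [/IH2 -> H]]; apply: modn_small.
  by case: o H => //= _; apply: leq_ltn_trans W1; case: (_ < _) => //; case: (_ == _).
Qed.

Fixpoint writes_var (P : cmd) (x : nat) : bool :=
  match P with
  | CSkip | CPut _ _ _ => false
  | CAssign y _ | CFlip y => x == y
  | CSeq P1 P2 | CIf _ P1 P2 => writes_var P1 x || writes_var P2 x
  | CWhile _ P1 => writes_var P1 x
  end.

Fixpoint writes_arr (P : cmd) (a : nat) : bool :=
  match P with
  | CSkip | CAssign _ _ | CFlip _ => false
  | CPut b _ _ => a == b
  | CSeq P1 P2 | CIf _ P1 P2 => writes_arr P1 a || writes_arr P2 a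
  | CWhile _ P1 => writes_arr P1 a
  end.

(** A syntactic frame property: specifications and loop invariants mention only what a command
    changes, and the rest is recovered by computing [writes_var] and [writes_arr]. *)
Definition frame (P : cmd) (s s' : state) : Prop :=
  (forall x, ~~ writes_var P x -> vars s' x = vars s x) /\
  (forall a i, ~~ writes_arr P a -> arrs s' a i = arrs s a i).

Lemma frame_refl P s : frame P s s.
Proof. by []. Qed.

Lemma frame_trans P s1 s2 s3 : frame P s1 s2 -> frame P s2 s3 -> frame P s1 s3.
Proof.
by move=> [v1 a1] [v2 a2]; split=> [x h|a i h];
  [rewrite v2 // v1|rewrite a2 // a1].
Qed.

Lemma frame_sub P Q s s' :
  (forall x, writes_var P x -> writes_var Q x) ->
  (forall a, writes_arr P a -> writes_arr Q a) -> frame P s s' -> frame Q s s'.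
Proof.
move=> hv ha [v a]; split=> [x h|b i h]; [apply: v|apply: a];
  by apply: contra h; auto.
Qed.

Lemma exec_frame w P s t s' : exec w P s t s' -> frame P s s'.
Proof.
elim=> {P s t s'}.
- by [].
- by move=> x a s; split=> //= y; case: eqP.
- by move=> x i a s; split=> //= y j; case: eqP.
- by move=> x s b r _; split=> //= y; case: eqP.
- move=> P Q s1 t1 s2 t2 s3 _ h1 _ h2; apply: (@frame_trans _ _ s2).
    by apply: frame_sub h1 => x /= ->.
  by apply: frame_sub h2 => x /= ->; rewrite orbT.
- move=> a P Q s t s' _; case: ifP => _; apply: frame_sub => x /= ->; by rewrite ?orbT.
- by [].
- by move=> a P s1 t1 s2 t2 s3 _ _ h1 _ h2; apply: frame_trans h2.
Qed.

Fixpoint flips (P : cmd) : bool :=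
  match P with
  | CSkip | CAssign _ _ | CPut _ _ _ => false
  | CFlip _ => true
  | CSeq P1 P2 | CIf _ P1 P2 => flips P1 || flips P2
  | CWhile _ P1 => flips P1
  end.

(** [frame] says nothing about coins. This carries the coin sequence unchanged through the
    deterministic phases that precede the sampling. *)
Lemma exec_coins w P s t s' : exec w P s t s' -> ~~ flips P -> coins s' = coins s.
Proof.
elim=> {P s t s'} //=.
- by move=> P Q s1 t1 s2 t2 s3 _ h1 _ h2; rewrite negb_or => /andP[/h1 <- /h2].
- move=> a P Q s t s' _ h; rewrite negb_or => /andP[hP hQ]; apply: h.
  by case: ifP.
- by move=> a P s1 t1 s2 t2 s3 _ _ h1 _ h2 h; rewrite h2 // h1.
Qed.

(** Total correctness in weakest-precondition style, with the cost as an argument of the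
    postcondition. *)
Definition wp (w : nat) (P : cmd) (s : state) (Q : nat -> state -> Prop) : Prop :=
  exists t s', exec w P s t s' /\ Q t s'.

Section Rules.
Variable w : nat.
Hypothesis w0 : 0 < w.
Local Notation W := (2 ^ w).

Lemma wp_frame P s (Q Q' : nat -> state -> Prop) :
  wp w P s Q -> (forall t s', frame P s s' -> Q t s' -> Q' t s') -> wp w P s Q'.
Proof.
by move=> [t [s' [h q]]] i; exists t, s'; split=> //; apply: i q; apply: exec_frame h.
Qed.

Lemma wp_coins P s (Q Q' : nat -> state -> Prop) : ~~ flips P ->
  wp w P s Q -> (forall t s', frame P s s' -> coins s' = coins s -> Q t s' -> Q' t s') ->
  wp w P s Q'.
Proof.
move=> f [t [s' [h q]]] i; exists t, s'; split=> //.
by apply: i q; [apply: exec_frame h|apply: exec_coins h f].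
Qed.

Lemma wp_skip s (Q : nat -> state -> Prop) : Q 1 s -> wp w CSkip s Q.
Proof. by move=> q; exists 1, s; split=> //; constructor. Qed.

Lemma wp_assign x a s (Q : nat -> state -> Prop) :
  fits W s a -> Q (ecost a).+1 (set_var s x (ev s a)) -> wp w (CAssign x a) s Q.
Proof. by move=> /(eval_ev w0) <- q; do 2 eexists; split; [constructor|]. Qed.

Lemma wp_put x i a s (Q : nat -> state -> Prop) :
  fits W s i -> fits W s a ->
  Q (ecost i + ecost a).+1 (set_arr s x (ev s i) (ev s a)) -> wp w (CPut x i a) s Q.
Proof.
by move=> /(eval_ev w0) <- /(eval_ev w0) <- q; do 2 eexists; split; [constructor|].
Qed.

Lemma wp_flip x s b r (Q : nat -> state -> Prop) : coins s = b :: r ->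
  Q 1 (set_var (State (vars s) (arrs s) r) x b) -> wp w (CFlip x) s Q.
Proof. by move=> e q; do 2 eexists; split; [apply: ExFlip e|]. Qed.

Lemma wp_seq P1 P2 s (Q : nat -> state -> Prop) :
  wp w P1 s (fun t1 s1 => wp w P2 s1 (fun t2 s2 => Q (t1 + t2) s2)) ->
  wp w (CSeq P1 P2) s Q.
Proof.
move=> [t1 [s1 [h1 [t2 [s2 [h2 q]]]]]]; exists (t1 + t2), s2; split=> //.
by apply: ExSeq h1 h2.
Qed.

Lemma wp_if a P1 P2 s (Q : nat -> state -> Prop) : fits W s a ->
  (ev s a != 0 -> wp w P1 s (fun t s' => Q (ecost a + t).+1 s')) ->
  (ev s a = 0 -> wp w P2 s (fun t s' => Q (ecost a + t).+1 s')) ->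
  wp w (CIf a P1 P2) s Q.
Proof.
move=> /(eval_ev w0) e h1 h2.
have [t [s' [h q]]] : wp w (if ev s a != 0 then P1 else P2) s
    (fun t s' => Q (ecost a + t).+1 s').
  by case: (eqVneq (ev s a) 0) => [/h2|/h1].
by exists (ecost a + t).+1, s'; split=> //; apply: ExIf; rewrite e.
Qed.

(* [k] is a variant and [t] is the time spent so far. *)
Lemma wp_while (I : nat -> nat -> state -> Prop) k0 a P s0 (Q : nat -> state -> Prop) :
  I k0 0 s0 ->
  (forall k t s, frame (CWhile a P) s0 s -> I k t s -> fits W s a /\
     (ev s a = 0 -> Q (t + (ecost a).+1) s) /\
     (ev s a != 0 -> wp w P s (fun t' s' => exists2 k', k' < k &
        I k' (t + (ecost a + t').+1) s'))) ->
  wp w (CWhile a P) s0 Q.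
Proof.
move=> i0 step.
suff main k : forall t s, frame (CWhile a P) s0 s -> I k t s ->
    exists t2 s', exec w (CWhile a P) s t2 s' /\ Q (t + t2) s'.
  exact: (main k0 0 s0 (frame_refl _ _) i0).
elim/ltn_ind: k => k IH t s f i.
have [/(eval_ev w0) e [qF qT]] := step _ _ _ f i.
case: (eqVneq (ev s a) 0) => [z|nz].
  by exists (ecost a).+1, s; split; [apply: ExWhileF; rewrite e|apply: qF].
have [t1 [s1 [h1 [k' lk i']]]] := qT nz.
have [|t2 [s2 [h2 q]]] := IH _ lk _ s1 _ i'.
  by apply: (frame_trans f); apply: (exec_frame h1).
exists (ecost a + t1 + t2).+1, s2; split; first by apply: ExWhileT h1 h2; rewrite e.
by have <- : t + (ecost a + t1).+1 + t2 = t + (ecost a + t1 + t2).+1 by lia.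
Qed.

End Rules.

(** * Pruned Dijkstra search *)

Declare Scope prog_scope.
Delimit Scope prog_scope with P.
Notation "# k" := (ELit k) (at level 8, k at level 2, format "# k") : prog_scope.
Notation "$ x" := (EVar x) (at level 8, x at level 2, format "$ x") : prog_scope.
Notation "a ^[ i ]" := (EGet a i) (at level 8, i at level 200) : prog_scope.
Notation "a + b" := (EBin OpAdd a b) : prog_scope.
Notation "a - b" := (EBin OpSub a b) : prog_scope.
Notation "a * b" := (EBin OpMul a b) : prog_scope.
Notation "a ./ b" := (EBin OpDiv a b) (at level 40) : prog_scope.
Notation "a =? b" := (EBin OpEq a b) (at level 70) : prog_scope.
Notation "a <? b" := (EBin OpLt a b) (at level 70) : prog_scope.
Notation "x ::= a" := (CAssign x a) (at level 75) : prog_scope.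
Notation "x ^[ i ] ::= a" := (CPut x i a)
  (at level 8, i at level 200, a at level 74) : prog_scope.
Notation "P ;; Q" := (CSeq P Q) (at level 80, right associativity) : prog_scope.
Notation "'IF' a 'THEN' P 'ELSE' Q 'FI'" := (CIf a P Q) (at level 8, a at level 200) : prog_scope.
Notation "'IF' a 'THEN' P 'FI'" := (CIf a P CSkip) (at level 8, a at level 200) : prog_scope.
Notation "'WHILE' a 'DO' P 'OD'" := (CWhile a P) (at level 8, a at level 200) : prog_scope.

Notation xN := 0 (only parsing).
Notation xM := 1 (only parsing).
Notation xMax := 2 (only parsing).
Notation xInf := 3 (only parsing).
Notation xV := 4 (only parsing).
Notation xCnt := 5 (only parsing).
Notation xBase := 6 (only parsing).
Notation xSrc := 7 (only parsing).
Notation xX := 8 (only parsing).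
Notation xCX := 9 (only parsing).
Notation xFlag := 10 (only parsing).
Notation xE := 11 (only parsing).
Notation xY := 12 (only parsing).
Notation xI := 14 (only parsing).
Notation xVal := 15 (only parsing).
Notation xK := 16 (only parsing).
Notation xL := 17 (only parsing).
Notation xU := 18 (only parsing).
Notation xG := 19 (only parsing).
Notation xB := 20 (only parsing).
Notation xJ := 21 (only parsing).
Notation xS := 22 (only parsing).
Notation xLg := 23 (only parsing).
Notation xDraws := 24 (only parsing).
Notation xPow := 25 (only parsing).
Notation xRnd := 26 (only parsing).
Notation xCoin := 27 (only parsing).
Notation xEdge := 28 (only parsing).
Notation xD := 29 (only parsing).
Notation aTail := 0 (only parsing).
Notation aHead := 1 (only parsing).
Notation aWt := 2 (only parsing).
Notation aOut := 3 (only parsing).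
Notation aFst := 4 (only parsing).
Notation aNxt := 5 (only parsing).
Notation aDst := 6 (only parsing).
Notation aW := 7 (only parsing).
Notation aC := 8 (only parsing).
Notation aT := 9 (only parsing).
Notation aSmp := 10 (only parsing).
Notation aR := 11 (only parsing).
Notation aSeen := 12 (only parsing).

Open Scope prog_scope.

(* The tournament tree aT has its leaves at V, ..., 2 V - 1 and its root at 1;
   each node i < V holds the maximum of nodes 2 i and 2 i + 1, for any V > 0. All
   arrays start at 0, so a distance x is stored as INF - x: then 0 stands for an
   unreached vertex, and the queue extracts a maximum. *)
Definition tree_set : cmd :=
  xI ::= $xV + $xY ;;
  aT^[$xI] ::= $xVal ;;
  xI ::= $xI ./ #2 ;;
  WHILE $xI DO
    IF aT^[#2 * $xI] <? aT^[#2 * $xI + #1]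
    THEN aT^[$xI] ::= aT^[#2 * $xI + #1]
    ELSE aT^[$xI] ::= aT^[#2 * $xI] FI ;;
    xI ::= $xI ./ #2
  OD.

Definition tree_argmax : cmd :=
  xI ::= #1 ;;
  WHILE $xI <? $xV DO
    IF aT^[#2 * $xI] <? aT^[$xI]
    THEN xI ::= #2 * $xI + #1
    ELSE xI ::= #2 * $xI FI
  OD ;;
  xX ::= $xI - $xV.

(* A pivot r is represented in aR by the base address b of its distances: aC
   holds INF - d(r,x) at b + x and INF - d(x,r) at b + V + (n + x). *)
Definition test_vertex : cmd :=
  xFlag ::= #1 ;;
  xL ::= #0 ;;
  WHILE $xL <? $xK DO
    xB ::= aR^[$xL] ;;
    IF ($xG + ($xInf - aC^[$xB + $xV + $xN + $xU])) <?
       (($xInf - $xCX) + ($xInf - aC^[$xB + $xV + $xN + $xX]))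
    THEN xFlag ::= #0 FI ;;
    IF ($xG + ($xInf - $xCX)) <?
       (($xInf - aC^[$xB + $xV + $xN + $xU]) + ($xInf - aC^[$xB + $xX]))
    THEN CSkip ELSE xFlag ::= #0 FI ;;
    xL ::= $xL + #1
  OD.

Definition relax_edge : cmd :=
  xY ::= aDst^[$xE - #1] ;;
  xVal ::= $xCX - aW^[$xE - #1] ;;
  IF aC^[$xBase + $xY] <? $xVal
  THEN aC^[$xBase + $xY] ::= $xVal ;; tree_set FI ;;
  xE ::= aNxt^[$xE - #1].

(* The region of aC from xBase on must be 0 initially. Weights are positive, so an
   extracted vertex is never improved later and needs no mark. *)
Definition search : cmd :=
  xY ::= $xSrc ;;
  xVal ::= $xInf ;;
  tree_set ;;
  aC^[$xBase + $xSrc] ::= $xInf ;;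
  WHILE aT^[#1] DO
    xCX ::= aT^[#1] ;;
    tree_argmax ;;
    xY ::= $xX ;;
    xVal ::= #0 ;;
    tree_set ;;
    test_vertex ;;
    IF $xFlag
    THEN xE ::= aFst^[$xX] ;; WHILE $xE DO relax_edge OD FI
  OD.

Close Scope prog_scope.

(** * The tournament tree *)

Section Heap.
Variable V : nat.

Definition heap (T f : nat -> nat) : Prop :=
  (forall v, v < V -> T (V + v) = f v) /\
  (forall i, 0 < i < V -> T i = maxn (T (2 * i)) (T (2 * i).+1)).

Lemma heap_le T f i : heap T f -> 0 < i < 2 * V -> T i <= T 1.
Proof.
move=> [_ h]; elim/ltn_ind: i => i IH hi.
have [->//|i1] : i = 1 \/ 1 < i by lia.
apply: (@leq_trans (T (i %/ 2))); last by apply: IH; lia.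
rewrite (h (i %/ 2)) //; last by lia.
have [e|e] : i = 2 * (i %/ 2) \/ i = (2 * (i %/ 2)).+1 by lia.
  by rewrite -e leq_maxl.
by rewrite -e leq_maxr.
Qed.

Lemma heap_root T f v : heap T f -> v < V -> f v <= T 1.
Proof. by move=> h hv; case: (h) => <- // _; apply: (heap_le h); lia. Qed.

Lemma heap_ext T T' f f' : heap T f -> (forall i, T' i = T i) ->
  (forall v, v < V -> f' v = f v) -> heap T' f'.
Proof.
by move=> [h1 h2] eT ef; split=> [v hv|i hi]; rewrite !eT ?h1 ?ef // h2.
Qed.

Definition upd (f : nat -> nat) y a := fun v => if v == y then a else f v.

End Heap.

Section Tree.
Variables (w V lg : nat).
Hypotheses (w0 : 0 < w) (V0 : 0 < V) (VW : 4 * V < 2 ^ w) (Vlg : 2 * V <= 2 ^ lg).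

Lemma tree_set_spec s f : vars s xV = V -> vars s xY < V -> heap V (arrs s aT) f ->
  wp w tree_set s (fun t s' => heap V (arrs s' aT) (upd f (vars s xY) (vars s xVal)) /\
     t <= 40 * lg.+1).
Proof.
move=> sV sY [hl hi]; rewrite /tree_set.
set y := vars s xY in sY *; set a := vars s xVal.
have lgW : lg <= 2 ^ lg by apply/ltnW/ltn_expl.
apply: wp_seq; apply: wp_assign => //=; first by rewrite sV; lia.
apply: wp_seq; apply: wp_put => //=; apply: wp_seq; apply: wp_assign => //=; first by rewrite sV; split; lia.
rewrite sV -/y -/a.
(* After a leaf is overwritten only its ancestors can violate the heap equation, and the ancestors
   of p, with p itself, are the quotients p / 2 ^ k. Once p reaches 0 no violating node is left in
   the range. *)
pose broken (T : nat -> nat) p := forall i, 0 < i < V ->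
  T i = maxn (T (2 * i)) (T (2 * i).+1) \/ exists k, i = p %/ 2 ^ k.
apply: (@wp_while _ w0 (fun k t s' => [/\ vars s' xI < 2 ^ k, vars s' xI < V,
   broken (arrs s' aT) (vars s' xI),
   forall v, v < V -> arrs s' aT (V + v) = upd f y a v & t + 27 * k <= 27 * lg]) lg).
  rewrite /=; split; rewrite ?eqxx; try lia.
  - move=> i hV; case: (eqVneq i ((V + y) %/ 2)) => [->|ne].
      by right; exists 0; rewrite expn0 divn1.
    left; do 3 (case: eqP => [|_]; first by lia); exact: hi.
  - move=> v hv; rewrite /upd eqn_add2l; case: eqP => // _; exact: hl.
move=> k t s' _ [hk hV hb hv ht] /=; split=> //.
have W1 : 4 * V < 2 ^ w by [].
split=> [z|nz].
  split; last by lia.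
  split=> [|i i0]; first exact: hv.
  have [//|[j e]] := hb i i0.
  by move: i0; rewrite e z div0n ltnn.
case: k hk ht => [|k] hk ht; first by rewrite expn0 in hk; lia.
have st (T' : nat -> nat) : (forall j, T' j = if j == vars s' xI
    then maxn (arrs s' aT (2 * vars s' xI)) (arrs s' aT (2 * vars s' xI).+1)
    else arrs s' aT j) ->
   broken T' (vars s' xI %/ 2) /\ (forall v, v < V -> T' (V + v) = upd f y a v).
  move=> eT; split; last by move=> v hvV; rewrite eT; case: eqP => [|_]; [lia|exact: hv].
  move=> i i0; rewrite !eT.
  case: (eqVneq i (vars s' xI)) => [->|ne]; first by left; do 2 (case: eqP => [|_]; first by lia).
  case: (eqVneq i (vars s' xI %/ 2)) => [->|ne2].
    by right; exists 0; rewrite expn0 divn1.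
  do 2 (case: eqP => [|_]; first by lia).
  have [->|[[|j] e]] := hb i i0; [by left|by move: ne; rewrite e expn0 divn1 eqxx|].
  by right; exists j; rewrite -divnMA -expnS.
have hk2 : vars s' xI %/ 2 < 2 ^ k by rewrite expnS in hk; lia.
apply: wp_seq => //; apply: wp_if => //=.
- by repeat split; lia.
- move=> lt; apply: wp_put => //=; [by repeat split; lia|].
  apply: wp_assign => //=; first by split; lia.
  have [|b1 b2] := st (fun j => if j == vars s' xI then arrs s' aT (2 * vars s' xI + 1) else arrs s' aT j).
    by move=> j; case: eqP => // _; rewrite addn1 in lt *; lia.
  by exists k => //; split=> //; lia.
- move=> lt; apply: wp_put => //=; [by repeat split; lia|].
  apply: wp_assign => //=; first by split; lia.
  have [|b1 b2] := st (fun j => if j == vars s' xI then arrs s' aT (2 * vars s' xI) else arrs s' aT j).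
    by move=> j; case: eqP => // _; rewrite addn1 in lt; lia.
  by exists k => //; split=> //; lia.
Qed.

Lemma tree_argmax_spec s f : vars s xV = V -> heap V (arrs s aT) f ->
  wp w tree_argmax s (fun t s' => [/\ vars s' xX < V, f (vars s' xX) = arrs s aT 1 &
     t <= 40 * lg.+1]).
Proof.
move=> sV h; rewrite /tree_argmax.
apply: wp_seq; apply: wp_assign => //=; first by lia.
apply: wp_seq.
(* The descent keeps to nodes that carry the value of the root. Each step at least doubles the node
   index, so [2 * V <= 2 ^ k * i] makes k a bound on the remaining steps. *)
apply: (@wp_while _ w0 (fun k t s' => [/\ 0 < vars s' xI < 2 * V,
   2 * V <= 2 ^ k * vars s' xI, arrs s aT (vars s' xI) = arrs s aT 1 & t + 27 * k <= 27 * lg]) lg).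
  by rewrite /=; split; lia.
move=> k t s' [fv fa] [hi hk he ht].
have eV : vars s' xV = V by rewrite fv.
have eT i : arrs s' aT i = arrs s aT i by rewrite fa.
case: h => [h1 h2].
rewrite /= eV; split=> //; split.
  move=> ge; apply: wp_assign; [exact: w0|by rewrite /= eV; lia|].
  rewrite /= eV; split; [by lia| |by lia].
  by rewrite -h1; [rewrite -he; congr (arrs _ _ _); lia|lia].
move=> lt.
case: k hk ht => [|k] hk ht; first by rewrite expn0 in hk; lia.
apply: wp_if => //=; first by repeat split; lia.
  rewrite !eT => lt2; apply: wp_assign => //=; first by repeat split; lia.
  exists k => //; rewrite /= addn1; split; try lia.
    by move: hk; rewrite expnS; nia.
  by rewrite -he (h2 (vars s' xI)) in lt2 *; lia.
rewrite !eT => lt2; apply: wp_assign => //=; first by repeat split; lia.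
exists k => //; rewrite /=; split; try lia.
  by move: hk; rewrite expnS; nia.
by rewrite -he (h2 (vars s' xI)) in lt2 *; lia.
Qed.

End Tree.

(** * The survival test as computed from the arrays *)

Section Passes.
Variables n V INF : nat.

(** This is [survives] with every distance decoded from its stored closeness; the entries at b + V +
    n + x come from the reversed copy and give distances to the pivot. [passes_pivots] makes the
    identification. *)
Definition passes1 (C : nat -> nat) u g x cx b : bool :=
  ((INF - cx) + (INF - C (b + V + n + x)) <= g + (INF - C (b + V + n + u))) &&
  (g + (INF - cx) < (INF - C (b + V + n + u)) + (INF - C (b + x))).

Definition passes (C R : nat -> nat) K u g x cx : bool :=
  all (fun k => passes1 C u g x cx (R k)) (iota 0 K).

Lemma passesS C R K u g x cx : passes C R K.+1 u g x cx =
  passes C R K u g x cx && passes1 C u g x cx (R K).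
Proof. by rewrite /passes -addn1 iotaD all_cat /= andbT. Qed.

Definition params (s : state) K u g : Prop :=
  [/\ vars s xN = n, vars s xV = V, vars s xInf = INF, vars s xK = K &
      vars s xU = u /\ vars s xG = g].

(** A search writes to the same array [C] from which its test reads. The test only looks at the
    blocks of the pivots, which lie below the region being written, so its outcome is stable during
    the search. *)
Lemma passes_ext (C C' R R' : nat -> nat) K u g x cx :
  (forall k, k < K -> R' k = R k) ->
  (forall k j, k < K -> j < V + n -> C' (R k + V + j) = C (R k + V + j)) ->
  (forall k j, k < K -> j < V -> C' (R k + j) = C (R k + j)) ->
  n <= V -> u < n -> x < n ->
  passes C' R' K u g x cx = passes C R K u g x cx.
Proof.
move=> eR eC1 eC2 nV un xn; apply: eq_in_all => k; rewrite mem_iota /= add0n => kK.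
rewrite /passes1 eR // -!addnA (addnA (R k) V).
by rewrite (addnA (R k) V (n + u)) !eC1 ?eC2 //; lia.
Qed.

End Passes.

Section Test.
Variables (w n V INF : nat).
Hypotheses (w0 : 0 < w) (INFW : 4 * INF < 2 ^ w).

Lemma test_spec s K u g : params n V INF s K u g -> g <= INF -> K < 2 ^ w ->
  (forall k, k < K -> arrs s aR k + V + n + (vars s xX + u) < 2 ^ w) ->
  wp w test_vertex s (fun t s' =>
    vars s' xFlag = passes n V INF (arrs s aC) (arrs s aR) K u g (vars s xX) (vars s xCX)
    /\ t <= 90 * K.+1).
Proof.
move=> [sN sV sI sK [sU sG]] gI KW RW; rewrite /test_vertex.
have W1 : 1 < 2 ^ w by rewrite -{1}(expn0 2) ltn_exp2l.
apply: wp_seq; apply: wp_assign => //=; apply: wp_seq; apply: wp_assign => //=; first by lia.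
apply: (@wp_while _ w0 (fun k t s' => [/\ vars s' xL + k = K, t + 90 * k <= 90 * K &
  vars s' xFlag = passes n V INF (arrs s aC) (arrs s aR) (vars s' xL) u g (vars s xX) (vars s xCX)]) K).
  by rewrite /= /passes; split; lia.
move=> k t s1 [fv fa] [hk ht hf] /=.
have := fv xK isT; have := fv xV isT; have := fv xInf isT; have := fv xN isT.
have := fv xU isT; have := fv xG isT; have := fv xX isT; have := fv xCX isT.
have aCE i : arrs s1 aC i = arrs s aC i by rewrite fa.
have aRE i : arrs s1 aR i = arrs s aR i by rewrite fa.
rewrite /= sN sV sI sK sU sG => eCX eX eG eU eN eI eV eK.
split=> //; rewrite eK; split.
  move=> z; have e : vars s1 xL = K by lia.
  by rewrite hf e; split=> //; lia.
move=> nz; have lK : vars s1 xL < K by lia.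
have := RW _ lK; set x := vars s xX in hf eX *; set cx := vars s xCX in hf eCX * => RWl.
apply: wp_seq; apply: wp_assign => //=.
rewrite aRE; set b := arrs s aR (vars s1 xL) in RWl *.
have hf' := passesS n V INF (arrs s aC) (arrs s aR) (vars s1 xL) u g x cx.
rewrite -/b /passes1 in hf'.
move: hf'; have := leq_subr cx INF; have := leq_subr (arrs s aC (b + V + n + u)) INF.
have := leq_subr (arrs s aC (b + V + n + x)) INF; have := leq_subr (arrs s aC (b + x)) INF.
set p1 := INF - cx; set p2 := INF - arrs s aC (b + V + n + u).
set p3 := INF - arrs s aC (b + V + n + x); set p4 := INF - arrs s aC (b + x).
move=> l4 l3 l2 l1 hf'.
have k1 : k.-1 < k by lia.
have k2 : vars s1 xL + 1 + k.-1 = K by lia.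
have finish c L (F : nat) : c <= 89 -> L = vars s1 xL + 1 ->
    F = passes n V INF (arrs s aC) (arrs s aR) (vars s1 xL).+1 u g x cx ->
    exists2 k', k' < k & [/\ L + k' = K, t + c.+1 + 90 * k' <= 90 * K &
      F = passes n V INF (arrs s aC) (arrs s aR) L u g x cx].
  by move=> c89 eL eF; exists k.-1 => //; rewrite eL; split=> //; [lia|rewrite addn1].
apply: wp_seq; apply: wp_if => //=; rewrite ?eV ?eN ?eU ?eX ?eI ?eG ?eCX ?aCE -/p1 -/p2 -/p3 -/p4.
- clear - RWl l1 l2 l3 l4 INFW gI W1; do ![split]; lia.
- move=> c1; apply: wp_assign => //=; first by lia.
  apply: wp_seq; apply: wp_if => //=; rewrite ?eV ?eN ?eU ?eX ?eI ?eG ?eCX ?aCE -/p1 -/p2 -/p3 -/p4.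
  + clear - RWl l1 l2 l3 l4 INFW gI W1; do ![split]; lia.
  + move=> c2; apply: wp_skip; apply: wp_assign => //=; first by split; lia.
    apply: finish => //=; rewrite hf' leqNgt; by move: c1; case: (_ < _); rewrite ?andbF.
  + move=> c2; apply: wp_assign => //=; first by lia.
    apply: wp_assign => //=; first by split; lia.
    by apply: finish => //=; rewrite hf' leqNgt; move: c1; case: (_ < _); rewrite ?andbF.
- move=> c1; apply: wp_skip.
  apply: wp_seq; apply: wp_if => //=; rewrite ?eV ?eN ?eU ?eX ?eI ?eG ?eCX ?aCE -/p1 -/p2 -/p3 -/p4.
  + clear - RWl l1 l2 l3 l4 INFW gI W1; do ![split]; lia.
  + move=> c2; apply: wp_skip; apply: wp_assign => //=; first by split; lia.
    have n1 : (g + p2 < p1 + p3) = false by case: (_ < _) c1.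
    have n2 : g + p1 < p2 + p4 by case: (_ < _) c2.
    by apply: finish => //=; rewrite hf' hf leqNgt n1 n2 !andbT.
  + move=> c2; apply: wp_assign => //=; first by lia.
    apply: wp_assign => //=; first by split; lia.
    by apply: finish => //=; rewrite hf'; move: c2; case: (_ < _); rewrite ?andbF.
Qed.

End Test.

(** * Walks, linked lists and the Dijkstra invariant *)

Inductive walk (out : nat -> seq (nat * nat)) (u : nat) : nat -> nat -> Prop :=
| walk_nil : walk out u u 0
| walk_snoc v x a l : walk out u v a -> (x, l) \in out v -> walk out u x (a + l).

(** A linked list in an array. A pointer is the index of a cell plus one, so 0 is the null pointer
    and zero-initialized arrays hold empty lists. *)
Fixpoint chain (nx : nat -> nat) (h : nat) (L : seq nat) : Prop :=
  match L with
  | [::] => h = 0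
  | i :: L' => h = i.+1 /\ chain nx (nx i) L'
  end.

Section Dijkstra.
Variables (V INF src : nat) (out : nat -> seq (nat * nat)) (P : nat -> nat -> bool).
Hypothesis outP : forall v y l, v < V -> (y, l) \in out v -> y < V /\ 0 < l.

(* [c] is the closeness INF - distance, [D] lists the extracted vertices, and
   [E z] is the part of [out z] that has been relaxed already. *)
Record dijkstra_inv (E : nat -> seq (nat * nat)) (c : nat -> nat) (D : seq nat) :=
  DijkstraInv {
    dij_src : c src = INF;
    dij_sound : forall v, v < V -> 0 < c v -> c v <= INF /\ walk out src v (INF - c v);
    dij_done : uniq D /\ forall x, x \in D -> x < V /\ 0 < c x;
    dij_mono : forall x y, x \in D -> y < V -> y \notin D -> c y <= c x;
    dij_relaxed : forall x y l, x \in D -> P x (c x) -> (y, l) \in E x ->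
      c x - l <= c y;
    dij_parent : forall y, y < V -> 0 < c y -> y = src \/
      exists x, [/\ x \in D, P x (c x) & y \in unzip1 (out x)] }.

(** The queue maximum has the largest closeness outside [D], as [dij_mono] requires of a new member.
    None of its edges is relaxed yet: the empty list at x is the starting value of the prefix [pre]
    in the relaxation lemmas. *)
Lemma dijkstra_extract c D x : dijkstra_inv out c D -> x < V -> x \notin D ->
  0 < c x -> (forall y, y < V -> y \notin D -> c y <= c x) ->
  dijkstra_inv (fun z => if z == x then [::] else out z) c (x :: D).
Proof.
move=> [i1 i2 [i3 i4] i5 i6 i7] xV xD cx0 top; split=> //.
- split; first by rewrite /= xD.
  by move=> z; rewrite inE => /orP[/eqP -> //|/i4].
- move=> z y; rewrite !inE negb_or => /orP[/eqP ->|zD] yV /andP[_ yD]; first exact: top.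
  exact: i5.
- move=> z y l /=; case: (eqVneq z x) => [->|zx]; rewrite // inE (negbTE zx); exact: i6.
- move=> y yV cy0; have [->|[z [zD pz yz]]] := i7 y yV cy0; first by left.
  by right; exists z; rewrite inE zD orbT.
Qed.

Lemma dijkstra_skip c D x : dijkstra_inv (fun z => if z == x then [::] else out z) c (x :: D) ->
  ~~ P x (c x) -> dijkstra_inv out c (x :: D).
Proof.
move=> [i1 i2 i3 i4 i5 i6] px; split=> // z y l zD pz.
have /= := i5 z y l zD pz; case: (eqVneq z x) => // zx.
by rewrite zx (negbTE px) in pz.
Qed.

Lemma dijkstra_relax_none c D x pre y l :
  dijkstra_inv (fun z => if z == x then pre else out z) c (x :: D) -> c x - l <= c y ->
  dijkstra_inv (fun z => if z == x then rcons pre (y, l) else out z) c (x :: D).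
Proof.
move=> [i1 i2 i3 i4 i5 i6] le; split=> // z y' l' zD pz.
have /= := i5 z y' l' zD pz; case: (eqVneq z x) => // -> h; rewrite mem_rcons inE.
by case/orP=> [/eqP[-> ->] //|/h].
Qed.

(** A strict improvement can only concern a vertex still outside the extracted set, because every
    extracted vertex has closeness at least c x, while y has less than c x - l. Hence the closeness
    of extracted vertices is final. *)
Lemma dijkstra_relax c D x pre y l :
  dijkstra_inv (fun z => if z == x then pre else out z) c (x :: D) ->
  P x (c x) -> (y, l) \in out x -> (forall z, z \in D -> c x <= c z) ->
  c y < c x - l ->
  y \notin x :: D /\
  dijkstra_inv (fun z => if z == x then rcons pre (y, l) else out z)
    (upd c y (c x - l)) (x :: D).
Proof.
move=> [i1 i2 [i3 i4] i5 i6 i7] px yx top lt.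
have [xV cx0] := i4 x (mem_head _ _).
have [yV l0] := outP xV yx.
have yD : y \notin x :: D.
  rewrite inE negb_or; apply/andP; split.
    by apply/eqP => e; move: lt; rewrite e; lia.
  by apply/negP => /top; lia.
split=> //.
have cE z : z \in x :: D -> upd c y (c x - l) z = c z.
  by rewrite /upd => zD; case: eqP => // e; rewrite -e zD in yD.
have cge z : c z <= upd c y (c x - l) z by rewrite /upd; case: eqP => // ->; lia.
split=> //.
(* The source is never improved: its closeness INF already bounds all the others. *)
- rewrite /upd; case: (eqVneq src y) => // e.
  by have [] := i2 x xV cx0; rewrite -e i1 in lt; lia.
- move=> v vV; rewrite /upd; case: (eqVneq v y) => [-> _|_]; last exact: i2.
  have [le wk] := i2 x xV cx0; split; first by lia.
  have -> : INF - (c x - l) = (INF - c x) + l by lia.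
  exact: walk_snoc wk yx.
- by split=> // z zD; rewrite cE //; exact: i4.
- move=> z v zD vV vD; rewrite (cE z zD) /upd; case: (eqVneq v y) => [_|_]; last exact: i5.
  suff : c x <= c z by lia.
  by move: zD; rewrite inE => /orP[/eqP -> //|/top].
- move=> z v l' zD; rewrite (cE z zD) => pz.
  case: (eqVneq z x) => [->|zx].
    rewrite mem_rcons inE => /orP[/eqP [-> ->]|vp]; first by rewrite /upd eqxx.
    by apply: leq_trans (cge v); apply: i6 => //; rewrite ?mem_head ?eqxx.
  move=> vz; apply: leq_trans (cge v); apply: i6 => //.
  by rewrite (negbTE zx).
- move=> v vV; rewrite /upd; case: (eqVneq v y) => [-> _|_ cv0].
    right; exists x; rewrite ?mem_head -/(upd _ _ _ _) cE ?mem_head //; split=> //.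
    by apply/mapP; exists (y, l).
  have [->|[z [zD pz vz]]] := i7 v vV cv0; first by left.
  by right; exists z; rewrite -/(upd _ _ _ _) cE.
Qed.

Lemma dijkstra_done c D x :
  dijkstra_inv (fun z => if z == x then out x else out z) c (x :: D) ->
  dijkstra_inv out c (x :: D).
Proof.
move=> [i1 i2 i3 i4 i5 i6]; split=> // z y l zD pz yz.
by apply: i5 => //=; case: (eqVneq z x) => // <-.
Qed.

(** By [dij_parent] every extracted vertex other than the source is the head of an edge out of an
    expanded vertex. So all extractions, even those of vertices that fail the test, are charged to
    scanned edges, plus one for the source. *)
Lemma dijkstra_size c D : dijkstra_inv out c D -> (forall v, v < V -> v \notin D -> c v = 0) ->
  size D <= (\sum_(x <- D | P x (c x)) size (out x)).+1.
Proof.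
move=> [i1 i2 [i3 i4] i5 i6 i7] all0.
have -> : \sum_(x <- D | P x (c x)) size (out x) =
  size (flatten [seq unzip1 (out x) | x <- D & P x (c x)]).
  rewrite size_flatten /shape -map_comp sumnE big_map big_filter.
  by apply: eq_bigr => z _; rewrite /= size_map.
rewrite -[_.+1]/(size (src :: _)); apply: uniq_leq_size => // y yD.
have [yV cy] := i4 y yD.
have [->|[z [zD pz yz]]] := i7 y yV cy; first exact: mem_head.
rewrite inE; apply/orP; right; apply/flattenP; exists (unzip1 (out z)) => //.
by apply/mapP; exists z => //; rewrite mem_filter pz.
Qed.

End Dijkstra.

(** * Correctness and cost of the search program *)

Section Search.
Variables (w n V INF lg : nat) (out : nat -> seq (nat * nat)).
Hypotheses (w0 : 0 < w) (INF0 : 0 < INF) (INFW : 4 * INF < 2 ^ w) (V0 : 0 < V) (VW : 4 * V < 2 ^ w)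
  (Vlg : 2 * V <= 2 ^ lg) (nV : 2 * n = V).
Hypothesis outP : forall v y l, v < V -> (y, l) \in out v -> y < V /\ 0 < l.

Definition adjacency (s : state) : Prop :=
  exists L : nat -> seq nat, forall v, v < V ->
    [/\ chain (arrs s aNxt) (arrs s aFst v) (L v), all (fun i => i < 2 ^ w) (L v) &
        out v = [seq (arrs s aDst i, arrs s aW i) | i <- L v]].

(** All that pruning leaves of Dijkstra's guarantee: values come from walks, and edges out of
    passing vertices are relaxed. Minimality is not part of it; [search_exact] derives it where it
    holds. *)
Definition search_result src (P : nat -> nat -> bool) (F : nat -> nat) : Prop :=
  [/\ F src = INF,
      forall v, v < V -> 0 < F v -> F v <= INF /\ walk out src v (INF - F v) &
      forall x y l, x < V -> 0 < F x -> P x (F x) -> (y, l) \in out x -> F x - l <= F y].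

Definition search_size (P : nat -> nat -> bool) (F : nat -> nat) : nat :=
  \sum_(x <- iota 0 V | (0 < F x) && P x (F x)) size (out x).

Lemma relax_loop_spec (P : nat -> nat -> bool) s src D x base Lx :
  vars s xV = V -> vars s xBase = base -> base + V < 2 ^ w ->
  vars s xCX = arrs s aC (base + x) ->
  chain (arrs s aNxt) (vars s xE) Lx -> all (fun i => i < 2 ^ w) Lx ->
  out x = [seq (arrs s aDst i, arrs s aW i) | i <- Lx] ->
  heap V (arrs s aT) (fun v => if v \in x :: D then 0 else arrs s aC (base + v)) ->
  dijkstra_inv V INF src out P (fun z => if z == x then [::] else out z)
    (fun v => arrs s aC (base + v)) (x :: D) ->
  P x (arrs s aC (base + x)) ->
  (forall z, z \in D -> arrs s aC (base + x) <= arrs s aC (base + z)) ->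
  wp w (CWhile (EVar xE) relax_edge) s (fun t s' =>
    [/\ heap V (arrs s' aT) (fun v => if v \in x :: D then 0 else arrs s' aC (base + v)),
        dijkstra_inv V INF src out P out (fun v => arrs s' aC (base + v)) (x :: D),
        forall z, z \in x :: D -> arrs s' aC (base + z) = arrs s aC (base + z),
        forall i, i < base \/ base + V <= i -> arrs s' aC i = arrs s aC i &
        t <= size (out x) * (40 * lg.+1 + 60) + 2]).
Proof.
move=> sV sB bW sCX chx allx outx heap0 dij0 px top0.
set tU := 40 * lg.+1.
(* [pre] is the part of [out x] already relaxed, and [Lq] lists the cells still to be visited from
   the current pointer. *)
pose inv k t s' := exists pre Lq, [/\ size Lq = k,
   [/\ out x = pre ++ [seq (arrs s aDst i, arrs s aW i) | i <- Lq],
     chain (arrs s aNxt) (vars s' xE) Lq & all (fun i => i < 2 ^ w) Lq],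
   heap V (arrs s' aT) (fun v => if v \in x :: D then 0 else arrs s' aC (base + v)) /\
   dijkstra_inv V INF src out P (fun z => if z == x then pre else out z)
     (fun v => arrs s' aC (base + v)) (x :: D),
   (forall z, z \in x :: D -> arrs s' aC (base + z) = arrs s aC (base + z)) /\
     (forall i, i < base \/ base + V <= i -> arrs s' aC i = arrs s aC i) &
   t + k * (tU + 60) <= size (out x) * (tU + 60)].
apply: (@wp_while _ w0 inv (size Lx)).
  by exists [::], Lx; split=> //; rewrite outx size_map.
move=> k t s1 [fv fa] [pre [Lq [sq [oq cq aq] [hq dq] [Cq Cout] tq]]] /=; split=> //.
have eV : vars s1 xV = V by rewrite fv.
have eB : vars s1 xBase = base by rewrite fv.
have eCX : vars s1 xCX = arrs s aC (base + x) by rewrite fv.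
have eD i : arrs s1 aDst i = arrs s aDst i by rewrite fa.
have eW i : arrs s1 aW i = arrs s aW i by rewrite fa.
have eNx i : arrs s1 aNxt i = arrs s aNxt i by rewrite fa.
split=> [z|].
  have Lq0 : Lq = [::] by case: Lq cq {sq oq aq} => //= i Lq []; rewrite z.
  split=> //; last by lia.
  apply: dijkstra_done; move: oq; rewrite Lq0 cats0 => ->; exact: dq.
case: Lq sq oq cq aq => [|i Lq] //=; first by move=> _ _ -> _; rewrite eqxx.
move=> sq oq [xEi cq] /andP[iW aq] _; rewrite /relax_edge.
set y := arrs s aDst i; set l := arrs s aW i in oq *; set cx := arrs s aC (base + x) in eCX *.
have W1 : 1 < 2 ^ w by rewrite -{1}(expn0 2) ltn_exp2l.
have yx : (y, l) \in out x by rewrite oq mem_cat mem_head orbT.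
have xD : x \in x :: D := mem_head _ _.
have [dx0 dx1] := dij_done dq; have [xV cx0] := dx1 x xD.
have [yV l0] := outP xV yx.
have cxle : cx <= INF by have [] := dij_sound dq xV cx0; rewrite Cq.
rewrite /= Cq // -/cx in cx0.
apply: wp_seq; apply: wp_assign => //=; first by rewrite xEi; lia.
rewrite xEi subn1 /= eD -/y.
apply: wp_seq; apply: wp_assign => //=; first by rewrite xEi /= eCX subn1 /= eW; lia.
rewrite xEi subn1 /= eCX eW -/l.
have Pq : P x (arrs s1 aC (base + x)) by rewrite Cq.
have tq' : k.-1 < k by lia.
have tt c : c <= tU + 60 -> t + c + k.-1 * (tU + 60) <= size (out x) * (tU + 60).
  by move=> h; apply: leq_trans tq; rewrite -sq /= mulSn; lia.
have sizes : size Lq = k.-1 by rewrite -sq.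
apply: wp_seq; apply: wp_if => //=; rewrite ?eB; first by lia.
- move=> lt; have lt' : arrs s1 aC (base + y) < arrs s1 aC (base + x) - l.
    by rewrite (Cq x xD) -/cx; case: (_ < _) lt.
  have top1 z : z \in D -> arrs s1 aC (base + x) <= arrs s1 aC (base + z).
    by move=> zD; rewrite (Cq x xD) (Cq z) ?inE ?zD ?orbT //; apply: top0.
  have [yD dq'] := dijkstra_relax outP dq Pq yx top1 lt'.
  apply: wp_seq; apply: wp_put => //=; rewrite ?eB; first by lia.
  apply: wp_frame; first by apply: (tree_set_spec w0 V0 VW Vlg (f := fun v => if v \in x :: D then 0 else arrs s1 aC (base + v))).
  move=> t2 s2 [fv2 fa2] [/= heap2 tle2]; apply: wp_assign => //=.
    by rewrite fv2 //= xEi; lia.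
  have CE j : arrs s2 aC (base + j) = upd (fun v => arrs s1 aC (base + v)) y (cx - l) j.
    by rewrite fa2 //= /upd eqn_add2l.
  exists k.-1 => //; exists (rcons pre (y, l)), Lq; split=> //=.
  + by rewrite fv2 //= xEi fa2 //= subn1 /= eNx cat_rcons.
  + split.
      apply: heap_ext heap2 _ _ => // v vV; rewrite CE /upd.
      case: (eqVneq v y) => [->|//]; by rewrite (negbTE yD).
    move: dq'; rewrite /= (Cq x) // -/cx => dq'.
    case: dq' => i1 i2 i3 i4 i5 i6; split=> //.
    * by rewrite CE.
    * by move=> v; rewrite CE; exact: i2.
    * by split; [exact: i3.1|move=> v; rewrite CE; exact: i3.2].
    * by move=> v v'; rewrite !CE; exact: i4.
    * by move=> v v' l'; rewrite !CE; exact: i5.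
    * move=> v vV; rewrite CE => h; have [|[z [h1 h2 h3]]] := i6 v vV h; first by left.
      by right; exists z; rewrite CE.
  + split=> [z zD|j hj]; last first.
      by rewrite fa2 //=; case: eqP => [e|_]; [lia|exact: Cout].
    rewrite CE /upd; case: (eqVneq z y) => [e|_]; last exact: Cq.
    by rewrite -e zD in yD.
  + by apply: tt; rewrite /tU; lia.
- move=> ge; have ge' : arrs s1 aC (base + x) - l <= arrs s1 aC (base + y).
    by rewrite (Cq x) // -/cx leqNgt; case: (_ < _) ge.
  apply: wp_skip; apply: wp_assign => //=; first by rewrite xEi; lia.
  exists k.-1 => //; exists (rcons pre (y, l)), Lq; split=> //=.
  + by rewrite xEi subn1 /= eNx cat_rcons.
  + by split=> //; apply: dijkstra_relax_none.
  + by apply: tt; lia.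
Qed.

(** With pivots, the test at x reads entry n + x of a block, so such a search must stay among the
    first n vertices; this is the hypothesis under [0 < K]. The searches that start in the reversed
    copy have K = 0. *)
Lemma search_spec s K u g base src : params n V INF s K u g -> g <= INF -> K < 2 ^ w ->
  vars s xBase = base -> vars s xSrc = src -> src < V -> u < n -> base + V < 2 ^ w ->
  (forall k, k < K -> arrs s aR k + 3 * V <= base) ->
  (0 < K -> forall v a, walk out src v a -> v < n) ->
  heap V (arrs s aT) (fun=> 0) -> (forall v, v < V -> arrs s aC (base + v) = 0) ->
  adjacency s ->
  let P := passes n V INF (arrs s aC) (arrs s aR) K u g in
  wp w search s (fun t s' => let F v := arrs s' aC (base + v) in
    [/\ heap V (arrs s' aT) (fun=> 0),
        forall i, i < base \/ base + V <= i -> arrs s' aC i = arrs s aC i,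
        search_result src P F &
        t <= 900 * (lg.+1 * K.+1) * (search_size P F).+1]).
Proof.
move=> par gI KW sB sS srcV uV bW RB Kn h0 C0 [L adj] P.
have [sN sV sI sK [sU sG]] := par.
have W1 : 1 < 2 ^ w by rewrite -{1}(expn0 2) ltn_exp2l.
(* [B] bounds both the cost of one extraction (two tree operations and one test) and the cost of one
   relaxation. The final factor 3 collects the set-up, the extractions ([dijkstra_size]) and the
   relaxations. *)
pose tU := 40 * lg.+1; pose B := 2 * tU + 90 * K.+1 + 100.
rewrite /search.
apply: wp_seq; apply: wp_assign => //=; apply: wp_seq; apply: wp_assign => //=; apply: wp_seq.
apply: wp_frame; first by apply: (tree_set_spec w0 V0 VW Vlg (f := fun=> 0)); rewrite /= ?sS.
move=> t1 s1 [fv fa] [/=]; rewrite sS sI -/tU => heap1 tle1.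
apply: wp_seq; apply: wp_put => //=.
  by rewrite !fv //= sB sS; lia.
rewrite !fv //= sB sS sI.
have aE a i : ~~ writes_arr tree_set a -> arrs s1 a i = arrs s a i by move=> h; rewrite fa.
pose inv k t s' := exists D, [/\ size D + k = V,
   heap V (arrs s' aT) (fun v => if v \in D then 0 else arrs s' aC (base + v)),
   dijkstra_inv V INF src out P out (fun v => arrs s' aC (base + v)) D,
   forall i, i < base \/ base + V <= i -> arrs s' aC i = arrs s aC i &
   t <= \sum_(x <- D) (B + (if P x (arrs s' aC (base + x)) then size (out x) * B else 0))].
apply: (@wp_while _ w0 inv V).
  exists [::]; split=> //=.
  - apply: heap_ext heap1 _ _ => // v vV.
    by rewrite /= /upd eqn_add2l; case: eqP => // _; rewrite aE // C0.
  - split=> //=; first by rewrite eqxx.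
    + move=> v vV; rewrite eqn_add2l; case: eqP => [-> _|_].
        by split=> //; rewrite subnn; constructor.
      by rewrite aE // C0.
    + move=> v vV; rewrite eqn_add2l; case: eqP => [-> _|_]; first by left.
      by rewrite aE // C0.
  - move=> i hi; case: eqP => [e|_]; last by rewrite aE.
    by lia.
move=> k t s2 [fv2 fa2] [D [sD heap2 dij Cs2 tle]] /=.
have v2 x : x \in [:: xN; xV; xInf; xK; xU; xG; xBase] -> vars s2 x = vars s x.
  by rewrite !inE => h; repeat case/orP: h => [/eqP ->|h]; rewrite ?(eqP h) fv2 //= fv.
have a2 a i : a \in [:: aR; aFst; aNxt; aDst; aW] -> arrs s2 a i = arrs s a i.
  by rewrite !inE => h; repeat case/orP: h => [/eqP ->|h]; rewrite ?(eqP h) fa2 //= fa.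
have eV : vars s2 xV = V by rewrite v2.
have eB : vars s2 xBase = base by rewrite v2.
split=> //; split=> [root0|rootn0].
  (* An empty queue means that the extracted vertices are exactly the reached ones, so sums over [D]
     turn into sums over positive closeness. *)
  have all0 v : v < V -> v \notin D -> arrs s2 aC (base + v) = 0.
    by move=> vV vD; have := heap_root heap2 vV; rewrite (negbTE vD) root0; lia.
  split=> //.
  - split; first by move=> v vV; rewrite (heap2.1 v vV); case: ifP => // /negbT /(all0 _ vV).
    exact: heap2.2.
  - case: dij => i1 i2 i3 i4 i5 i6; split=> // x y l xV cx0; apply: i5.
    by apply/negPn/negP => /(all0 _ xV) e; rewrite e in cx0.
  - have eqD Q f : \sum_(x <- iota 0 V | (0 < arrs s2 aC (base + x)) && Q x) f x =
        \sum_(x <- D | Q x) f x :> nat.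
      rewrite -big_filter_cond; apply: perm_big; apply: uniq_perm; last first.
      - move=> x; rewrite mem_filter mem_iota /= add0n; apply/andP/idP => [[cx xV]|xD].
          by apply/negPn/negP => /(all0 _ xV) e; rewrite e in cx.
        by have [] := (dij_done dij).2 x xD.
      - by case: (dij_done dij).
      - by rewrite filter_uniq // iota_uniq.
    have := dijkstra_size dij all0; rewrite /search_size eqD.
    set sz := \sum_(x <- D | _) _ => szD.
    have : t <= size D * B + sz * B.
      apply: leq_trans tle _; rewrite big_split /= big_const_seq count_predT iter_addn_0 mulnC -big_mkcond /=.
      by rewrite big_distrl.
    move=> tD; have : size D * B <= sz.+1 * B by rewrite leq_mul2r szD orbT.
    move=> SB; have BB : 3 * B <= 900 * (lg.+1 * K.+1).
      by rewrite /B /tU; clear; nia.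
    have : 3 * B * sz.+1 <= 900 * (lg.+1 * K.+1) * sz.+1 by rewrite leq_mul2r BB orbT.
    have tB : t1 + 20 <= B by rewrite /B; lia.
    move: tD SB tB; clear; nia.
pose f v := if v \in D then 0 else arrs s2 aC (base + v).
apply: wp_seq; apply: wp_assign => //=; apply: wp_seq.
apply: wp_frame; first by apply: (tree_argmax_spec w0 V0 VW Vlg (f := f)) => //=; rewrite v2.
move=> t3 s3 fr3 [xlV fx tle3].
set x := vars s3 xX in xlV fx.
have fx' : f x = arrs s2 aT 1 by [].
have xD : x \notin D by apply/negP => xD; move: rootn0; rewrite -fx' /f xD.
have cxE : arrs s2 aC (base + x) = arrs s2 aT 1 by rewrite -fx' /f (negbTE xD).
have cx0 : 0 < arrs s2 aC (base + x) by rewrite cxE lt0n.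
have topx y : y < V -> y \notin D -> arrs s2 aC (base + y) <= arrs s2 aC (base + x).
  by move=> yV yD; have := heap_root heap2 yV; rewrite (negbTE yD) -cxE.
have dij' := dijkstra_extract dij xlV xD cx0 topx.
apply: wp_seq; apply: wp_assign => //=; apply: wp_seq; apply: wp_assign => //=; first by lia.
apply: wp_seq; apply: wp_frame.
  apply: (tree_set_spec w0 V0 VW Vlg (f := f)) => //=.
    by rewrite fr3.1 //= v2.
  apply: heap_ext heap2 _ _; last by [].
  by move=> i /=; rewrite fr3.2.
move=> t5 s5 fr5 [/= heap5 tle5].
rewrite -/x -/tU in heap5 tle5.
have v5 y : y \in [:: xN; xV; xInf; xK; xU; xG; xBase] -> vars s5 y = vars s y.
  move=> h; rewrite -v2 //; move: h; rewrite !inE => h.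
  by repeat case/orP: h => [/eqP ->|h]; rewrite ?(eqP h) fr5.1 //= fr3.1.
have a5 a i : a != aT -> arrs s5 a i = arrs s2 a i.
  by move=> h; rewrite fr5.2 /= ?(negbTE h) ?fr3.2.
have x5 : vars s5 xX = x by rewrite fr5.1.
have cx5 : vars s5 xCX = arrs s2 aC (base + x) by rewrite fr5.1 //= fr3.1 //= cxE.
have aR5 i : arrs s5 aR i = arrs s aR i by rewrite a5 // a2.
have par5 : params n V INF s5 K u g by split; rewrite ?v5.
have xlt : 0 < K -> x < n.
  by move=> /Kn h; apply: h; have [_ wk] := dij_sound dij xlV cx0; exact: wk.
apply: wp_seq; apply: wp_frame.
  apply: (test_spec w0 INFW par5 gI KW) => k' kK.
  by rewrite aR5 x5; have := RB _ kK; have := xlt (leq_ltn_trans (leq0n _) kK); lia.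
move=> t6 s6 fr6; rewrite x5 cx5.
have Pe cx : passes n V INF (arrs s5 aC) (arrs s5 aR) K u g x cx = P x cx.
  have [K0|K0] : K = 0 \/ 0 < K by lia.
    by rewrite /P K0.
  apply: passes_ext => // [k' j kK jV|k' j kK jV||]; last exact: xlt.
  - by rewrite a5 // Cs2 //; left; have := RB _ kK; lia.
  - by rewrite a5 // Cs2 //; left; have := RB _ kK; lia.
  - by rewrite -nV; lia.
rewrite Pe => -[flag6 tle6].
have v6 y : y \in [:: xV; xBase] -> vars s6 y = vars s2 y.
  by rewrite !inE => /orP[/eqP ->|/eqP ->]; rewrite fr6.1 // v5 // v2.
have a6 a i : arrs s6 a i = arrs s5 a i by rewrite fr6.2.
have heap6 : heap V (arrs s6 aT) (fun v => if v \in x :: D then 0 else arrs s6 aC (base + v)).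
  apply: heap_ext heap5 _ _ => [i|v vV]; first by rewrite a6.
  by rewrite /upd /f inE a6 a5 //; case: eqP.
have aC6 i : arrs s6 aC i = arrs s2 aC i by rewrite a6 a5.
have dij6 : dijkstra_inv V INF src out P (fun z => if z == x then [::] else out z)
    (fun v => arrs s6 aC (base + v)) (x :: D).
  case: dij' => i1 i2 i3 i4 i5 i6; split=> //.
  + by rewrite aC6.
  + by move=> v; rewrite aC6; exact: i2.
  + by split; [exact: i3.1|move=> v; rewrite aC6; exact: i3.2].
  + by move=> v v'; rewrite !aC6; exact: i4.
  + by move=> v v' l'; rewrite !aC6; exact: i5.
  + move=> v vV; rewrite aC6 => h; have [|[z [h1 h2 h3]]] := i6 v vV h; first by left.
    by right; exists z; rewrite aC6.
have sumx (c : nat -> nat) r : (forall z, z \in x :: D -> c z = arrs s2 aC (base + z)) ->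
    r <= B + (if P x (arrs s2 aC (base + x)) then size (out x) * B else 0) ->
    t + r <= \sum_(z <- x :: D) (B + (if P z (c z) then size (out z) * B else 0)).
  move=> ec rle; rewrite big_cons ec ?mem_head // addnC leq_add //.
  apply: leq_trans tle _; rewrite big_seq [leqRHS]big_seq leq_sum // => z zD.
  by rewrite ec // inE zD orbT.
have sDx : size (x :: D) + k.-1 = V.
  suff : size (x :: D) <= V by move: sD => /=; clear; lia.
  rewrite -[leqRHS](size_iota 0 V); apply: uniq_leq_size; first exact: (dij_done dij').1.
  by move=> z /((dij_done dij').2 z) [zV _]; rewrite mem_iota.
have k1 : k.-1 < k by move: sDx sD => /=; clear; lia.
have v7 : vars s6 xX = x by rewrite fr6.1.
have cx7 : vars s6 xCX = arrs s6 aC (base + x) by rewrite fr6.1 // aC6.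
apply: wp_if => //=; rewrite flag6.
- move=> Px; have {}Px : P x (arrs s2 aC (base + x)) by case: (P _ _) Px.
  apply: wp_seq; apply: wp_assign => //=.
  have [chx allx outx] := adj x xlV.
  have a6' a i : a \in [:: aFst; aNxt; aDst; aW] -> arrs s6 a i = arrs s a i.
    by rewrite !inE => h; repeat case/orP: h => [/eqP ->|h]; rewrite ?(eqP h) a6 a5 // a2.
  have chE h Lx : chain (arrs s aNxt) h Lx -> chain (arrs s6 aNxt) h Lx.
    by elim: Lx h => //= i Lx IH h [-> /IH c]; split=> //; rewrite a6'.
  have chx6 : chain (arrs s6 aNxt) (arrs s6 aFst (vars s6 xX)) (L x).
    by rewrite v7 a6' //; exact: chE.
  have outx6 : out x = [seq (arrs s6 aDst i, arrs s6 aW i) | i <- L x].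
    by rewrite outx; apply: eq_map => i; rewrite !a6'.
  have eV6 : vars s6 xV = V by rewrite v6 // v2.
  have eB6 : vars s6 xBase = base by rewrite v6 // v2.
  have Px6 : P x (arrs s6 aC (base + x)) by rewrite aC6.
  have top6 z : z \in D -> arrs s6 aC (base + x) <= arrs s6 aC (base + z).
    by move=> zD; rewrite !aC6; apply: (dij_mono dij).
  apply: wp_frame; first by apply: (relax_loop_spec
      (P := P) (src := src) (D := D) (x := x) (base := base) (Lx := L x)).
  move=> t8 s8 fr8 /= [heap8 dij8 C8 out8 tle8].
  exists k.-1 => //; exists (x :: D); split=> //.
  + by move=> i hi; rewrite out8 // aC6 Cs2.
  + apply: sumx; first by move=> z zD; rewrite C8 // aC6.
    rewrite Px; have : size (out x) * (40 * lg.+1 + 60) <= size (out x) * B.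
      by rewrite leq_mul2l /B /tU; apply/orP; right; clear; lia.
    by move: tle8 tle3 tle5 tle6; rewrite /B /tU; clear; lia.
- move=> Px; have {}Px : ~~ P x (arrs s2 aC (base + x)) by case: (P _ _) Px.
  apply: wp_skip; exists k.-1 => //; exists (x :: D); split=> //.
  + by apply: dijkstra_skip; [exact: dij6|rewrite aC6].
  + by move=> i hi; rewrite aC6 Cs2.
  + apply: sumx; first by move=> z zD; rewrite aC6.
    by rewrite (negbTE Px); move: tle3 tle5 tle6; rewrite /B /tU; clear; lia.
Qed.

End Search.

(** * Distances and cycles *)

Lemma walk_trans out u v x a b : walk out u v a -> walk out v x b -> walk out u x (a + b).
Proof.
move=> h; elim=> [|y z b' l _ IH yz]; first by rewrite addn0.
by rewrite addnA; apply: walk_snoc yz.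
Qed.

(** Distances truncated at INF, which stands for every larger distance and for unreachability. The
    triangle inequality survives truncation. *)
Definition is_dist INF out (d : nat -> nat -> nat) : Prop :=
  forall u v, [/\ d u v <= INF, d u v < INF -> walk out u v (d u v) &
    forall a, walk out u v a -> d u v <= a].

Section Dist.
Variables (INF : nat) (out : nat -> seq (nat * nat)) (d : nat -> nat -> nat).
Hypothesis dP : is_dist INF out d.

Lemma dist_triangle u v x : d u x <= d u v + d v x.
Proof.
have [h1 h2 h3] := dP u v; have [k1 k2 k3] := dP v x; have [l1 l2 l3] := dP u x.
case: (ltnP (d u v) INF) => [/h2 w1|]; last by lia.
case: (ltnP (d v x) INF) => [/k2 w2|]; last by lia.
exact/l3/(walk_trans w1 w2).
Qed.

(* [dv] is d(u,v), or an upper bound for it during the search from u. *)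
Definition survives u g v dv r : bool :=
  (dv + d v r <= g + d u r) && (g + dv < d u r + d r v).

(** The second condition of either survival is the exact negation of the first condition of the
    other; hence one of them is strict. *)
Lemma survives_asym u g v r :
  survives u g v (d u v) r -> ~~ survives u g r (d u r) v.
Proof. by rewrite /survives => /andP[h1 h2]; apply/negP => /andP[h3 h4]; lia. Qed.

(** Stepping back from x to v lowers the distance from u by l, raises the distance to r by at most
    l, and lowers the distance from r by at most l. Both inequalities persist. *)
Lemma survives_prefix u g v x l r : (x, l) \in out v -> d u x = d u v + l ->
  survives u g x (d u x) r -> survives u g v (d u v) r.
Proof.
move=> vx dx /andP[h1 h2].
have wvx : walk out v x l by rewrite -(add0n l); apply: walk_snoc vx; constructor.
have [_ _ /(_ _ wvx) dvx] := dP v x.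
have t1 := dist_triangle v x r; have t2 := dist_triangle r v x.
by apply/andP; split; lia.
Qed.

(** Two detours: from v to r through u for the first condition, and from r to u through v for the
    second. *)
Lemma survives_near u g v r a b : walk out u v a -> walk out v u b -> a + b <= g ->
  2 * g < d u r + d r u -> survives u g v (d u v) r.
Proof.
move=> w1 w2 ab rt.
have [_ _ /(_ _ w1) d1] := dP u v; have [_ _ /(_ _ w2) d2] := dP v u.
have t1 := dist_triangle v u r; have t2 := dist_triangle r v u.
by apply/andP; split; lia.
Qed.

(** Induction along a shortest walk, for a property [Q] that is closed under predecessors on
    shortest walks and implies passing at the true distance. The predecessor has exact closeness by
    induction, hence it is tested at its true distance, passes, and its edge is relaxed. *)
Lemma search_exact V src P F v a (Q : nat -> bool) :
  (forall v y l, v < V -> (y, l) \in out v -> y < V /\ 0 < l) ->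
  search_result V INF out src P F ->
  (forall v x l, (x, l) \in out v -> d src x = d src v + l -> Q x -> Q v) ->
  (forall v cv, Q v -> INF - cv = d src v -> P v cv) -> src < V ->
  walk out src v a -> a = d src v -> a < INF -> Q v -> v < V /\ F v = INF - d src v.
Proof.
move=> outP [F0 Fs Fr] Qpre QP srcV; elim=> {v a}.
  by rewrite F0 => <-; rewrite subn0.
move=> v x a l wv IH vx ea aI Qx.
have wx := walk_snoc wv vx.
have wl : walk out v x l by rewrite -(add0n l); apply: walk_snoc vx; constructor.
have [_ _ /(_ _ wv) dv] := dP src v; have [_ _ /(_ _ wl) dvx] := dP v x.
have tr := dist_triangle src v x.
have av : a = d src v by lia.
have aI' : a < INF by lia.
have Qv : Q v by apply: (Qpre v x l) => //; lia.
have [vV Fv] := IH av aI' Qv.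
have [xlV l0] := outP _ _ _ vV vx; split=> //.
have Fv0 : 0 < F v by rewrite Fv; lia.
have Pv : P v (F v) by apply: QP => //; rewrite Fv; lia.
have le := Fr _ _ _ vV Fv0 Pv vx.
have Fx0 : 0 < F x by lia.
have [FleI wF] := Fs _ xlV Fx0.
have [_ _ /(_ _ wF) dF] := dP src x.
lia.
Qed.

Lemma search_le V src P F v : search_result V INF out src P F -> v < V -> 0 < F v ->
  d src v <= INF - F v /\ F v <= INF.
Proof.
by move=> [_ Fs _] vV Fv; have [FleI w] := Fs _ vV Fv; have [_ _ /(_ _ w)] := dP src v.
Qed.

Lemma search_full V src P F v :
  (forall v y l, v < V -> (y, l) \in out v -> y < V /\ 0 < l) ->
  search_result V INF out src P F -> (forall v c, P v c) -> src < V -> v < V ->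
  F v = INF - d src v.
Proof.
move=> outP res PT srcV vV; have [h1 h2 h3] := dP src v.
case: (ltnP (d src v) INF) => [lt|ge].
  by have [] := search_exact (Q := xpredT) outP res (fun _ _ _ _ _ => id)
    (fun _ _ _ _ => PT _ _) srcV (h2 lt) erefl lt isT.
case: (posnP (F v)) => [->|F0]; first by lia.
by have [] := search_le res vV F0; lia.
Qed.

End Dist.

(** * The graph together with its reversed copy *)

Section Doubled.
Variables (n M : nat) (tl hd ln : nat -> nat).

(* The graph of the first k edges together with its reverse, in which n + v stands
   for vertex v. *)
Fixpoint doubled (k v : nat) : seq (nat * nat) :=
  if k is k'.+1 then
    (if tl k' == v then [:: (hd k', ln k')] else [::]) ++
    (if n + hd k' == v then [:: (n + tl k', ln k')] else [::]) ++ doubled k' v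
  else [::].

Lemma mem_doubled k v x l : (x, l) \in doubled k v <->
  exists i, i < k /\ ((tl i = v /\ x = hd i) \/ (n + hd i = v /\ x = n + tl i)) /\ l = ln i.
Proof.
elim: k v x l => [|k IH] v x l /=; first by split=> // -[i []].
rewrite !mem_cat; split; first (case/or3P => [||/(IH v x l).1 [i [ik h]]]; last by exists i; split=> //; lia).
  - by case: eqP => // e; rewrite inE => /eqP [-> ->]; exists k; split=> //; split=> //; left.
  - by case: eqP => // e; rewrite inE => /eqP [-> ->]; exists k; split=> //; split=> //; right.
move=> [i [ik [h ->]]]; rewrite ltnS leq_eqVlt in ik.
case/orP: ik => [/eqP ek|ik].
  rewrite ek in h *; case: h => -[<- ->]; rewrite eqxx mem_head ?orbT //.
have hi : (x, ln i) \in doubled k v by apply: (IH v x (ln i)).2; exists i.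
by rewrite hi !orbT.
Qed.

Lemma size_doubled k : (forall i, i < k -> tl i < n /\ hd i < n) ->
  \sum_(v <- iota 0 (2 * n)) size (doubled k v) = 2 * k.
Proof.
elim: k => [|k IH] hk /=; first by rewrite big1.
under eq_bigr do rewrite !size_cat.
rewrite !big_split /= IH; last by move=> i ik; apply: hk; lia.
have [tk hdk] := hk k (ltnSn k).
have one j : j < 2 * n -> \sum_(v <- iota 0 (2 * n)) (j == v : nat) = 1.
  move=> jn; rewrite (bigD1_seq j) ?iota_uniq ?mem_iota //= eqxx big1 // => v.
  by rewrite eq_sym; case: eqP.
have -> : \sum_(v <- iota 0 (2 * n)) size (if tl k == v then [:: (hd k, ln k)] else [::]) = 1.
  by rewrite -[RHS](one (tl k)); [apply: eq_bigr => v _; case: eqP|lia].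
have -> : \sum_(v <- iota 0 (2 * n)) size (if n + hd k == v then [:: (n + tl k, ln k)] else [::]) = 1.
  by rewrite -[RHS](one (n + hd k)); [apply: eq_bigr => v _; case: eqP|lia].
lia.
Qed.

Variable m : nat.
Hypothesis edgeP : forall i, i < m -> [/\ tl i < n, hd i < n & 0 < ln i].
Local Notation out := (doubled m).

Lemma doubled_bound v y l : v < 2 * n -> (y, l) \in out v -> y < 2 * n /\ 0 < l.
Proof.
move=> vV /mem_doubled [i [/edgeP[h1 h2 h3] [h ->]]].
by case: h => -[_ ->]; split=> //; lia.
Qed.

Lemma walk_low u v a : walk out u v a -> u < n -> v < n.
Proof.
elim=> // {v a} v x a l _ IH /mem_doubled [i [/edgeP[h1 h2 h3] [h _]]] /IH vn.
by case: h => -[e ->] //; lia.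
Qed.

Lemma walk_flip u v a : walk out u v a -> u < n -> walk out (n + v) (n + u) a.
Proof.
elim=> {v a}; first by constructor.
move=> v x a l wv IH vx un; rewrite (addnC a).
have vn := walk_low wv un.
apply: walk_trans (IH un); rewrite -(add0n l); apply: walk_snoc; first by constructor.
move/mem_doubled: vx => [i [im [h ->]]]; apply/mem_doubled; exists i; split=> //; split=> //.
have [h1 h2 h3] := edgeP im.
by right; case: h => -[e ->]; [rewrite e|lia].
Qed.

Lemma walk_unflip v x a : walk out (n + v) x a -> v < n -> exists2 u, u < n /\ x = n + u & walk out u v a.
Proof.
elim=> {x a}; first by move=> vn; exists v => //; constructor.
move=> x y a l _ IH xy vn; have [u [un ex] wu] := IH vn.
move/mem_doubled: xy => [i [im [h ->]]]; have [h1 h2 h3] := edgeP im.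
case: h => -[e ->]; first by lia.
exists (tl i) => //; rewrite addnC; apply: walk_trans wu.
rewrite -(add0n (ln i)); apply: walk_snoc; first by constructor.
by apply/mem_doubled; exists i; split=> //; split=> //; left; split=> //; lia.
Qed.

(** The two copies are disjoint and reverse to each other, so a search from n + r in the same graph
    yields the distances to r. *)
Lemma dist_flip INF d u v : is_dist INF out d -> u < n -> v < n ->
  d (n + v) (n + u) = d u v.
Proof.
move=> dP un vn; have [h1 h2 h3] := dP u v; have [k1 k2 k3] := dP (n + v) (n + u).
apply/eqP; rewrite eqn_leq; apply/andP; split.
  case: (ltnP (d u v) INF) => [/h2 w|]; last by lia.
  exact/k3/walk_flip.
case: (ltnP (d (n + v) (n + u)) INF) => [/k2 w|]; last by lia.
have [u' [un' /eqP e] w'] := walk_unflip w vn.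
by apply: h3; move: e w'; rewrite eqn_add2l => /eqP <-.
Qed.

End Doubled.

(** * Simple cycles against closed walks *)

Section Cycles.
Variables (n : nat) (e : rel 'I_n) (wt : 'I_n -> 'I_n -> nat) (es : seq ('I_n * 'I_n)).
Hypothesis esP : edge_listing e es.

Definition tail_of i := nth 0 [seq nat_of_ord uv.1 | uv <- es] i.
Definition head_of i := nth 0 [seq nat_of_ord uv.2 | uv <- es] i.
Definition weight_of i := nth 0 [seq wt uv.1 uv.2 | uv <- es] i.
Local Notation out := (doubled n tail_of head_of weight_of (size es)).

Lemma edge_index i : i < size es -> exists u v : 'I_n,
  [/\ e u v, tail_of i = u, head_of i = v & weight_of i = wt u v].
Proof.
move=> im; have uv0 : 'I_n * 'I_n by case: (es) im.
have [_ mem] := esP; pose uv := nth uv0 es i.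
exists uv.1, uv.2; split; last 3 first.
- by rewrite /tail_of (nth_map uv0).
- by rewrite /head_of (nth_map uv0).
- by rewrite /weight_of (nth_map uv0).
by rewrite -mem -surjective_pairing mem_nth.
Qed.

Lemma out_edge (u v : 'I_n) : e u v -> (val v, wt u v) \in out u.
Proof.
rewrite -esP.2 => uv; apply/mem_doubled; exists (index (u, v) es).
rewrite index_mem; split=> //; rewrite /tail_of /head_of /weight_of.
by rewrite !(nth_map (u, v)) ?index_mem // !nth_index //; split=> //; left.
Qed.

Lemma edge_out (u : 'I_n) x l : (x, l) \in out u ->
  exists2 v : 'I_n, x = v & e u v /\ l = wt u v.
Proof.
move=> /mem_doubled [i [im [h ->]]]; have [u' [v [uv e1 e2 e3]]] := edge_index im.
rewrite e1 e2 in h; rewrite e3; case: h => -[eu ex].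
  by exists v => //; move/val_inj: eu => <-.
by have := ltn_ord u; rewrite -eu; lia.
Qed.

Fixpoint path_weight (u : 'I_n) (p : seq 'I_n) : nat :=
  if p is v :: p' then wt u v + path_weight v p' else 0.

Lemma path_weight_cat u p q :
  path_weight u (p ++ q) = path_weight u p + path_weight (last u p) q.
Proof. by elim: p u => //= v p IH u; rewrite IH addnA. Qed.

Lemma cycle_weight_path u p : uniq (u :: p) ->
  cycle_weight wt (u :: p) = path_weight u (rcons p u).
Proof.
rewrite /cycle_weight => U.
(* [next] unfolds to [next_at], which remembers the first vertex x of the cycle separately from the
   current suffix; only that form admits an induction. *)
suff gen x y s : uniq (y :: s) ->
    \sum_(z <- y :: s) wt z (next_at z x y s) = path_weight y (rcons s x).
  by rewrite -(gen u u p U); apply: eq_bigr.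
elim: s y => [|z s IH] y /=; first by rewrite big_seq1 eqxx addn0.
move=> /andP[ys U']; rewrite big_cons eqxx -IH //; congr (_ + _).
apply: eq_big_seq => z' zz'.
by rewrite ifN //; apply: contraNneq ys => <-.
Qed.

Lemma cycle_weight_rot k p : uniq p -> cycle_weight wt (rot k p) = cycle_weight wt p.
Proof.
move=> U; rewrite /cycle_weight; under eq_bigr do rewrite next_rot //.
by apply: perm_big; rewrite perm_rot.
Qed.

Lemma path_walk u p : path e u p -> walk out u (last u p) (path_weight u p).
Proof.
elim/last_ind: p => [|p v IH]; first by constructor.
rewrite rcons_path last_rcons -cats1 path_weight_cat /= addn0 => /andP[/IH w uv].
by apply: walk_snoc w _; apply: out_edge.
Qed.

(** After rotation to start at u, the last edge of the cycle is split off, because the algorithm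
    closes cycles by adding edges into u to distances from u. *)
Lemma cycle_walk p (u : 'I_n) : ucycle e p -> u \in p ->
  exists v a l, [/\ v < n, walk out u v a, (val u, l) \in out v & a + l = cycle_weight wt p].
Proof.
move=> /andP[cp up] /rot_to [k q eq]; rewrite -(cycle_weight_rot k up) eq.
have cq : cycle e (u :: q) by rewrite -eq rot_cycle.
have uq : uniq (u :: q) by rewrite -eq rot_uniq.
rewrite cycle_weight_path //; move: cq; rewrite /= rcons_path => /andP[pq lq].
exists (last u q), (path_weight u q), (wt (last u q) u); split=> //.
- exact: path_walk.
- exact: out_edge.
- by rewrite -cats1 path_weight_cat /= addn0.
Qed.

(** Whenever the walk returns to a vertex of the path built so far, the path is cut back to that
    vertex; with natural weights this cannot increase its weight. *)
Lemma walk_path (u : 'I_n) v a : walk out u v a -> exists p : seq 'I_n,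
  [/\ path e u p, uniq (u :: p), v = last u p & path_weight u p <= a].
Proof.
elim=> {v a}; first by exists [::].
move=> v x a l _ [p [pp Up ev wp]]; rewrite ev => /edge_out [y -> [ly ->]].
case: (boolP (y \in u :: p)) => [|yp]; last first.
  exists (rcons p y); rewrite rcons_path pp ly last_rcons -rcons_cons rcons_uniq yp Up.
  by split=> //; rewrite -cats1 path_weight_cat /= addn0; lia.
rewrite inE => /orP[/eqP ->|yp]; first by exists [::]; split.
case/path.splitP: yp pp Up wp {ev ly} => p1 p2; rewrite cat_path -cat_cons cat_uniq path_weight_cat.
move=> /andP[pp1 _] /andP[Up _] wp; exists (rcons p1 y).
by rewrite last_rcons; split=> //; lia.
Qed.

Lemma walk_cycle (u v : 'I_n) a l : walk out u v a -> (val u, l) \in out v ->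
  exists p, [/\ ucycle e p, u \in p & cycle_weight wt p <= a + l].
Proof.
move=> /walk_path [p [pp Up ev wp]] /edge_out [u' eu [vu ->]].
exists (u :: p); rewrite mem_head; split=> //.
  rewrite /ucycle Up andbT /= rcons_path pp.
  by rewrite -(val_inj ev) (val_inj eu).
rewrite cycle_weight_path // -cats1 path_weight_cat /= addn0 -(val_inj ev) -(val_inj eu).
by lia.
Qed.

Lemma cycle_weight_bound M p : (forall u v, e u v -> wt u v <= M) -> ucycle e p ->
  cycle_weight wt p <= n * M.
Proof.
move=> wM /andP[cp up]; apply: (@leq_trans (\sum_(x <- p) M)).
  rewrite /cycle_weight [leqLHS]big_seq [leqRHS]big_seq leq_sum // => x xp.
  exact/wM/(next_cycle cp).
rewrite big_const_seq count_predT iter_addn_0 mulnC leq_mul2r.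
by rewrite -[n in _ <= n]card_ord -(card_uniqP up) max_card orbT.
Qed.

End Cycles.

(** * Greedy elimination with random pivots *)

(** The expectation of f over N independent uniform draws, multiplied by #|X| ^ N. Peeling off the
    first draw matches the recursion of [foldl], and no fractions occur. *)
Fixpoint sumseq (X : finType) (N : nat) (f : seq X -> nat) : nat :=
  if N is N'.+1 then \sum_x sumseq N' (fun xs => f (x :: xs)) else f [::].

Section SumSeq.
Variable X : finType.
Implicit Types f g : seq X -> nat.

Lemma leq_sumseq N f g : (forall xs, f xs <= g xs) -> sumseq N f <= sumseq N g.
Proof. by elim: N f g => //= N IH f g fg; apply: leq_sum => x _; apply: IH. Qed.

Lemma eq_sumseq N f g : f =1 g -> sumseq N f = sumseq N g.
Proof. by elim: N f g => //= N IH f g fg; apply: eq_bigr => x _; apply: IH. Qed.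

Lemma sumseq_scale N a f : sumseq N (fun xs => a * f xs) = a * sumseq N f.
Proof. by elim: N f => //= N IH f; rewrite big_distrr; apply: eq_bigr => x _; rewrite IH. Qed.

Lemma sumseq_const N a : sumseq N (fun _ : seq X => a) = #|X| ^ N * a.
Proof.
elim: N => [|N IH] /=; first by rewrite mul1n.
by rewrite IH sum_nat_const expnS mulnA.
Qed.

Lemma sumseq_sum (I : finType) N (F : I -> seq X -> nat) :
  sumseq N (fun xs => \sum_i F i xs) = \sum_i sumseq N (F i).
Proof. by elim: N F => //= N IH F; rewrite exchange_big; apply: eq_bigr => x _; rewrite IH. Qed.

Lemma sumseqD N f g : sumseq N (fun xs => f xs + g xs) = sumseq N f + sumseq N g.
Proof. by elim: N f g => //= N IH f g; rewrite -big_split; apply: eq_bigr => x _; rewrite IH. Qed.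

Lemma sumseq_cat a b f :
  sumseq (a + b) f = sumseq a (fun xs => sumseq b (fun ys => f (xs ++ ys))).
Proof. by elim: a f => //= a IH f; apply: eq_bigr => x _; rewrite IH. Qed.

Lemma sumseq_size N f g : (forall xs, size xs = N -> f xs = g xs) -> sumseq N f = sumseq N g.
Proof.
elim: N f g => [|N IH] f g fg /=; first exact: fg.
by apply: eq_bigr => x _; apply: IH => xs xsN; apply: fg; rewrite /= xsN.
Qed.

Lemma sumseq_tuple N f : \sum_(t : N.-tuple X) f t = sumseq N f.
Proof.
elim: N f => [|N IH] f /=.
  by rewrite (big_pred1 [tuple]) // => t; apply/esym/eqP; exact: tuple0.
rewrite (reindex (fun p : X * N.-tuple X => cons_tuple p.1 p.2)) /=.
  rewrite -(pair_bigA _ (fun x (t : N.-tuple X) => f (x :: t))) /=.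
  by apply: eq_bigr => x _; rewrite -IH.
exists (fun t => (thead t, behead_tuple t)).
  by move=> [x t] _ /=; congr (_, _); apply: val_inj.
by move=> t _; apply: val_inj; rewrite [t]tuple_eta.
Qed.

End SumSeq.

Section Greedy.
Variables (X : finType) (sv : rel X).
Hypothesis sv_asym : forall x y, sv x y -> ~~ sv y x.

(* The state consists of the survivors and of the number of pivots. *)
Definition greedy (st : {set X} * nat) (x : X) : {set X} * nat :=
  if x \in st.1 then ([set y in st.1 | sv y x], st.2.+1) else st.

(** For every ordered pair in B at most one of x = y, sv y x and sv x y holds, by asymmetry. So a
    pivot drawn uniformly from B leaves at most (#|B| - 1) / 2 survivors on average. *)
Lemma card_survivors (B : {set X}) :
  2 * (\sum_(x in B) #|[set y in B | sv y x]|) + #|B| <= #|B| * #|B|.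
Proof.
have -> : #|B| = \sum_(x in B) \sum_(y in B) (x == y : nat).
  rewrite -sum1_card; apply: eq_bigr => x xB; rewrite (bigD1 x) //= eqxx big1 // => y.
  by rewrite eq_sym; case: eqP; rewrite ?andbF.
have -> : \sum_(x in B) #|[set y in B | sv y x]| = \sum_(x in B) \sum_(y in B) (sv y x : nat).
  apply: eq_bigr => x _; rewrite -sum1_card big_mkcond /= [RHS]big_mkcond.
  by apply: eq_bigr => y _; rewrite inE; case: (y \in B); case: sv.
rewrite mul2n -addnn {2}exchange_big -!big_split /=.
have -> : (\sum_(x in B) \sum_(y in B) (x == y : nat)) = #|B|.
  rewrite -sum1_card; apply: eq_bigr => x xB; rewrite (bigD1 x) //= eqxx big1 // => y.
  by rewrite eq_sym; case: eqP; rewrite ?andbF.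
rewrite -sum_nat_const leq_sum // => x _; rewrite -!big_split /= -sum1_card leq_sum // => y _.
case: (eqVneq x y) => [->|_].
  by case: (boolP (sv y y)) => // h; have := sv_asym h; rewrite h.
by case: (boolP (sv y x)) => [/sv_asym /negbTE ->|_] //; case: sv.
Qed.

Lemma sum_greedy (B : {set X}) k (F : {set X} * nat -> nat) :
  \sum_x F (greedy (B, k) x) =
  \sum_(x in B) F ([set y in B | sv y x], k.+1) + (#|X| - #|B|) * F (B, k).
Proof.
rewrite (bigID (mem B)) /=; congr (_ + _).
  by apply: eq_bigr => x xB; rewrite /greedy /= xB.
rewrite (eq_bigr (fun=> F (B, k))); last first.
  by move=> x xB; rewrite /greedy /= (negbTE xB).
by rewrite sum_nat_const -(cardC (mem B)) addKn; congr (_ * _); apply: eq_card.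
Qed.

(* The potential [large s B] shrinks by a factor 1 - 1/(2s) on average at each
   draw, and (#|B| + 1) * 2 ^ k is a supermartingale (count_step). *)
Definition large (s : nat) (B : {set X}) : nat := if #|X| <= s * #|B| then #|B| else 0.

(** While B is large a draw hits it with probability at least 1/s, and a hit at least halves it on
    average, for an expected loss of a fraction 1/(2s). Below the threshold B stays there, because
    it only shrinks. *)
Lemma large_step s B k : 0 < s ->
  2 * s * (\sum_x large s (greedy (B, k) x).1) <= (2 * s).-1 * #|X| * large s B.
Proof.
move=> s0; rewrite (sum_greedy B k (fun st => large s st.1)) /=.
have BX : #|B| <= #|X| by apply: max_card.
have sub x : #|[set y in B | sv y x]| <= #|B|.
  by apply: subset_leq_card; apply/fintype.subsetP => y; rewrite inE => /andP[].
have := card_survivors B; rewrite {2 3}/large; case: (leqP #|X| (s * #|B|)) => h.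
  have le : \sum_(x in B) large s [set y in B | sv y x] <= \sum_(x in B) #|[set y in B | sv y x]|.
    by apply: leq_sum => x _; rewrite /large; case: ifP.
  move: le; set S1 := \sum_(x in B) _; set S2 := \sum_(x in B) _.
  set b := #|B| in h BX *; set q := #|X| in h BX * => le cs.
  have e : (2 * s).-1 * q * b = 2 * s * (q * b) - q * b by rewrite -subn1 -mulnA mulnBl mul1n.
  have l1 : b * b <= q * b by rewrite leq_mul2r BX orbT.
  have l2 : q * b <= s * (b * b) by rewrite mulnA leq_mul2r h orbT.
  have l3 : s * (2 * S1) <= s * (b * b) by rewrite leq_mul2l; apply/orP; right; lia.
  have l4 : s * (b * b) <= s * (q * b) by rewrite leq_mul2l l1 orbT.
  have e2 : 2 * s * (S1 + (q - b) * b) = s * (2 * S1) + (2 * (s * (q * b)) - 2 * (s * (b * b))).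
    by rewrite mulnDr mulnBl mulnBr -!mulnA; congr (_ + _); rewrite mulnCA.
  rewrite e e2 -mulnA; move: l2 l3 l4; clear; lia.
move=> _; rewrite muln0 addn0 big1 ?muln0 // => x _; rewrite /large leqNgt (leq_ltn_trans _ h) //.
by rewrite leq_mul2l sub orbT.
Qed.

Lemma large_sum s N st : 0 < s ->
  (2 * s) ^ N * sumseq N (fun xs => large s (foldl greedy st xs).1) <=
  ((2 * s).-1 * #|X|) ^ N * large s st.1.
Proof.
move=> s0; elim: N st => [|N IH] st /=; first by rewrite !mul1n.
have step : (2 * s) ^ N * \sum_x sumseq N (fun xs => large s (foldl greedy (greedy st x) xs).1) <=
    ((2 * s).-1 * #|X|) ^ N * \sum_x large s (greedy st x).1.
  by rewrite !big_distrr /=; apply: leq_sum => x _; apply: IH.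
have := large_step st.1 st.2 s0; rewrite -surjective_pairing => h.
rewrite [X in _ <= X * _]expnSr -mulnA.
apply: (@leq_trans ((2 * s) * (((2 * s).-1 * #|X|) ^ N * \sum_x large s (greedy st x).1))).
  by rewrite expnS -mulnA leq_mul2l step orbT.
by rewrite mulnCA leq_mul2l h orbT.
Qed.

(** A hit doubles 2 ^ k, and the average of the new #|B| + 1 is at most (#|B| - 1) / 2 + 1, half of
    the old value. The summand 1 in the potential makes this balance exact. *)
Lemma count_step (B : {set X}) k :
  \sum_x (#|(greedy (B, k) x).1| + 1) * 2 ^ (greedy (B, k) x).2 <=
  #|X| * ((#|B| + 1) * 2 ^ k).
Proof.
rewrite (sum_greedy B k (fun st => (#|st.1| + 1) * 2 ^ st.2)) /=.
have BX : #|B| <= #|X| by apply: max_card.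
have := card_survivors B; rewrite -big_distrl big_split /= sum1_card expnS.
set S := \sum_(x in B) _ => cs.
have -> : #|X| = (#|X| - #|B|) + #|B| by rewrite subnK.
rewrite addnK [leqRHS]mulnDl addnC leq_add2l.
have : 2 * (S + #|B|) <= #|B| * (#|B| + 1) by lia.
by move=> h; rewrite !mulnA leq_mul2r; apply/orP; right; lia.
Qed.

Lemma count_sum N st :
  sumseq N (fun xs => (#|(foldl greedy st xs).1| + 1) * 2 ^ (foldl greedy st xs).2) <=
  #|X| ^ N * ((#|st.1| + 1) * 2 ^ st.2).
Proof.
elim: N st => [|N IH] st /=; first by rewrite mul1n.
apply: (@leq_trans (\sum_x #|X| ^ N * ((#|(greedy st x).1| + 1) * 2 ^ (greedy st x).2))).
  by apply: leq_sum => x _; apply: IH.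
rewrite -big_distrr expnSr -mulnA leq_mul2l; apply/orP; right.
by have := count_step st.1 st.2; rewrite -surjective_pairing.
Qed.

(** That is, (1 - 1/(2s)) ^ (2s) <= 1/2. The auxiliary [gen] is Bernoulli's inequality 1 + k/a <= (1
    + 1/a) ^ k with denominators cleared, applied at k = a + 1. *)
Lemma bernoulli s : 0 < s -> 2 * (2 * s).-1 ^ (2 * s) <= (2 * s) ^ (2 * s).
Proof.
move=> s0; set a := (2 * s).-1; have -> : 2 * s = a.+1 by rewrite /a; lia.
have gen k : (a + k) * a ^ k <= a * a.+1 ^ k.
  elim: k => [|k IH]; first by rewrite addn0.
  rewrite !expnS; apply: (@leq_trans (a.+1 * ((a + k) * a ^ k))); last by rewrite [leqRHS]mulnCA leq_mul2l IH orbT.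
  by rewrite !mulnA leq_mul2r; apply/orP; right; clear; nia.
have := gen a.+1; have a0 : 0 < a by rewrite /a; lia.
have -> : (a + a.+1) * a ^ a.+1 = (2 * a + 1) * a ^ a.+1 by congr (_ * _); lia.
move=> h; rewrite -(leq_pmul2l a0); apply: leq_trans h.
by rewrite mulnA leq_mul2r; apply/orP; right; lia.
Qed.

Lemma bernoulli_pow s c : 0 < s ->
  2 ^ c * (2 * s).-1 ^ (2 * s * c) <= (2 * s) ^ (2 * s * c).
Proof.
by move=> s0; rewrite !(expnM _ (2 * s) c) -expnMn; case: c => // c; rewrite leq_exp2r // bernoulli.
Qed.

(** Markov's inequality: [large] is at least 1 when B is still large, starts at #|X| or less, and 2
    s c draws multiply its mean by at most 2 ^ -c. *)
Lemma greedy_large B0 s c : 0 < s -> 0 < #|X| ->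
  2 ^ c * sumseq (2 * s * c) (fun xs => #|X| <= s * #|(foldl greedy (B0, 0) xs).1| : nat) <=
  #|X| ^ (2 * s * c) * #|X|.
Proof.
move=> s0 X0; set N := 2 * s * c.
have le : sumseq N (fun xs => #|X| <= s * #|(foldl greedy (B0, 0) xs).1| : nat) <=
    sumseq N (fun xs => large s (foldl greedy (B0, 0) xs).1).
  apply: leq_sumseq => xs; rewrite /large.
  case: (leqP #|X| (s * #|(foldl greedy (B0, 0) xs).1|)) => //= h.
  by rewrite lt0n; apply/eqP => e; move: h; rewrite e muln0 leqNgt X0.
have := large_sum N (B0, 0) s0; have := bernoulli_pow c s0; rewrite -/N.
have : large s (B0, 0).1 <= #|X| by rewrite /large; case: ifP => // _; apply: max_card.
rewrite (expnMn _ #|X|); set S := sumseq N _ in le *; set S' := sumseq N _ in le *.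
set p := (2 * s) ^ N; set q := _.-1 ^ N; set l := large _ _; set Y := _ ^ N.
move=> lX pq SS; have p0 : 0 < p by rewrite expn_gt0; lia.
rewrite -(leq_pmul2l p0).
apply: (@leq_trans (2 ^ c * (p * S'))); first by rewrite mulnCA !leq_mul2l le !orbT.
apply: (@leq_trans (2 ^ c * (q * Y * l))); first by rewrite leq_mul2l SS orbT.
rewrite -!mulnA mulnA; apply: leq_mul => //.
by rewrite leq_mul2l lX orbT.
Qed.

(** Markov's inequality for the supermartingale of [count_step], whose initial value is at most #|X|
    + 1. *)
Lemma greedy_count B0 N L :
  2 ^ L * sumseq N (fun xs => L <= (foldl greedy (B0, 0) xs).2 : nat) <=
  #|X| ^ N * #|X|.+1.
Proof.
rewrite -sumseq_scale; apply: leq_trans (_ : #|X| ^ N * ((#|B0| + 1) * 1) <= _); last first.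
  by rewrite leq_mul2l muln1 addn1 ltnS max_card orbT.
apply: leq_trans (count_sum N (B0, 0)); apply: leq_sumseq => xs.
case: (leqP L (foldl greedy (B0, 0) xs).2) => [h|_]; last by rewrite muln0.
rewrite muln1; apply: (@leq_trans (2 ^ (foldl greedy (B0, 0) xs).2)); first by rewrite leq_exp2l.
by rewrite leq_pmull // addn1.
Qed.

End Greedy.

(** * From fair coins to uniform draws *)

Definition bits (a : nat) (r : seq bool) : nat := foldl (fun a (c : bool) => 2 * a + c) a r.

Fixpoint draws (b N : nat) (r : seq bool) : seq nat :=
  if N is N'.+1 then bits 0 (take b r) :: draws b N' (drop b r) else [::].

Lemma sumseq_bits b a (f : nat -> nat) :
  sumseq b (fun r => f (bits a r)) = \sum_(y < 2 ^ b) f (a * 2 ^ b + y).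
Proof.
elim: b a => [|b IH] a /=; first by rewrite big_ord1 muln1 addn0.
rewrite big_bool /= (IH (2 * a + 1)) (IH (2 * a + 0)) addnC.
have -> : 2 ^ b.+1 = 2 ^ b + 2 ^ b by rewrite expnS mul2n addnn.
rewrite big_split_ord /=; congr (_ + _); apply: eq_bigr => y _; congr f; lia.
Qed.

(** Reading b bits is a bijection onto the numbers below 2 ^ b, so disjoint blocks of coins give
    independent uniform draws. *)
Lemma sumseq_draws b N (f : seq nat -> nat) :
  sumseq (N * b) (fun r => f (draws b N r)) =
  sumseq N (fun ys : seq 'I_(2 ^ b) => f (map val ys)).
Proof.
elim: N f => [|N IH] f //=.
rewrite mulSn sumseq_cat.
transitivity (sumseq b (fun r => sumseq N (fun ys : seq 'I_(2 ^ b) => f (bits 0 r :: map val ys)))).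
  apply: sumseq_size => r rb; rewrite -(IH (fun ys => f (bits 0 r :: ys))).
  by apply: eq_sumseq => r'; rewrite -rb take_size_cat // drop_size_cat.
rewrite (sumseq_bits b 0 (fun a => sumseq N (fun ys : seq 'I_(2 ^ b) => f (a :: map val ys)))).
by apply: eq_bigr => y _; rewrite mul0n.
Qed.

Lemma draws_cat b N r r' : size r = N * b -> draws b N (r ++ r') = draws b N r.
Proof.
elim: N r => //= N IH r; rewrite mulSn => rN.
rewrite take_cat drop_cat; case: ltngtP => // h; try lia.
  by rewrite IH // size_drop rN addKn.
have N0 : N * b = 0 by lia.
have -> : b - size r = 0 by rewrite h subnn.
rewrite take0 cats0 drop0 take_oversize -?h // drop_oversize -?h //.
by rewrite -[in LHS](cat0s r') IH // N0.
Qed.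

(** * Preprocessing *)

Open Scope prog_scope.

(* xS is the square root of n and xLg its binary logarithm, both rounded up. *)
Definition init_consts (d : nat) : cmd :=
  xInf ::= #2 * ($xN * $xMax) + #2 ;;
  xV ::= #2 * $xN ;;
  xS ::= #0 ;;
  WHILE $xS * $xS <? $xN DO xS ::= $xS + #1 OD ;;
  xLg ::= #0 ;;
  xPow ::= #1 ;;
  WHILE $xPow <? $xN DO xPow ::= #2 * $xPow ;; xLg ::= $xLg + #1 OD ;;
  xDraws ::= #2 * $xS * (#d * $xLg).

Definition link_edges : cmd :=
  xEdge ::= #0 ;;
  WHILE $xEdge <? $xM DO
    aNxt^[$xEdge] ::= aFst^[aTail^[$xEdge]] ;;
    aFst^[aTail^[$xEdge]] ::= $xEdge + #1 ;;
    aDst^[$xEdge] ::= aHead^[$xEdge] ;;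
    aW^[$xEdge] ::= aWt^[$xEdge] ;;
    aNxt^[$xM + $xEdge] ::= aFst^[$xN + aHead^[$xEdge]] ;;
    aFst^[$xN + aHead^[$xEdge]] ::= $xM + $xEdge + #1 ;;
    aDst^[$xM + $xEdge] ::= $xN + aTail^[$xEdge] ;;
    aW^[$xM + $xEdge] ::= aWt^[$xEdge] ;;
    xEdge ::= $xEdge + #1
  OD.

Definition draw_edge : cmd :=
  xRnd ::= #0 ;;
  xPow ::= #1 ;;
  WHILE $xPow <? $xM DO
    CFlip xCoin ;; xRnd ::= #2 * $xRnd + $xCoin ;; xPow ::= #2 * $xPow
  OD.

(* Rejecting the draws y >= m makes the others uniform. *)
Definition draw_samples : cmd :=
  xCnt ::= #0 ;;
  xJ ::= #0 ;;
  WHILE $xJ <? $xDraws DO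
    draw_edge ;;
    IF $xRnd <? $xM THEN aSmp^[$xCnt] ::= aTail^[$xRnd] ;; xCnt ::= $xCnt + #1 FI ;;
    xJ ::= $xJ + #1
  OD.

Close Scope prog_scope.

Section Preprocessing.
Variables (w n m : nat).
Hypotheses (w0 : 0 < w) (n0 : 0 < n).

Lemma init_spec d M s : vars s xN = n -> vars s xMax = M -> 0 < M ->
  2 * (n * M) + 2 < 2 ^ w -> (n.+1) * (n.+1) < 2 ^ w -> 4 * n < 2 ^ w ->
  d < 2 ^ w -> 2 * n.+1 * (d * n) < 2 ^ w ->
  wp w (init_consts d) s (fun t s' => exists r l,
    [/\ [/\ n <= r * r, r.-1 * r.-1 < n & 0 < r], n <= 2 ^ l /\ 2 ^ l < 2 * n,
     [/\ vars s' xInf = 2 * (n * M) + 2, vars s' xV = 2 * n &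
         vars s' xDraws = 2 * r * (d * l)] &
     t <= 30 * (r + l + 1)]).
Proof.
move=> sN sM M0 b1 b2 b3 b4 b5; rewrite /init_consts.
have W1 : 1 < 2 ^ w by rewrite -{1}(expn0 2) ltn_exp2l.
have nM : n <= n * M by rewrite leq_pmulr.
apply: wp_seq; apply: wp_assign => //=; first by rewrite sN sM; do ![split]; lia.
apply: wp_seq; apply: wp_assign => //=; first by rewrite sN; do ![split]; lia.
apply: wp_seq; apply: wp_assign => //=; first by lia.
apply: wp_seq; set s1 := set_var _ xS 0.
pose inv1 k t s' := [/\ vars s' xS <= n, vars s' xS + k = n,
  0 < vars s' xS -> (vars s' xS).-1 * (vars s' xS).-1 < n & t = 10 * vars s' xS].
apply: wp_frame.
  apply: (@wp_while _ w0 inv1 n _ _ _ (fun t s' => [/\ n <= vars s' xS * vars s' xS,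
      (vars s' xS).-1 * (vars s' xS).-1 < n, 0 < vars s' xS & t = 10 * vars s' xS + 6])).
    by rewrite /inv1 /=; split.
  move=> k t s' [fv _] [h1 h2 h3 h4] /=.
  have eN : vars s' xN = n by rewrite fv //= sN.
  rewrite eN; split; first by do ![split]; nia.
  split=> [z|nz].
    have h : n <= vars s' xS * vars s' xS by rewrite leqNgt; case: (_ < _) z.
    have p0 : 0 < vars s' xS by nia.
    by split=> //; [exact: h3|lia].
  have lt : vars s' xS * vars s' xS < n by case: (_ < _) nz.
  apply: wp_assign => //=; first by do ![split]; nia.
  exists k.-1; first by nia.
  by rewrite /inv1 /= addn1 /=; split=> //; nia.
move=> t2 s2 [fv2 _] [r1 r2 r3 t2E].
set r := vars s2 xS in r1 r2 r3 t2E.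
apply: wp_seq; apply: wp_assign => //=; first by lia.
apply: wp_seq; apply: wp_assign => //=.
apply: wp_seq.
pose inv2 k t s' := [/\ vars s' xLg + k = n, vars s' xPow = 2 ^ vars s' xLg,
  2 ^ vars s' xLg < 2 * n, vars s' xLg < 2 ^ vars s' xLg & t = 12 * vars s' xLg].
apply: wp_frame.
  apply: (@wp_while _ w0 inv2 n _ _ _ (fun t s' => let l := vars s' xLg in
      [/\ n <= 2 ^ l, 2 ^ l < 2 * n, l <= n & t = 12 * l + 4])).
    by rewrite /inv2 /=; split => //; lia.
  move=> k t s' [fv _] [h1 h2 h3 h4 h5] /=.
  have eN : vars s' xN = n by rewrite fv //= fv2 //= sN.
  rewrite eN h2; split => //; split=> [z|nz].
    have h : n <= 2 ^ vars s' xLg by rewrite leqNgt; case: (_ < _) z.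
    by split=> //; lia.
  have lt : 2 ^ vars s' xLg < n by case: (_ < _) nz.
  apply: wp_seq; apply: wp_assign => //=; first by rewrite h2; do ![split]; lia.
  apply: wp_assign => //=; first by do ![split]; lia.
  exists k.-1; first by lia.
  by rewrite /inv2 /= h2 addn1 expnS; split=> //; lia.
move=> t3 s3 [fv3 _] [l1 l2 l3 t3E].
set l := vars s3 xLg in l1 l2 l3 t3E.
have eS : vars s3 xS = r by rewrite fv3.
have rn : r <= n.+1 by nia.
have dl : d * l <= d * n by rewrite leq_mul2l l3 orbT.
have rdl : 2 * r * (d * l) <= 2 * n.+1 * (d * n) by apply: leq_mul => //; lia.
have fit1 : 2 * r * (d * l) < 2 ^ w by apply: leq_ltn_trans b5.
have fit2 : d * l < 2 ^ w by apply: leq_ltn_trans fit1; rewrite leq_pmull // muln_gt0.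
have fit3 : 2 * r < 2 ^ w by lia.
have fit4 : 2 < 2 ^ w by lia.
apply: wp_assign => //=; rewrite ?eS //.
exists r, l; split=> //; last by rewrite t2E t3E; lia.
by split=> //; rewrite fv3 //= fv2 //= ?sN ?sM.
Qed.

Lemma up_log_minimal k : k < up_log 2 m -> 2 ^ k < m.
Proof. by move=> h; rewrite ltnNge; apply: contraL h => /up_log_min; rewrite -leqNgt => ->. Qed.

Lemma draw_edge_spec s : vars s xM = m -> up_log 2 m <= size (coins s) -> 4 * m + 4 < 2 ^ w ->
  wp w draw_edge s (fun t s' => [/\ vars s' xRnd = bits 0 (take (up_log 2 m) (coins s)),
    coins s' = drop (up_log 2 m) (coins s) &
    up_log 2 m <= t <= 20 * (up_log 2 m).+1]).
Proof.
move=> sM; set b := up_log 2 m => sc mW; rewrite /draw_edge.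
apply: wp_seq; apply: wp_assign => //=; first by lia.
apply: wp_seq; apply: wp_assign => //=; first by lia.
pose inv k t s' := [/\ k <= b, vars s' xPow = 2 ^ (b - k),
  vars s' xRnd = bits 0 (take (b - k) (coins s)) /\ bits 0 (take (b - k) (coins s)) < 2 ^ (b - k),
  coins s' = drop (b - k) (coins s) & t = 15 * (b - k)].
apply: (@wp_while _ w0 inv b).
  by rewrite /inv subnn expn0 take0 drop0; split.
move=> k t s' [fv _] [kb hp [hr hr2] hc ht] /=.
have eM : vars s' xM = m by rewrite fv //= sM.
rewrite hp eM; split=> //; split=> [z|nz].
  have h : m <= 2 ^ (b - k) by rewrite leqNgt; case: (_ < _) z.
  have k0 : k = 0.
    have [//|k0] := posnP k; have : b - k < b by lia.
    by move=> /up_log_minimal; rewrite ltnNge h.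
  by rewrite hr hc k0 subn0 in ht *; split=> //; lia.
have lt : 2 ^ (b - k) < m by case: (_ < _) nz.
have k0 : 0 < k.
  rewrite lt0n; apply/eqP => k0; move: lt; rewrite k0 subn0 ltnNge.
  by rewrite /b up_logP.
have sz : b - k < size (coins s) by lia.
have [c [rest ec]] : exists c rest, coins s' = c :: rest.
  by rewrite hc (drop_nth false) //; eexists; eexists.
apply: wp_seq; apply: wp_flip; first exact: ec.
have bk : b - k.-1 = (b - k).+1 by lia.
have tk : take (b - k).+1 (coins s) = rcons (take (b - k) (coins s)) c.
  by rewrite (take_nth false) // -[X in nth _ _ X]addn0 -nth_drop -hc ec.
have rb : bits 0 (take (b - k).+1 (coins s)) = 2 * bits 0 (take (b - k) (coins s)) + c.
  by rewrite tk /bits foldl_rcons.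
have c1 : c <= 1 by case: c {ec tk rb}.
apply: wp_seq; apply: wp_assign => //=; first by rewrite hr; do ![split]; lia.
apply: wp_assign => //=; first by rewrite hp; do ![split]; lia.
exists k.-1; first by lia.
rewrite /inv /= bk hp hr rb expnS; split=> //; try lia.
by rewrite -addn1 addnC -drop_drop -hc ec /= drop0.
Qed.

Lemma draw_samples_spec s (tl : nat -> nat) N : vars s xM = m -> vars s xDraws = N ->
  (forall i, arrs s aTail i = tl i) ->
  N * up_log 2 m <= size (coins s) -> 4 * m + 4 < 2 ^ w -> N + 1 < 2 ^ w ->
  wp w draw_samples s (fun t s' =>
    let smp := [seq tl y | y <- draws (up_log 2 m) N (coins s) & y < m] in
    [/\ vars s' xCnt = size smp, size smp <= N,
        forall j, j < size smp -> arrs s' aSmp j = nth 0 smp j &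
        N * up_log 2 m <= t <= 50 * (N * (up_log 2 m).+1).+1]).
Proof.
move=> sM sN stl; set b := up_log 2 m => sc mW NW; rewrite /draw_samples.
apply: wp_seq; apply: wp_assign => //=; first by lia.
apply: wp_seq; apply: wp_assign => //=; first by lia.
pose smp N' := [seq tl y | y <- draws b N' (coins s) & y < m].
have drS N' r : draws b N'.+1 r = rcons (draws b N' r) (bits 0 (take b (drop (N' * b) r))).
  elim: N' r => [|N' IH] r; first by rewrite /= drop0.
  transitivity (bits 0 (take b r) :: draws b N'.+1 (drop b r)); first by [].
  by rewrite IH /= drop_drop mulSn (addnC b).
pose inv k t s' := let j := vars s' xJ in [/\ j + k = N, coins s' = drop (j * b) (coins s),
  vars s' xCnt = size (smp j) /\ size (smp j) <= j,
  forall i, i < size (smp j) -> arrs s' aSmp i = nth 0 (smp j) i &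
  j * b <= t <= 40 * (j * b.+1)].
apply: (@wp_while _ w0 inv N).
  by rewrite /inv /= add0n mul0n drop0; split.
move=> k t s' [fv fa] [hj hc [hn hn2] ha ht] /=.
have eM : vars s' xM = m by rewrite fv //= sM.
have eN : vars s' xDraws = N by rewrite fv //= sN.
rewrite eN; split=> //; split=> [z|nz].
  have k0 : vars s' xJ = N by case: ltnP z; lia.
  rewrite k0 in hc hn hn2 ha ht; split=> //.
  by move: ht => /andP[h1 h2]; apply/andP; split; lia.
have lt : vars s' xJ < N by case: (_ < _) nz.
set j := vars s' xJ in hj hc hn hn2 ha ht lt.
have jb : j.+1 * b <= size (coins s) by apply: leq_trans sc; rewrite leq_mul2r lt orbT.
apply: wp_seq; apply: wp_frame.
  by apply: draw_edge_spec => //; rewrite hc size_drop; move: jb; rewrite mulSn -/b; lia.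
move=> t1 s1 [fv1 fa1] [r1 c1 tb1].
rewrite -/b hc in r1 c1.
set y := bits 0 _ in r1.
have smpS : smp j.+1 = if y < m then rcons (smp j) (tl y) else smp j.
  by rewrite /smp drS -/y filter_rcons; case: ifP => // _; rewrite map_rcons.
have coinsS : drop b (drop (j * b) (coins s)) = drop (j.+1 * b) (coins s).
  by rewrite drop_drop mulSn.
have eM1 : vars s1 xM = m by rewrite fv1.
have ecnt : vars s1 xCnt = size (smp j) by rewrite fv1.
have ej : vars s1 xJ = j by rewrite fv1.
have k1 : k.-1 < k by lia.
have W1 : 1 < 2 ^ w by lia.
have times c : t1 <= c <= t1 + 20 -> j.+1 * b <= t + c <= 40 * (j.+1 * b.+1).
  move=> c20; move: ht tb1 => /andP[h1 h2] /andP[h3 h4]; rewrite !mulSn.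
  by move: h1 h2 h3 h4 c20; rewrite -/b; clear; lia.
have aS i : arrs s1 aSmp i = arrs s' aSmp i by rewrite fa1.
have aTl i : arrs s1 aTail i = tl i by rewrite fa1 // fa //= stl.
apply: wp_seq; apply: wp_if => //=; rewrite r1 eM1.
- move=> lt2; have {}lt2 : y < m by case: (_ < _) lt2.
  rewrite lt2 in smpS.
  apply: wp_seq; apply: wp_put => //=; apply: wp_assign => //=; first by rewrite ecnt; split=> //; lia.
  apply: wp_assign => //=; first by rewrite ej; split=> //; lia.
  exists k.-1 => //; rewrite /inv /= ej addn1 smpS size_rcons ecnt r1 aTl; split=> //.
  + by lia.
  + by rewrite c1 coinsS.
  + by split; lia.
  + move=> i; rewrite nth_rcons ltnS leq_eqVlt; case: eqVneq => [-> _|ne /= h].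
      by rewrite ltnn.
    by rewrite h aS ha.
  + by apply: times; lia.
- move=> ge2; have {}ge2 : y < m = false by case: (_ < _) ge2.
  rewrite ge2 in smpS.
  apply: wp_skip; apply: wp_assign => //=; first by rewrite ej; split=> //; lia.
  exists k.-1 => //; rewrite /inv /= ej addn1 smpS ecnt; split=> //.
  + by lia.
  + by rewrite c1 coinsS.
  + by split; lia.
  + by move=> i h; rewrite aS ha.
  + by apply: times; lia.
Qed.

Lemma chain_ext nx nx' h L : (forall i, i \in L -> nx' i = nx i) -> chain nx h L -> chain nx' h L.
Proof.
elim: L h => //= i L IH h e [-> c]; split=> //; rewrite e ?mem_head //.
by apply: IH => // j jL; apply: e; rewrite inE jL orbT.
Qed.

(** Cell j holds edge j and cell m + j its reversal. [doubled] puts the newest edge first, just as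
    insertion at the head of a linked list does. *)
Lemma link_edges_spec s (tl hd ln : nat -> nat) : vars s xM = m -> vars s xN = n ->
  (forall i, arrs s aTail i = tl i) -> (forall i, arrs s aHead i = hd i) ->
  (forall i, arrs s aWt i = ln i) -> (forall v, arrs s aFst v = 0) ->
  (forall i, i < m -> tl i < n /\ hd i < n) -> 4 * m + 4 * n + 4 < 2 ^ w ->
  wp w link_edges s (fun t s' =>
    adjacency w (2 * n) (doubled n tl hd ln m) s' /\ t <= 80 * m.+1).
Proof.
move=> sM sN stl shd sln sF ed mW; rewrite /link_edges.
apply: wp_seq; apply: wp_assign => //=; first by lia.
pose inv k t s' := let j := vars s' xEdge in [/\ j + k = m,
  exists L : nat -> seq nat, forall v, v < 2 * n ->
    [/\ chain (arrs s' aNxt) (arrs s' aFst v) (L v),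
        forall i, i \in L v -> i < j \/ m <= i < m + j &
        doubled n tl hd ln j v = [seq (arrs s' aDst i, arrs s' aW i) | i <- L v]] &
  t <= 75 * j].
apply: (@wp_while _ w0 inv m).
  rewrite /inv /= add0n; split=> //; exists (fun=> [::]) => v _; split=> //=.
move=> k t s' [fv fa] [hj [L hL] ht] /=.
have eM : vars s' xM = m by rewrite fv //= sM.
have eN : vars s' xN = n by rewrite fv //= sN.
rewrite eM; split=> //; split=> [z|nz].
  have k0 : vars s' xEdge = m by case: ltnP z; lia.
  rewrite k0 in hL ht; split; last by lia.
  exists L => v vV; have [h1 h2 h3] := hL v vV; split=> //.
  by apply/allP => i /h2; lia.
have lt : vars s' xEdge < m by case: (_ < _) nz.
set j := vars s' xEdge in hj hL ht lt.
have aTl i : arrs s' aTail i = tl i by rewrite fa //= stl.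
have aHd i : arrs s' aHead i = hd i by rewrite fa //= shd.
have aLn i : arrs s' aWt i = ln i by rewrite fa //= sln.
have [tn hn] := ed j lt.
have W1 : 1 < 2 ^ w by lia.
have mjW : m + j < 2 ^ w by lia.
have mjW1 : m + j + 1 < 2 ^ w by lia.
have nhW : n + hd j < 2 ^ w by lia.
have ntW : n + tl j < 2 ^ w by lia.
have jW1 : j + 1 < 2 ^ w by lia.
apply: wp_seq; apply: wp_put => //=.
apply: wp_seq; apply: wp_put => //=; rewrite -/j ?aTl //.
apply: wp_seq; apply: wp_put => //=; rewrite -/j.
apply: wp_seq; apply: wp_put => //=; rewrite -/j.
apply: wp_seq; apply: wp_put => //=; rewrite -/j ?eM ?eN ?aHd //.
apply: wp_seq; apply: wp_put => //=; rewrite -/j ?eM ?eN ?aHd //.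
apply: wp_seq; apply: wp_put => //=; rewrite -/j ?eM ?eN ?aTl //.
apply: wp_seq; apply: wp_put => //=; rewrite -/j ?eM ?eN ?aLn //.
apply: wp_assign => //=; rewrite -/j //.
exists k.-1; first by lia.
rewrite /inv /= -/j ?eM ?eN ?aTl ?aHd ?aLn; split; [lia| |lia].
have jm : j == m + j = false by apply/eqP; lia.
have nt : n + hd j == tl j = false by apply/eqP; lia.
have tn' : tl j == n + hd j = false by apply/eqP; lia.
have mj : m + j == j = false by apply/eqP; lia.
rewrite ?jm ?nt ?tn' ?mj.
pose L' v := if v == tl j then j :: L v else if v == n + hd j then m + j :: L v else L v.
exists L' => v vV; have [h1 h2 h3] := hL v vV; rewrite addn1 /=.
have hnew i : i \in L v -> (i == j = false) * (i == m + j = false).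
  by move=> /h2 h; split; apply/eqP; lia.
have ch : chain (fun i => if i == m + j then arrs s' aFst (n + hd j)
     else if i == j then arrs s' aFst (tl j) else arrs s' aNxt i) (arrs s' aFst v) (L v).
  by apply: chain_ext h1 => i iL; rewrite !hnew.
have dd : [seq (if i == m + j then n + tl j else if i == j then hd j else arrs s' aDst i,
     if i == m + j then ln j else if i == j then ln j else arrs s' aW i) | i <- L v] =
     doubled n tl hd ln j v.
  by rewrite h3; apply/eq_in_map => i iL; rewrite !hnew.
rewrite /L'; case: (eqVneq v (tl j)) => [ev|nv].
  have -> : v == n + hd j = false by rewrite ev.
  split.
  - have e : arrs s' aFst v = arrs s' aFst (tl j) by rewrite ev.
    by split; [rewrite addn1|rewrite jm eqxx; rewrite e in ch].
  - by move=> i; rewrite inE => /orP[/eqP ->|/h2]; lia.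
  - by rewrite addn1 map_cons jm eqxx dd /= ev eqxx nt.
case: (eqVneq v (n + hd j)) => [ev|nv2].
  split.
  - have e : arrs s' aFst v = arrs s' aFst (n + hd j) by rewrite ev.
    by split; [|rewrite eqxx; rewrite e in ch].
  - by move=> i; rewrite inE => /orP[/eqP ->|/h2]; lia.
  - by rewrite addn1 map_cons eqxx dd /= ev eqxx tn'.
split=> //.
- by move=> i /h2; lia.
- by rewrite addn1 dd /= eq_sym (negbTE nv) eq_sym (negbTE nv2).
Qed.

End Preprocessing.

(** * Estimates *)

Open Scope prog_scope.

(** Sample j owns the two consecutive blocks of length V from 2 j V on, one for each direction. With
    no pivots in force the test accepts everything, and [search] is plain Dijkstra. *)
Definition sample_dists : cmd :=
  xK ::= #0 ;;
  xU ::= #0 ;;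
  xG ::= #0 ;;
  xJ ::= #0 ;;
  WHILE $xJ <? $xCnt DO
    xBase ::= #2 * $xJ * $xV ;;
    xSrc ::= aSmp^[$xJ] ;;
    search ;;
    xBase ::= $xBase + $xV ;;
    xSrc ::= $xN + aSmp^[$xJ] ;;
    search ;;
    xJ ::= $xJ + #1
  OD.

Definition roundtrips : cmd :=
  xD ::= $xInf ;;
  xJ ::= #0 ;;
  WHILE $xJ <? $xCnt DO
    IF aSmp^[$xJ] =? $xU THEN CSkip ELSE
      xB ::= #2 * $xJ * $xV ;;
      xY ::= ($xInf - aC^[$xB + $xU]) + ($xInf - aC^[$xB + $xV + $xN + $xU]) ;;
      IF $xY <? $xD THEN xD ::= $xY FI
    FI ;;
    xJ ::= $xJ + #1
  OD.

(** A sample of closeness 0 is not reached from u and is skipped. Thus pivots are taken from the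
    same set of surviving reached vertices that [scan_size] charges for. *)
Definition select_pivots : cmd :=
  xG ::= ($xD - #1) ./ #2 ;;
  xK ::= #0 ;;
  xJ ::= #0 ;;
  WHILE $xJ <? $xCnt DO
    IF aSmp^[$xJ] =? $xU THEN CSkip ELSE
      xX ::= aSmp^[$xJ] ;;
      xCX ::= aC^[#2 * $xJ * $xV + $xV + $xN + $xU] ;;
      IF $xCX THEN
        test_vertex ;;
        IF $xFlag THEN aR^[$xK] ::= #2 * $xJ * $xV ;; xK ::= $xK + #1 FI
      FI
    FI ;;
    xJ ::= $xJ + #1
  OD.

(** The edges into u are read off the list of n + u in the reversed copy, whose heads have the form
    n + v. When no cycle is found the output keeps its initial 0, the code of infinity. *)
Definition close_cycles : cmd :=
  xE ::= aFst^[$xN + $xU] ;;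
  WHILE $xE DO
    xY ::= ($xInf - aC^[$xBase + (aDst^[$xE - #1] - $xN)]) + aW^[$xE - #1] ;;
    IF $xY <? $xD THEN xD ::= $xY FI ;;
    xE ::= aNxt^[$xE - #1]
  OD ;;
  IF $xD <? $xInf THEN aOut^[$xU] ::= $xD FI.

(** Each u has its own region of [aC], above all sample blocks and never written before; clearing a
    shared region would cost n steps per vertex. *)
Definition vertex_estimate : cmd :=
  roundtrips ;;
  select_pivots ;;
  xBase ::= (#2 * $xCnt + $xU + #1) * $xV ;;
  xSrc ::= $xU ;;
  search ;;
  close_cycles.

(** Running over edges and marking their tails keeps the cost proportional to m even when n is much
    larger. A vertex that is no tail lies on no cycle and keeps the output 0. *)
Definition all_estimates : cmd :=
  xEdge ::= #0 ;;
  WHILE $xEdge <? $xM DO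
    xU ::= aTail^[$xEdge] ;;
    IF aSeen^[$xU] THEN CSkip ELSE aSeen^[$xU] ::= #1 ;; vertex_estimate FI ;;
    xEdge ::= $xEdge + #1
  OD.

Close Scope prog_scope.

Section Estimates.
Variables (w n m INF lg : nat) (tl hd ln : nat -> nat) (d : nat -> nat -> nat) (smp : seq nat).
Local Notation V := (2 * n).
Local Notation out := (doubled n tl hd ln m).
Local Notation cnt := (size smp).
Hypotheses (w0 : 0 < w) (n0 : 0 < n) (INF0 : 0 < INF) (INFW : 8 * INF < 2 ^ w)
  (VW : 4 * V < 2 ^ w) (regW : (2 * cnt + n + 4) * V < 2 ^ w) (Vlg : 2 * V <= 2 ^ lg)
  (mW : 4 * m + 4 < 2 ^ w).
Hypothesis edgeP : forall i, i < m -> [/\ tl i < n, hd i < n & 0 < ln i <= INF].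
Hypothesis dP : is_dist INF out d.
Hypothesis smpP : forall r, r \in smp -> r < n.

Let edgeP' i : i < m -> [/\ tl i < n, hd i < n & 0 < ln i].
Proof. by move=> /edgeP [h1 h2 /andP[h3 _]]. Qed.

Let outP := doubled_bound edgeP'.

Definition consts (s : state) : Prop :=
  [/\ vars s xN = n, vars s xInf = INF, vars s xV = V & vars s xCnt = cnt].

Definition graph_ok (s : state) : Prop :=
  [/\ adjacency w V out s, heap V (arrs s aT) (fun=> 0) &
      forall j, j < cnt -> arrs s aSmp j = nth 0 smp j].

Definition dists_ok (s : state) (k : nat) : Prop := forall j, j < k -> forall v, v < V ->
  arrs s aC (2 * j * V + v) = INF - d (nth 0 smp j) v /\
  arrs s aC (2 * j * V + V + v) = INF - d (n + nth 0 smp j) v.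

Lemma adjacency_ext s s' :
  (forall a i, a \in [:: aFst; aNxt; aDst; aW] -> arrs s' a i = arrs s a i) ->
  adjacency w V out s -> adjacency w V out s'.
Proof.
move=> e [L h]; exists L => v vV; have [h1 h2 h3] := h v vV; split=> //.
  by rewrite e //; apply: chain_ext h1 => i _; rewrite e.
by rewrite h3; apply: eq_map => i; rewrite !e.
Qed.

Let smp_nth j : j < cnt -> nth 0 smp j < n.
Proof. by move=> h; apply/smpP/mem_nth. Qed.

Let size_le P F : search_size V out P F <= 2 * m.
Proof.
rewrite -(size_doubled (tl := tl) (hd := hd) ln (n := n) (k := m)); last first.
  by move=> i /edgeP [].
by rewrite /search_size big_mkcond leq_sum // => v _; case: ifP.
Qed.

Lemma full_search_spec s base src : consts s -> adjacency w V out s ->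
  heap V (arrs s aT) (fun=> 0) -> vars s xK = 0 -> vars s xU < n -> vars s xG = 0 ->
  vars s xBase = base -> vars s xSrc = src -> src < V -> base + V < 2 ^ w ->
  (forall v, v < V -> arrs s aC (base + v) = 0) ->
  wp w search s (fun t s' => [/\ heap V (arrs s' aT) (fun=> 0),
    forall i, i < base \/ base + V <= i -> arrs s' aC i = arrs s aC i,
    forall v, v < V -> arrs s' aC (base + v) = INF - d src v &
    t <= 900 * lg.+1 * (2 * m).+1]).
Proof.
move=> [sN sI sV sC] adj h0 sK sU sG sB sS srcV bW C0.
have par : params n V INF s 0 (vars s xU) 0 by [].
have V0 : 0 < V by lia.
have INFW4 : 4 * INF < 2 ^ w by lia.
apply: wp_frame.
  by apply: (search_spec w0 INF0 INFW4 V0 VW Vlg erefl outP par (base := base) (src := src)) => //; lia.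
move=> t s' _ /= [h1 h2 h3 h4]; split=> //.
  move=> v vV; exact: (search_full dP outP h3).
apply: leq_trans h4 _; rewrite muln1 leq_mul2l; apply/orP; right.
by rewrite ltnS size_le.
Qed.

Lemma sample_dists_spec s : consts s -> graph_ok s -> (forall i, arrs s aC i = 0) ->
  wp w sample_dists s (fun t s' => [/\ heap V (arrs s' aT) (fun=> 0), dists_ok s' cnt,
    forall i, 2 * cnt * V <= i -> arrs s' aC i = 0 &
    t <= 2000 * (cnt * (lg.+1 * (2 * m).+1)).+1]).
Proof.
move=> [sN sI sV sC] [adj h0 hS] C0; rewrite /sample_dists.
have W1 : 2 < 2 ^ w by lia.
apply: wp_seq; apply: wp_assign => //=; first by lia.
apply: wp_seq; apply: wp_assign => //=; first by lia.
apply: wp_seq; apply: wp_assign => //=; first by lia.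
apply: wp_seq; apply: wp_assign => //=; first by lia.
set s0 := set_var _ _ _; pose Z := lg.+1 * (2 * m).+1.
pose inv k t s' := let j := vars s' xJ in [/\ j + k = cnt, heap V (arrs s' aT) (fun=> 0),
  dists_ok s' j, forall i, 2 * j * V <= i -> arrs s' aC i = 0 &
  t <= 1900 * (j * Z) + 40 * j /\ [/\ vars s' xK = 0, vars s' xU = 0 & vars s' xG = 0]].
apply: (@wp_while _ w0 inv cnt).
  by rewrite /inv /=; split.
move=> k t s1 [fv fa] [hj hh hd1 hC [ht [hK hU hG]]] /=.
have [eN eI eV eC] : consts s1 by split; rewrite fv //.
have aS i : arrs s1 aSmp i = arrs s aSmp i by rewrite fa.
have adj1 : adjacency w V out s1.
  by apply: adjacency_ext adj => a i; rewrite !inE => h;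
     repeat case/orP: h => [/eqP ->|h]; rewrite ?(eqP h) fa.
rewrite eC; split=> //; split=> [z|nz].
  have k0 : vars s1 xJ = cnt by case: ltnP z; lia.
  rewrite k0 in hd1 hC ht; split=> //; rewrite -/Z.
  have : cnt <= cnt * Z by rewrite leq_pmulr.
  by move: ht; clear; lia.
have lt : vars s1 xJ < cnt by case: (_ < _) nz.
set j := vars s1 xJ in hj hd1 hC ht lt.
have regj : 2 * j * V + V + V + V < 2 ^ w.
  apply: leq_ltn_trans regW; rewrite -!mulSnr leq_mul2r; apply/orP; right; lia.
have jV2 : 2 * j <= 2 * j * V by rewrite leq_pmulr //; lia.
have rn := smp_nth lt; set r := nth 0 smp j in rn.
have arr : arrs s1 aSmp j = r by rewrite aS hS.
apply: wp_seq; apply: wp_assign => //=; rewrite -/j ?eV.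
  by do ![split]; lia.
apply: wp_seq; apply: wp_assign => //=; rewrite -/j ?arr.
apply: wp_seq; apply: wp_frame.
  apply: (full_search_spec (base := 2 * j * V) (src := r)) => //=.
  - by rewrite hU.
  - by lia.
  - by lia.
  - by move=> v vV; apply: hC; lia.
move=> t2 s2 fr2 [/= hh2 out2 C2 tle2].
have v2 x : x \in [:: xN; xV; xInf; xK; xU; xG; xBase; xCnt; xJ] ->
    vars s2 x = vars (set_var (set_var s1 6 (2 * j * V)) 7 r) x.
  by rewrite !inE => h; repeat case/orP: h => [/eqP ->|h]; rewrite ?(eqP h) fr2.1.
have a2 a i : a \in [:: aSmp; aFst; aNxt; aDst; aW] -> arrs s2 a i = arrs s1 a i.
  by rewrite !inE => h; repeat case/orP: h => [/eqP ->|h]; rewrite ?(eqP h) fr2.2.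
have adj2 : adjacency w V out s2.
  by apply: adjacency_ext adj1 => a i h; rewrite a2 // inE h orbT.
apply: wp_seq; apply: wp_assign => //=; first by rewrite !v2 //= eV; lia.
rewrite !v2 //= eV.
apply: wp_seq; apply: wp_assign => //=; first by rewrite !v2 //= eN a2 // arr; lia.
rewrite !v2 //= eN a2 // arr.
apply: wp_seq; apply: wp_frame.
  apply: (full_search_spec (base := 2 * j * V + V) (src := n + r)) => //=.
  - by split; rewrite /= v2.
  - by rewrite v2.
  - by rewrite v2 //= hU.
  - by rewrite v2.
  - by lia.
  - by lia.
  - by move=> v vV; rewrite out2; [apply: hC; lia|lia].
move=> t3 s3 fr3 [/= hh3 out3 C3 tle3].
have v3 x : x \in [:: xK; xU; xG; xJ] -> vars s3 x = vars s1 x.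
  move=> h; rewrite fr3.1; move: h; rewrite !inE => h;
    repeat case/orP: h => [/eqP ->|h]; rewrite ?(eqP h) //= v2 //.
apply: wp_assign => //=; first by rewrite v3 // -/j; split=> //; lia.
exists k.-1; first by lia.
rewrite /inv /= !v3 // -/j addn1; split=> //.
- by lia.
- move=> j' j'j v vV; move: (j'j); rewrite ltnS leq_eqVlt => /orP[/eqP ->|lt'].
    by rewrite C3 // out3; [rewrite C2|lia].
  have [<- <-] := hd1 j' lt' v vV.
  have reg' : 2 * j' * V + V + V <= 2 * j * V.
    by rewrite -!mulSnr leq_mul2r; apply/orP; right; lia.
  by split; rewrite out3 ?out2 //; lia.
- move=> i; rewrite -!mulnA mulSn !mulnA => hi.
  have hi2 : 2 * j * V + V + V <= i by lia.
  by rewrite out3 ?out2; [apply: hC|..]; lia.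
- split=> //; move: ht tle2 tle3; rewrite mulSn -/Z -!mulnA -/Z.
  by clear; lia.
Qed.

(** * Round trips, pivots and the estimate of one vertex *)

Let dI u v : d u v <= INF. Proof. by have [] := dP u v. Qed.

Let V2W : 2 < 2 ^ w. Proof. by lia. Qed.

Definition rt_step u D r := if r == u then D else minn D (d r u + d u r).
Definition rt_min u rs := foldl (rt_step u) INF rs.

Lemma rt_min_le u rs : rt_min u rs <= INF.
Proof.
rewrite /rt_min; have : INF <= INF by []; move: {1 3}INF => D.
elim: rs D => //= r rs IH D h; apply: IH; rewrite /rt_step.
by case: ifP => // _; apply: leq_trans h; apply: geq_minl.
Qed.

Lemma rt_min_mem u rs r : r \in rs -> r != u -> rt_min u rs <= d r u + d u r.
Proof.
rewrite /rt_min; elim: rs INF => //= r' rs IH D; rewrite inE => /orP[/eqP <-|rrs] ru; last exact: IH.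
have le D' : foldl (rt_step u) D' rs <= D'.
  elim: rs D' {IH} => //= a rs IH D'; apply: leq_trans (IH _) _; rewrite /rt_step.
  by case: ifP => // _; apply: geq_minl.
by apply: leq_trans (le _) _; rewrite /rt_step (negbTE ru) geq_minr.
Qed.

Lemma rt_min_attained u rs : rt_min u rs = INF \/
  exists r, [/\ r \in rs, r != u & rt_min u rs = d r u + d u r].
Proof.
elim/last_ind: rs => [|rs r IH]; first by left.
rewrite /rt_min foldl_rcons -/(rt_min u rs) /rt_step; case: eqP => [_|/eqP ru].
  by case: IH => [->|[r' [h1 h2 h3]]]; [left|right; exists r'; rewrite mem_rcons inE h1 orbT].
case: (leqP (rt_min u rs) (d r u + d u r)) => h.
  by case: IH => [->|[r' [h1 h2 h3]]]; [left|right; exists r'; rewrite mem_rcons inE h1 orbT].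
by right; exists r; rewrite mem_rcons mem_head.
Qed.

Lemma roundtrips_spec s u : consts s -> vars s xU = u -> u < n ->
  (forall j, j < cnt -> arrs s aSmp j = nth 0 smp j) -> dists_ok s cnt ->
  wp w roundtrips s (fun t s' => vars s' xD = rt_min u smp /\ t <= 60 * cnt.+1).
Proof.
move=> [sN sI sV sC] sU un hS hd0; rewrite /roundtrips.
apply: wp_seq; apply: wp_assign => //=; apply: wp_seq; apply: wp_assign => //=; first by lia.
pose inv k t s' := let j := vars s' xJ in [/\ j + k = cnt,
  vars s' xD = rt_min u (take j smp) & t <= 55 * j].
apply: (@wp_while _ w0 inv cnt).
  by rewrite /inv /= take0 sI.
move=> k t s1 [fv fa] [hj hD ht] /=.
have [eN eI eV eC] : consts s1 by split; rewrite fv //.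
have eU : vars s1 xU = u by rewrite fv.
have aE a i : arrs s1 a i = arrs s a i by rewrite fa.
rewrite eC; split=> //; split=> [z|nz].
  have k0 : vars s1 xJ = cnt by case: ltnP z; lia.
  by rewrite hD k0 take_size; split=> //; lia.
have lt : vars s1 xJ < cnt by case: (_ < _) nz.
set j := vars s1 xJ in hj hD ht lt.
have regj : 2 * j * V + V + V + V < 2 ^ w.
  apply: leq_ltn_trans regW; rewrite -!mulSnr leq_mul2r; apply/orP; right; lia.
have jV2 : 2 * j <= 2 * j * V by rewrite leq_pmulr //; lia.
have rn := smp_nth lt; set r := nth 0 smp j in rn.
have arr : arrs s1 aSmp j = r by rewrite aE hS.
have Dj : rt_min u (take j.+1 smp) = rt_step u (rt_min u (take j smp)) r.
  by rewrite /rt_min (take_nth 0) // foldl_rcons.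
have uV : u < V by lia.
have [c1 _] := hd0 j lt u uV.
have nuV : n + u < V by lia.
have [_ c2] := hd0 j lt (n + u) nuV.
have dnn : d (n + nth 0 smp j) (n + u) = d u r.
  exact: (dist_flip edgeP' dP un rn).
rewrite dnn addnA -/r in c2; rewrite -/r in c1.
have d1 := dI r u; have d2 := dI u r.
have k1 : k.-1 < k by lia.
have jW : j + 1 < 2 ^ w by lia.
apply: wp_seq; apply: wp_if => //=; rewrite -/j ?arr ?eU.
- move=> e; have {}e : r == u by case: (r == u) e.
  apply: wp_skip; apply: wp_assign => //=; rewrite -/j; first by split; lia.
  exists k.-1 => //; rewrite /inv /= -/j addn1 Dj /rt_step e /=; split=> //; lia.
- move=> e; have {}e : r == u = false by case: (r == u) e.
  apply: wp_seq; apply: wp_assign => //=; rewrite -/j ?eV; first by do ![split]; lia.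
  apply: wp_seq; apply: wp_assign => //=; rewrite ?eV ?eN ?eU ?eI !aE.
    by do ![split]; lia.
  rewrite c1 c2 !subKn //.
  apply: wp_if => //=; rewrite ?eV ?eN ?eU ?eI hD => h.
    have {}h : d r u + d u r < rt_min u (take j smp) by case: (_ < _) h.
    apply: wp_assign => //=; apply: wp_assign => //=; rewrite -/j; first by split; lia.
    exists k.-1 => //; rewrite /inv /= -/j addn1 Dj /rt_step e /=; split=> //; lia.
  have {}h : rt_min u (take j smp) <= d r u + d u r by rewrite leqNgt; case: (_ < _) h.
  apply: wp_skip; apply: wp_assign => //=; rewrite -/j; first by split; lia.
  exists k.-1 => //; rewrite /inv /= -/j addn1 Dj /rt_step e /=; split=> //; lia.
Qed.

Definition pivot_step u g (R : seq nat) r :=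
  if [&& r != u, d u r < INF & all (survives d u g r (d u r)) R] then rcons R r else R.
Definition pivots u g rs := foldl (pivot_step u g) [::] rs.

Lemma pivots_rcons u g rs r : pivots u g (rcons rs r) = pivot_step u g (pivots u g rs) r.
Proof. by rewrite /pivots foldl_rcons. Qed.

Lemma pivots_mem u g rs r : r \in pivots u g rs -> r \in rs /\ r != u.
Proof.
elim/last_ind: rs => // rs a IH; rewrite pivots_rcons /pivot_step mem_rcons.
case: ifP => [/andP[au _]|_]; rewrite ?mem_rcons !inE.
  by case/orP=> [/eqP ->|/IH [-> ->]]; rewrite ?eqxx ?orbT.
by move=> /IH [-> ->]; rewrite orbT.
Qed.

Lemma pivots_size_take u g rs j : size (pivots u g (take j rs)) <= size (pivots u g rs).
Proof.
rewrite -{2}(cat_take_drop j rs) /pivots foldl_cat.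
move: (foldl _ _ (take j rs)) => R; elim: (drop j rs) R => //= r rs' IH R.
apply: leq_trans (IH _); rewrite /pivot_step; case: ifP => // _.
by rewrite size_rcons.
Qed.

Lemma passes_pivots s u g js x cx : dists_ok s cnt -> u < n -> x < n ->
  (forall k, k < size js -> arrs s aR k = 2 * nth 0 js k * V) ->
  all (fun j => j < cnt) js ->
  passes n V INF (arrs s aC) (arrs s aR) (size js) u g x cx =
  all (survives d u g x (INF - cx)) (map (nth 0 smp) js).
Proof.
move=> hd0 un xn hR jsc; rewrite /passes all_map.
rewrite -[in RHS](mkseq_nth 0 js) /mkseq all_map; apply: eq_in_all => k.
rewrite mem_iota /= add0n => kl; rewrite hR //; set j := nth 0 js k.
have jc : j < cnt by apply: (allP jsc); apply: mem_nth.
have rn := smp_nth jc.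
have nxV : n + x < V by lia.
have nuV : n + u < V by lia.
have xV' : x < V by lia.
have [c1 _] := hd0 j jc x xV'; have [_ c2] := hd0 j jc _ nuV; have [_ c3] := hd0 j jc _ nxV.
rewrite (dist_flip edgeP' dP un rn) in c2; rewrite (dist_flip edgeP' dP xn rn) in c3.
by rewrite /passes1 -!(addnA (2 * j * V + V) n) c2 c3 c1 !subKn.
Qed.

Lemma select_pivots_spec s u : consts s -> vars s xU = u -> u < n ->
  (forall j, j < cnt -> arrs s aSmp j = nth 0 smp j) -> dists_ok s cnt ->
  vars s xD <= INF -> let g := (vars s xD - 1) %/ 2 in
  wp w select_pivots s (fun t s' => exists js,
    [/\ pivots u g smp = map (nth 0 smp) js /\ all (fun j => j < cnt) js,
        vars s' xK = size js /\ (forall k, k < size js -> arrs s' aR k = 2 * nth 0 js k * V),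
        vars s' xG = g &
        t <= 200 * ((size js).+1 * cnt.+1)]).
Proof.
move=> [sN sI sV sC] sU un hS hd0 DI g; rewrite /select_pivots.
apply: wp_seq; apply: wp_assign => //=; first by do ![split]; lia.
rewrite -/g; have gI : g <= INF by rewrite /g; lia.
apply: wp_seq; apply: wp_assign => //=; first by lia.
apply: wp_seq; apply: wp_assign => //=; first by lia.
(* The final number of pivots bounds every intermediate one, which gives a uniform cost per
   sample. *)
pose KF := size (pivots u g smp).
pose inv k t s' := exists js, let j := vars s' xJ in [/\ j + k = cnt,
  pivots u g (take j smp) = map (nth 0 smp) js /\ all (fun i => i < cnt) js,
  vars s' xK = size js /\ (forall i, i < size js -> arrs s' aR i = 2 * nth 0 js i * V),
  vars s' xG = g & t <= j * (90 * KF.+1 + 70)].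
apply: (@wp_while _ w0 inv cnt).
  by exists [::]; rewrite /= take0; split.
move=> k t s1 [fv fa] [js [hj [hp hall] [hK hR] hG ht]] /=.
have [eN eI eV eC] : consts s1 by split; rewrite fv //.
have eU : vars s1 xU = u by rewrite fv.
have aE a i : a != aR -> arrs s1 a i = arrs s a i by move=> h; rewrite fa //= ?(negbTE h).
have hd1 : dists_ok s1 cnt by move=> j jc v vV; rewrite !aE //; apply: hd0.
rewrite eC; split=> //; split=> [z|nz].
  have k0 : vars s1 xJ = cnt by case: ltnP z; lia.
  exists js; rewrite k0 take_size in hp; split=> //.
  have KE : KF = size js by rewrite /KF hp size_map.
  by move: ht; rewrite k0 KE; clear; nia.
have lt : vars s1 xJ < cnt by case: (_ < _) nz.
set j := vars s1 xJ in hj hp ht lt.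
have jsj : size js <= KF.
  by rewrite -(size_map (nth 0 smp)) -hp; apply: pivots_size_take.
have jscnt : size js <= cnt.
  have -> : size js = size (pivots u g (take j smp)) by rewrite hp size_map.
  have : size (take j smp) <= cnt by rewrite size_take; case: ifP => //; lia.
  apply: leq_trans; elim/last_ind: (take j smp) => // rs r IH.
  rewrite pivots_rcons size_rcons /pivot_step; case: ifP => _; rewrite ?size_rcons ?ltnS //.
  exact: leq_trans IH _.
have regj : 2 * j * V + V + V + V < 2 ^ w.
  apply: leq_ltn_trans regW; rewrite -!mulSnr leq_mul2r; apply/orP; right; lia.
have jV2 : 2 * j <= 2 * j * V by rewrite leq_pmulr //; lia.
have cntW : cnt + 1 < 2 ^ w.
  apply: leq_ltn_trans regW; apply: (@leq_trans (2 * cnt + n + 4)); first by lia.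
  by rewrite leq_pmulr //; lia.
have rn := smp_nth lt; set r := nth 0 smp j in rn.
have arr : arrs s1 aSmp j = r by rewrite aE // hS.
have pS : pivots u g (take j.+1 smp) = pivot_step u g (map (nth 0 smp) js) r.
  by rewrite (take_nth 0) // pivots_rcons hp.
have nuV : n + u < V by lia.
have [_ c2] := hd1 j lt (n + u) nuV.
rewrite (dist_flip edgeP' dP un rn) -/r addnA in c2.
have d2 := dI u r.
have k1 : k.-1 < k by lia.
have jW : j + 1 < 2 ^ w by lia.
have times c : c <= 90 * (size js).+1 + 70 -> t + c <= j.+1 * (90 * KF.+1 + 70).
  move=> hc; have : 90 * (size js).+1 <= 90 * KF.+1 by rewrite leq_mul2l ltnS jsj orbT.
  by rewrite mulSn; move: ht hc; clear; lia.
have fitreg : [/\ 2 * j < 2 ^ w, 2 * j * V < 2 ^ w, 2 * j * V + V < 2 ^ w,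
    2 * j * V + V + n < 2 ^ w & 2 * j * V + V + n + u < 2 ^ w] by split; lia.
have [ft1 ft2 ft3 ft4 ft5] := fitreg.
have stay cst : cst <= 90 * (size js).+1 + 70 -> pivots u g (take j.+1 smp) = map (nth 0 smp) js ->
   forall s', vars s' xJ = j + 1 -> vars s' xK = vars s1 xK -> vars s' xG = g ->
   (forall i, arrs s' aR i = arrs s1 aR i) -> exists2 k', k' < k & inv k' (t + cst) s'.
  move=> hc hp' s' h1 h2 h3 h4; exists k.-1 => //; exists js; rewrite h1 addn1; split=> //.
  - by lia.
  - by split; [rewrite h2|move=> i il; rewrite h4 hR].
  - exact: times.
apply: wp_seq; apply: wp_if => //=; rewrite -/j ?arr ?eU.
  move=> e; have {}e : r == u by case: (r == u) e.
  apply: wp_skip; apply: wp_assign => //=; rewrite -/j; first by split; lia.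
  by apply: stay => //=; [lia|rewrite pS /pivot_step e].
move=> e; have {}e : r != u by case: (r == u) e.
apply: wp_seq; apply: wp_assign => //=; rewrite -/j ?arr.
apply: wp_seq; apply: wp_assign => //=; rewrite -/j ?eV ?eN ?eU; first by do ![split].
rewrite c2.
apply: wp_if => //=; last first.
  move=> c0; apply: wp_skip; apply: wp_assign => //=; rewrite -/j; first by split; lia.
  have dn : d u r < INF = false by lia.
  by apply: stay => //=; [lia|rewrite pS /pivot_step dn andbF].
move=> cn0; have dn : d u r < INF by lia.
set s2 := set_var _ xCX _.
have par2 : params n V INF s2 (size js) u g by split=> //.
have INFW4 : 4 * INF < 2 ^ w by lia.
have KW : size js < 2 ^ w by lia.
have hd2 : dists_ok s2 cnt by [].
apply: wp_seq; apply: wp_frame.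
  apply: (test_spec w0 INFW4 par2 gI KW) => i il /=.
  rewrite hR //; have jc : nth 0 js i < cnt by apply: (allP hall); apply: mem_nth.
  have : 2 * nth 0 js i * V + V + V + V < 2 ^ w.
    apply: leq_ltn_trans regW; rewrite -!mulSnr leq_mul2r; apply/orP; right; lia.
  by lia.
move=> t3 s3 [fv3 fa3] [/= flag3 tle3].
have pE : passes n V INF (arrs s1 aC) (arrs s1 aR) (size js) u g r (INF - d u r) =
    all (survives d u g r (d u r)) (map (nth 0 smp) js).
  by rewrite (passes_pivots g _ hd1 un rn hR hall) subKn.
rewrite pE in flag3.
have v3 x : x \in [:: xJ; xK; xG; xV] -> vars s3 x = vars s1 x.
  by rewrite !inE => h; repeat case/orP: h => [/eqP ->|h]; rewrite ?(eqP h) fv3.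
have a3 i : arrs s3 aR i = arrs s1 aR i by rewrite fa3.
apply: wp_if => //=; rewrite flag3 => h; last first.
  have {}h : all (survives d u g r (d u r)) (map (nth 0 smp) js) = false by case: (all _ _) h.
  apply: wp_skip; apply: wp_assign => //=; rewrite ?v3 // -/j; first by split; lia.
  by apply: stay => //=; [lia|rewrite pS /pivot_step h !andbF|rewrite v3|rewrite v3].
have {}h : all (survives d u g r (d u r)) (map (nth 0 smp) js) by case: (all _ _) h.
apply: wp_seq; apply: wp_put => //=; rewrite ?v3 // -/j ?eV; first by do ![split].
apply: wp_assign => //=; rewrite ?v3 // ?hK; first by split; lia.
apply: wp_assign => //=; rewrite ?v3 // -/j; first by split; lia.
exists k.-1 => //; exists (rcons js j); rewrite /= ?v3 // -/j addn1; split=> //.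
- by lia.
- by rewrite pS /pivot_step e dn h map_rcons all_rcons lt hall.
- rewrite size_rcons addn1; split=> // i; rewrite ltnS leq_eqVlt nth_rcons.
  case: eqVneq => [->|ne /= il]; first by rewrite ltnn.
  by rewrite il a3 hR.
- by apply: times; lia.
Qed.

Lemma out_flip u x l : u < n -> (x, l) \in out (n + u) <->
  exists2 v, x = n + v & v < n /\ (u, l) \in out v.
Proof.
move=> un; split.
  move=> /mem_doubled [i [im [h ->]]]; have [h1 h2 _] := edgeP im.
  case: h => -[e ->]; first by lia.
  exists (tl i) => //; split=> //; apply/mem_doubled; exists i; split=> //; split=> //.
  by left; split=> //; lia.
move=> [v -> [vn /mem_doubled [i [im [h ->]]]]]; have [h1 h2 _] := edgeP im.
apply/mem_doubled; exists i; split=> //; split=> //; right.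
by case: h => -[e1 e2]; lia.
Qed.

Definition close_step (F : nat -> nat) D (e : nat * nat) := minn D ((INF - F (e.1 - n)) + e.2).

Lemma close_fold_le F D es : foldl (close_step F) D es <= D.
Proof.
elim: es D => //= e es IH D; apply: leq_trans (IH _) _; exact: geq_minl.
Qed.

Lemma close_fold_mem F D es e : e \in es ->
  foldl (close_step F) D es <= (INF - F (e.1 - n)) + e.2.
Proof.
elim: es D => //= e' es IH D; rewrite inE => /orP[/eqP <-|]; last exact: IH.
by apply: leq_trans (close_fold_le _ _ _) _; apply: geq_minr.
Qed.

Lemma close_fold_attained F D es : foldl (close_step F) D es = D \/
  exists2 e, e \in es & foldl (close_step F) D es = (INF - F (e.1 - n)) + e.2.
Proof.
elim/last_ind: es => [|es e IH]; first by left.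
rewrite foldl_rcons /close_step; set D' := foldl _ _ _ in IH *.
case: (leqP D' (INF - F (e.1 - n) + e.2)) => h; last first.
  by right; exists e; rewrite ?mem_rcons ?mem_head.
by case: IH => [->|[e' h1 ->]]; [left|right; exists e'; rewrite ?mem_rcons ?inE ?h1 ?orbT].
Qed.

Lemma close_cycles_spec s u base : consts s -> adjacency w V out s ->
  vars s xU = u -> u < n -> vars s xBase = base -> base + V < 2 ^ w ->
  vars s xD <= INF -> arrs s aOut u = 0 ->
  wp w close_cycles s (fun t s' =>
    let D := foldl (close_step (fun v => arrs s aC (base + v))) (vars s xD) (out (n + u)) in
    [/\ forall i, arrs s' aOut i = if i == u then (if D < INF then D else 0) else arrs s aOut i
      & t <= 60 * (size (out (n + u))).+1]).
Proof.
move=> [sN sI sV sC] [L adj] sU un sB bW DI out0; rewrite /close_cycles.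
have nuV : n + u < V by lia.
have [chL allL outL] := adj _ nuV.
set F := fun v => arrs s aC (base + v).
apply: wp_seq; apply: wp_assign => //=; rewrite ?sN ?sU; first by split; lia.
pose inv k t s' := exists pre Lq, [/\ size Lq = k,
  out (n + u) = pre ++ [seq (arrs s aDst i, arrs s aW i) | i <- Lq],
  chain (arrs s aNxt) (vars s' xE) Lq /\ all (fun i => i < 2 ^ w) Lq,
  vars s' xD = foldl (close_step F) (vars s xD) pre &
  t + 50 * k <= 50 * size (out (n + u))].
apply: wp_seq; apply: wp_frame.
  apply: (@wp_while _ w0 inv (size (L (n + u))) _ _ _ (fun t s' =>
     vars s' xD = foldl (close_step F) (vars s xD) (out (n + u)) /\
     t <= 50 * size (out (n + u)) + 2)).
    by exists [::], (L (n + u)); split=> //; rewrite outL size_map.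
  move=> k t s1 [fv fa] [pre [Lq [sq oq [cq aq] hD ht]]] /=; split=> //.
  have [eN eI eV eC] : consts s1 by split; rewrite fv.
  have eB : vars s1 xBase = base by rewrite fv.
  have aE a i : arrs s1 a i = arrs s a i by rewrite fa.
  split=> [z|].
    have Lq0 : Lq = [::] by case: Lq cq {sq oq aq} => //= i Lq []; rewrite z.
    by split; [rewrite hD oq Lq0 cats0|lia].
  case: Lq sq oq cq aq => [|i Lq] //=; first by move=> _ _ -> _; rewrite eqxx.
  move=> sq oq [xEi cq] /andP[iW aq] _.
  have : (arrs s aDst i, arrs s aW i) \in out (n + u) by rewrite oq mem_cat mem_head orbT.
  move=> /(out_flip _ _ un) [v ev [vn /mem_doubled [e [em [_ el]]]]].
  have [_ _ /andP[_ lI]] := edgeP em; rewrite -el in lI.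
  set l := arrs s aW i in oq lI *.
  have v1 : vars s1 xE - 1 = i by rewrite xEi subn1.
  have FleI := leq_subr (F v) INF.
  have vV : base + v < 2 ^ w by lia.
  apply: wp_seq; apply: wp_assign => //=; rewrite ?v1 ?aE ?ev ?eN ?eB ?eI ?addKn.
    by do ![split]; lia.
  rewrite -/(F v) -/l.
  have k1 : k.-1 < k by lia.
  have W1 : 1 < 2 ^ w by lia.
  have finish c D E : c <= 50 -> D = minn (vars s1 xD) (INF - F v + l) -> E = arrs s aNxt i ->
     forall s', vars s' xD = D -> vars s' xE = E -> exists2 k', k' < k & inv k' (t + c) s'.
    move=> c50 eD eE s' hD' hE'; exists k.-1 => //; exists (rcons pre (v + n, l)), Lq; split.
    - by rewrite -sq.
    - by rewrite oq ev cat_rcons addnC.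
    - by rewrite hE' eE.
    - by rewrite foldl_rcons -hD hD' eD /close_step /= addnK.
    - by rewrite -sq /=; move: ht; rewrite -sq; lia.
  apply: wp_seq; apply: wp_if => //=.
    move=> h; have {}h : INF - F v + l < vars s1 xD by case: (_ < _) h.
    apply: wp_assign => //=; apply: wp_assign => //=; first by split; lia.
    by apply: finish; [| | |reflexivity|reflexivity] => //=; [lia|rewrite v1 aE].
  move=> h; have {}h : vars s1 xD <= INF - F v + l by rewrite leqNgt; case: (_ < _) h.
  apply: wp_skip; apply: wp_assign => //=; first by split; lia.
  by apply: finish; [| | |reflexivity|reflexivity] => //=; [lia|rewrite v1 aE].
move=> t2 s2 [fv2 fa2] [/= hD2 tle2].
have [eN eI eV eC] : consts s2 by split; rewrite fv2.
have eU : vars s2 xU = u by rewrite fv2.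
have a2 i : arrs s2 aOut i = arrs s aOut i by rewrite fa2.
apply: wp_if => //=; rewrite hD2 eI => h.
  apply: wp_put => //=; rewrite eU hD2.
  split; last by lia.
  move=> i; have -> : foldl (close_step F) (vars s xD) (out (n + u)) < INF by case: (_ < _) h.
  by rewrite a2; case: (i == u).
apply: wp_skip; split; last by lia.
move=> i; have -> : foldl (close_step F) (vars s xD) (out (n + u)) < INF = false by case: (_ < _) h.
by rewrite a2; case: eqP => // ->.
Qed.

(** A pruned search may hold an overestimate of the distance to v. If v passes with it, then v
    passes with the true distance, so expanded vertices are true survivors and the cost bound
    applies. *)
Lemma survives_mono u g v dv dv' r : dv' <= dv -> survives d u g v dv r ->
  survives d u g v dv' r.
Proof. by rewrite /survives => le /andP[h1 h2]; apply/andP; split; lia. Qed.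

Definition closed_walk u S := exists v a l,
  [/\ v < n, walk out u v a, (u, l) \in out v & a + l = S].

(** Since r differs from u the walk back has a last edge, which becomes the closing edge. *)
Lemma roundtrip_closed u r : u < n -> r < n -> r != u -> d r u < INF -> d u r < INF ->
  closed_walk u (d r u + d u r).
Proof.
move=> un rn ru l1 l2; have [_ /(_ l1) w1 _] := dP r u; have [_ /(_ l2) w2 _] := dP u r.
have : exists v b l, [/\ v < n, walk out r v b, (u, l) \in out v & d r u = b + l].
  case: {1 2}u (d r u) / w1 ru => [|v x b l wb vx]; first by rewrite eqxx.
  by exists v, b, l; split=> //; apply: (walk_low edgeP' wb).
move=> [v [b [l [vn wb vu ->]]]]; exists v, (d u r + b), l; split=> //; last by lia.
exact: walk_trans w2 wb.
Qed.

(** The source is exempt from elimination, as samples equal to u are never pivots; its own edges are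
    therefore charged separately. *)
Definition scan_size u g R := size (out u) +
  \sum_(x <- iota 0 n | [&& x != u, d u x < INF & all (survives d u g x (d u x)) R]) size (out x).

Lemma local_search_size u g R F : u < n ->
  (forall v, v < V -> 0 < F v -> F v <= INF /\ walk out u v (INF - F v)) ->
  search_size V out (fun x cx => all (survives d u g x (INF - cx)) R) F <= scan_size u g R.
Proof.
move=> un sound; rewrite /search_size /scan_size big_mkcond /=.
have -> : iota 0 V = iota 0 n ++ iota n n by rewrite -{2}(add0n n) -iotaD mul2n addnn.
rewrite big_cat /= [X in _ + X <= _]big1_seq => [|x]; last first.
  move=> /andP[_]; rewrite mem_iota => xn; case: ifP => // /andP[Fx _].
  have xlV : x < V by lia.
  by have [_ /(walk_low edgeP') /(_ un)] := sound x xlV Fx; lia.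
rewrite addn0 (bigD1_seq u) ?iota_uniq ?mem_iota //= leq_add //; first by case: ifP.
rewrite big_mkcond [leqRHS]big_mkcond /= big_seq [leqRHS]big_seq; apply: leq_sum => x.
rewrite mem_iota add0n /= => xn; case: eqP => //= _; case: ifP => // /andP[Fx hR].
have xlV : x < V by lia.
have [FleI wx] := sound x xlV Fx; have [_ _ /(_ _ wx) dx] := dP u x.
rewrite ifT //; apply/andP; split; first by lia.
by apply: sub_all hR => r; apply: survives_mono.
Qed.

(** Closed walks may replace simple cycles, since [walk_cycle] finds in each a cycle that is no
    heavier. The restriction 2 S < INF covers every simple cycle. *)
Definition vertex_result u D := (D < INF -> closed_walk u D) /\
  (forall S, closed_walk u S -> 2 * S < INF -> D <= 2 * S).

(** Either the least round trip is already at most 2 S, or S is within the radius; then the vertex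
    before u on the closed walk survives all pivots, its distance is exact, and its closing edge
    yields at most S. *)
Lemma vertex_result_close u F (R : seq nat) (D0 := rt_min u smp) (g := (D0 - 1) %/ 2) :
  u < n -> {subset R <= smp} -> (forall r, r \in R -> r != u) ->
  search_result V INF out u (fun x cx => all (survives d u g x (INF - cx)) R) F ->
  vertex_result u (foldl (close_step F) D0 (out (n + u))).
Proof.
move=> un Rsmp Ru res; set D := foldl _ _ _.
have uV : u < V by lia.
split=> [DI|S [v [a [l [vn wv vu aS]]]] SI].
  case: (close_fold_attained F D0 (out (n + u))) => [e|[[x l] he e]].
    rewrite /D e in DI *; case: (rt_min_attained u smp) => [e0|[r [h1 h2 h3]]].
      by rewrite /D0 e0 ltnn in DI.
    rewrite -/D0 in h3; rewrite h3; apply: roundtrip_closed => //; first exact: smpP.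
      by rewrite h3 in DI; lia.
    by rewrite h3 in DI; lia.
  rewrite /D e in DI *; have /(out_flip _ _ un) [v ev [vn vu]] := he.
  rewrite /= ev addKn in DI *.
  have [_ sound _] := res; have vV : v < V by lia.
  have Fv : 0 < F v by lia.
  have [FleI wv] := sound v vV Fv.
  by exists v, (INF - F v), l.
case: (leqP D0 (2 * S)) => h.
  by apply: leq_trans h; apply: close_fold_le.
have gS : S <= g by rewrite /g; lia.
have wu : walk out v u l by rewrite -(add0n l); apply: walk_snoc vu; constructor.
have sv r : r \in R -> survives d u g v (d u v) r.
  move=> rR; apply: (survives_near dP wv wu); first by lia.
  by have := rt_min_mem (Rsmp r rR) (Ru r rR); rewrite -/D0 /g; lia.
have [_ h2 /(_ _ wv) h3] := dP u v.
have dvI : d u v < INF by lia.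
have [] := search_exact (Q := fun x => all (survives d u g x (d u x)) R)
  dP outP res _ _ uV (h2 dvI) erefl dvI.
- by move=> x y l' xy dy; apply: sub_all => r; apply: (survives_prefix dP xy dy).
- by move=> x cx hR e; apply: sub_all hR => r; rewrite e.
- by apply/allP => r /sv.
move=> _ Fv; have hmem : (n + v, l) \in out (n + u) by apply/out_flip => //; exists v.
have := close_fold_mem F D0 hmem; rewrite -/D /= addKn Fv subKn; last by lia.
by lia.
Qed.

Definition radius u := (rt_min u smp - 1) %/ 2.
Definition vertex_pivots u := pivots u (radius u) smp.
Definition vertex_time u :=
  let K := (size (vertex_pivots u)).+1 in
  2000 * (K * cnt.+1 + lg.+1 * K * (scan_size u (radius u) (vertex_pivots u)).+1
          + (size (out (n + u))).+1).

Lemma vertex_estimate_spec s u (base := (2 * cnt + u + 1) * V) :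
  consts s -> graph_ok s -> dists_ok s cnt ->
  vars s xU = u -> u < n -> (forall v, v < V -> arrs s aC (base + v) = 0) -> arrs s aOut u = 0 ->
  wp w vertex_estimate s (fun t s' => exists D,
    [/\ vertex_result u D,
        forall i, arrs s' aOut i = if i == u then (if D < INF then D else 0) else arrs s aOut i,
        heap V (arrs s' aT) (fun=> 0),
        forall i, i < base \/ base + V <= i -> arrs s' aC i = arrs s aC i &
        t <= vertex_time u]).
Proof.
move=> cs [adj h0 hS] hd0 sU un C0 out0; rewrite /vertex_estimate.
have [sN sI sV sC] := cs.
have uV : u < V by lia.
apply: wp_seq; apply: wp_frame.
  exact: (roundtrips_spec cs sU un hS hd0).
move=> t1 s1 [fv1 fa1] [D1 tle1].
have cs1 : consts s1 by split; rewrite fv1.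
have a1 a i : arrs s1 a i = arrs s a i by rewrite fa1.
have hS1 j : j < cnt -> arrs s1 aSmp j = nth 0 smp j by move=> h; rewrite a1 hS.
have hd1 : dists_ok s1 cnt by move=> j jc v vV; rewrite !a1; apply: hd0.
have sU1 : vars s1 xU = u by rewrite fv1.
have DI : vars s1 xD <= INF by rewrite D1 rt_min_le.
apply: wp_seq; apply: wp_frame.
  exact: (select_pivots_spec cs1 sU1 un hS1 hd1 DI).
move=> t2 s2 [fv2 fa2] [js [[hp hall] [hK hR] hG tle2]].
rewrite D1 -/(radius u) in hp hG.
rewrite -/(vertex_pivots u) in hp.
have KE : size js = size (vertex_pivots u) by rewrite hp size_map.
have [eN eI eV eC] : consts s2 by case: cs1 => ? ? ? ?; split; rewrite fv2.
have a2 a i : a != aR -> arrs s2 a i = arrs s a i.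
  by move=> h; rewrite fa2 //= ?a1 // !(negbTE h).
have sU2 : vars s2 xU = u by rewrite fv2.
have rad : radius u <= INF by rewrite /radius; have := rt_min_le u smp; lia.
have jscnt : size js <= cnt.
  rewrite KE; rewrite /vertex_pivots; elim/last_ind: smp => // rs r IH.
  rewrite pivots_rcons size_rcons /pivot_step; case: ifP => _; rewrite ?size_rcons ?ltnS //.
  exact: leq_trans IH _.
have baseW : base + V < 2 ^ w.
  by apply: leq_ltn_trans regW; rewrite /base -mulSnr leq_mul2r; apply/orP; right; lia.
have Vn0 : 0 < V by lia.
have cuW : 2 * cnt + u + 1 < 2 ^ w.
  by apply: leq_ltn_trans baseW; rewrite /base; apply: leq_trans (leq_addr _ _); rewrite leq_pmulr.
apply: wp_seq; apply: wp_assign => //=; rewrite ?eC ?sU2 ?eV -/base.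
  by do ![split]; lia.
apply: wp_seq; apply: wp_assign => //=; rewrite ?sU2.
set s3 := set_var _ xSrc u.
have par3 : params n V INF s3 (size js) u (radius u) by split.
have adj3 : adjacency w V out s3.
  by apply: adjacency_ext adj => a i h; rewrite /= a2 //; apply: contraTneq h => ->.
have INFW4 : 4 * INF < 2 ^ w by lia.
have KW : size js < 2 ^ w by lia.
have hd3 : dists_ok s3 cnt by move=> j jc v vV; rewrite /= !a2 //; apply: hd0.
apply: wp_seq; apply: wp_frame.
  apply: (search_spec w0 INF0 INFW4 Vn0 VW Vlg erefl outP par3 (base := base) (src := u)) => //=.
  - move=> k kl; rewrite hR //.
    have jc : nth 0 js k < cnt by apply: (allP hall); apply: mem_nth.
    by rewrite -mulnDl /base leq_mul2r; apply/orP; right; lia.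
  - by move=> _ v a wv; apply: (walk_low edgeP' wv un).
  - by apply: heap_ext h0 _ _ => // i; rewrite a2.
  - by move=> v vV; rewrite a2 // C0.
move=> t4 s4 [fv4 fa4] /= [h4 out4 res4 tle4].
set F := fun v => arrs s4 aC (base + v) in res4 tle4.
set P := passes _ _ _ _ _ _ _ _ in res4 tle4.
pose P' x cx := all (survives d u (radius u) x (INF - cx)) (vertex_pivots u).
(* The array test and the abstract one agree only at reached vertices, which lie in the first copy;
   neither the result nor the size of the search looks at others. *)
have PE x : x < V -> 0 < F x -> P x (F x) = P' x (F x).
  move=> xV' Fx; have [_ sound _] := res4; have [_ wx] := sound x xV' Fx.
  have xn := walk_low edgeP' wx un.
  rewrite /P' hp -(passes_pivots (radius u) (F x) hd3 un xn hR hall).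
  by [].
have res' : search_result V INF out u P' F.
  have [r1 r2 r3] := res4; split=> // x y l xV' Fx; rewrite -PE //; exact: r3.
have szE : search_size V out P F = search_size V out P' F.
  rewrite /search_size big_seq_cond [RHS]big_seq_cond; apply: eq_bigl => x.
  rewrite mem_iota /=; case: ltnP => //= xV'; case: posnP => //= Fx; exact: PE.
have sz' : search_size V out P' F <= scan_size u (radius u) (vertex_pivots u).
  by have [_ r2 _] := res'; apply: local_search_size.
have cs4 : consts s4 by split; rewrite fv4.
have sU4 : vars s4 xU = u by rewrite fv4.
have sB4 : vars s4 xBase = base by rewrite fv4.
have sD4 : vars s4 xD = rt_min u smp by rewrite fv4 //= fv2.
have adj4 : adjacency w V out s4.
  by apply: adjacency_ext adj3 => a i; rewrite !inE => h;
     repeat case/orP: h => [/eqP ->|h]; rewrite ?(eqP h) fa4.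
have DI4 : vars s4 xD <= INF by rewrite sD4 rt_min_le.
have out04 : arrs s4 aOut u = 0 by rewrite fa4 //= a2.
apply: wp_frame.
  exact: (close_cycles_spec cs4 adj4 sU4 un sB4 baseW DI4 out04).
move=> t5 s5 [fv5 fa5] /= [hout tle5]; rewrite sD4 -/F in hout.
exists (foldl (close_step F) (rt_min u smp) (out (n + u))); split.
- apply: (vertex_result_close un _ _ res') => r.
    by move=> /pivots_mem [].
  by move=> /pivots_mem [].
- by move=> i; rewrite hout fa4 //= a2.
- by apply: heap_ext h4 _ _ => // i; rewrite fa5.
- by move=> i hi; rewrite fa5 // out4 //= a2.
- rewrite /vertex_time -KE; move: tle1 tle2 tle4 tle5.
  rewrite szE; set sc := scan_size _ _ _ in sz' *.
  set so := size (out (n + u)); move=> tle1 tle2 tle4 tle5.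
  have : 900 * (lg.+1 * (size js).+1) * (search_size V out P' F).+1 <= 900 * (lg.+1 * (size js).+1 * sc.+1).
    by rewrite -mulnA !leq_mul2l ltnS sz' !orbT.
  have : cnt.+1 <= (size js).+1 * cnt.+1 by rewrite leq_pmull.
  by move: tle1 tle2 tle4 tle5; clear; lia.
Qed.

(** This shows that the loop over edges misses no vertex that lies on a cycle. *)
Lemma closed_walk_edge u S : u < n -> closed_walk u S -> exists2 i, i < m & tl i = u.
Proof.
move=> un [v [a [l [vn wv vu _]]]].
have first : v = u \/ exists x l', (x, l') \in out u.
  elim: wv {vn vu} => [|{v}v x b l' _ IH vx]; first by left.
  by right; case: IH => [<-|]; [exists x, l'|].
have [x [l' /mem_doubled [i [im [h _]]]]] : exists x l', (x, l') \in out u.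
  by case: first => [e|//]; rewrite e in vu; exists u, l.
by exists i => //; case: h => -[] //; lia.
Qed.

Lemma all_estimates_spec s : consts s -> graph_ok s ->
  dists_ok s cnt -> vars s xM = m -> (forall i, arrs s aTail i = tl i) ->
  (forall i, 2 * cnt * V <= i -> arrs s aC i = 0) ->
  (forall u, arrs s aOut u = 0) -> (forall u, arrs s aSeen u = 0) ->
  wp w all_estimates s (fun t s' =>
    (forall u, u < n -> exists2 D, vertex_result u D &
       arrs s' aOut u = if D < INF then D else 0) /\
    exists S, [/\ uniq S, {subset S <= iota 0 n}, size S <= m &
      t <= 30 * m.+1 + \sum_(u <- S) (vertex_time u + 20)]).
Proof.
move=> cs [adj h0 hS] hd0 sM sT C0 out0 seen0; rewrite /all_estimates.
apply: wp_seq; apply: wp_assign => //=; first by lia.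
pose inv k t s' := let j := vars s' xEdge in exists S, [/\ j + k = m,
  [/\ uniq S, forall v, v \in S <-> exists2 i, i < j & tl i = v & size S <= j],
  [/\ heap V (arrs s' aT) (fun=> 0), dists_ok s' cnt &
      forall u, u < n -> u \notin S -> forall v, v < V -> arrs s' aC ((2 * cnt + u + 1) * V + v) = 0],
  (forall u, (arrs s' aSeen u == 0) = (u \notin S)) /\
  (forall u, if u \in S then exists2 D, vertex_result u D &
       arrs s' aOut u = (if D < INF then D else 0) else arrs s' aOut u = 0) &
  t <= 20 * j + \sum_(u <- S) (vertex_time u + 20)].
apply: (@wp_while _ w0 inv m).
  exists [::]; rewrite /= big_nil; split=> //.
  - by split=> // v; split=> // -[].
  - split=> // u un _ v vV; apply: C0; rewrite !mulnDl; lia.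
  - by split=> u; rewrite ?seen0 ?out0.
move=> k t s1 [fv fa] [S [hj [US memS szS] [hh hd1 fresh] [seen res] ht]] /=.
have [eN eI eV eC] : consts s1 by case: cs => ? ? ? ?; split; rewrite fv.
have eM : vars s1 xM = m by rewrite fv //= sM.
have aE a i : a \in [:: aTail; aSmp; aFst; aNxt; aDst; aW] -> arrs s1 a i = arrs s a i.
  by rewrite !inE => h; repeat case/orP: h => [/eqP ->|h]; rewrite ?(eqP h) fa.
rewrite eM; split=> //; split=> [z|nz].
  have k0 : vars s1 xEdge = m by case: ltnP z; lia.
  rewrite k0 in memS szS ht; split.
    (* A vertex never marked lies on no closed walk, so INF is a valid result for it, and its
       untouched output 0 is the matching code. *)
    move=> u un; have := res u; case: ifP => // uS ->; exists INF; last by rewrite ltnn.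
    split; first by rewrite ltnn.
    by move=> S' /(closed_walk_edge un) /memS; rewrite uS.
  exists S; split=> //; last (move: ht; set sm := \sum_(_ <- _) _; clear; lia).
  by move=> u /memS [i /edgeP [h1 _ _] <-]; rewrite mem_iota.
have lt : vars s1 xEdge < m by case: (_ < _) nz.
set j := vars s1 xEdge in hj memS szS ht lt.
have [un _ _] := edgeP lt; set u := tl j in un.
have W2 : 1 < 2 ^ w by lia.
have jW : j + 1 < 2 ^ w by lia.
have k1 : k.-1 < k by lia.
apply: wp_seq; apply: wp_assign => //=; rewrite -/j aE // sT -/u.
apply: wp_seq; apply: wp_if => //=.
  rewrite seen negbK => uS; apply: wp_skip; apply: wp_assign => //=; rewrite -/j.
  exists k.-1 => //; exists S; rewrite /= -/j addn1; split=> //; first by lia.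
    split=> //; last exact: leqW.
    move=> v; split=> [/memS [i il e]|[i il e]]; first by exists i => //; exact: ltnW.
    move: il; rewrite ltnS leq_eqVlt => /orP[/eqP ei|il]; last by apply/memS; exists i.
    by rewrite -e ei.
  by move: ht; set sm := \sum_(_ <- _) _; clear; lia.
move=> /eqP; rewrite seen => uS.
apply: wp_seq; apply: wp_put => //=.
set s2 := set_arr _ _ _ _.
have adj1 : adjacency w V out s1.
  by apply: adjacency_ext adj => a i h; rewrite aE // !inE; move: h; rewrite !inE => ->; rewrite !orbT.
apply: wp_frame.
  apply: (@vertex_estimate_spec s2 u) => //=.
  - by split=> // j' j'c; rewrite /= aE // hS.
  - by move=> v vV; apply: fresh.
  - by have := res u; rewrite (negbTE uS).
move=> t3 s3 [fv3 fa3] [D [hD hout hh3 C3 tle3]].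
have ej : vars s3 xEdge = j by rewrite fv3.
apply: wp_assign => //=; first by rewrite ej; split; lia.
exists k.-1 => //; exists (u :: S); rewrite /= ej addn1; split=> //.
- by lia.
- rewrite uS US; split=> //=; move=> v; rewrite inE; split=> [/orP[/eqP ->|/memS [i il e]]|[i il e]].
  + by exists j.
  + by exists i => //; apply: ltnW.
  + move: il; rewrite ltnS leq_eqVlt => /orP[/eqP ei|il]; first by rewrite -e ei eqxx.
    by apply/orP; right; apply/memS; exists i.
- split=> //.
  + move=> j' jc v vV; have [<- <-] := hd1 j' jc v vV.
    have reg : 2 * j' * V + V + V <= 2 * cnt * V.
      by rewrite -!mulSnr leq_mul2r; apply/orP; right; lia.
    have reg2 : 2 * cnt * V <= (2 * cnt + u + 1) * V by rewrite leq_mul2r; apply/orP; right; lia.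
    by split; rewrite C3 //; left; lia.
  + move=> u' un'; rewrite inE negb_or => /andP[uu uS'] v vV.
    rewrite C3 /=; first exact: fresh.
    case: (ltngtP u' u) => h; last by rewrite h eqxx in uu.
      left; apply: (@leq_trans ((2 * cnt + u' + 1) * V + V)); first by lia.
      by rewrite -mulSnr leq_mul2r; apply/orP; right; lia.
    right; apply: (@leq_trans ((2 * cnt + u' + 1) * V)); last by lia.
    by rewrite -mulSnr leq_mul2r; apply/orP; right; lia.
- split=> v; rewrite inE.
    by rewrite negb_or fa3 //=; case: (eqVneq v u) => //= _; rewrite seen.
  rewrite hout /=; case: (eqVneq v u) => [->|ne] /=; first by exists D.
  exact: res.
- rewrite big_cons; move: ht tle3; set sm := \sum_(_ <- _) _; set vt := vertex_time u.
  by clear; lia.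
Qed.

End Estimates.

(** * Running time and success probability *)

Definition algorithm (c : nat) : cmd :=
  CSeq (init_consts c) (CSeq link_edges (CSeq draw_samples (CSeq sample_dists all_estimates))).

Section Run.
Variables (w n m M c r l : nat) (tl hd ln : nat -> nat) (d : nat -> nat -> nat).
Local Notation V := (2 * n).
Local Notation INF := (2 * (n * M) + 2).
Local Notation out := (doubled n tl hd ln m).
Local Notation b := (up_log 2 m).
Local Notation N := (2 * r * (c * l)).
Hypotheses (w0 : 0 < w) (n0 : 0 < n) (M0 : 0 < M).
Hypotheses (rn : n <= r * r) (rn' : r.-1 * r.-1 < n) (r0 : 0 < r).
Hypotheses (ln1 : n <= 2 ^ l) (ln2 : 2 ^ l < 2 * n).
Hypotheses (INFW : 8 * INF < 2 ^ w) (nW : n.+1 * n.+1 < 2 ^ w) (VW : 4 * V < 2 ^ w)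
  (cW : c < 2 ^ w) (NW' : 2 * n.+1 * (c * n) < 2 ^ w) (mW : 4 * m + 4 * n + 4 < 2 ^ w)
  (regW : (2 * N + n + 4) * V < 2 ^ w).
Hypothesis edgeP : forall i, i < m -> [/\ tl i < n, hd i < n & 0 < ln i <= M].
Hypothesis dP : is_dist INF out d.

Let edgeI i : i < m -> [/\ tl i < n, hd i < n & 0 < ln i <= INF].
Proof.
move=> /edgeP [h1 h2 /andP[h3 h4]]; split=> //; rewrite h3 /=.
have : M <= n * M by rewrite leq_pmull.
by lia.
Qed.

Lemma algorithm_spec s : vars s xN = n -> vars s xM = m -> vars s xMax = M ->
  (forall i, arrs s aTail i = tl i) -> (forall i, arrs s aHead i = hd i) ->
  (forall i, arrs s aWt i = ln i) -> (forall a i, 2 < a -> arrs s a i = 0) ->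
  N * b <= size (coins s) ->
  let smp := [seq tl y | y <- draws b N (coins s) & y < m] in
  wp w (algorithm c) s (fun t s' =>
    (forall u, u < n -> exists2 D, vertex_result n m INF tl hd ln u D &
       arrs s' aOut u = if D < INF then D else 0) /\
    exists S, [/\ uniq S, {subset S <= iota 0 n}, size S <= m, size smp <= N &
      N * b <= t <= 30 * (r + l + 1) + 80 * m.+1 + 50 * (N * b.+1).+1 +
        2000 * (N * (l.+3 * (2 * m).+1)).+1 + 30 * m.+1 +
        \sum_(u <- S) (vertex_time n m INF l.+2 tl hd ln d smp u + 20)]).
Proof.
move=> sN sM sMax sT sH sL sZ sc smp; rewrite /algorithm.
have V0 : 0 < V by lia.
apply: wp_seq; apply: (wp_coins (P := init_consts c)) => //.
  by apply: (init_spec w0 n0 sN sMax M0 _ nW _ cW NW'); lia.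
move=> t1 s1 [fv1 fa1] cs1 [r' [l' [[h1 h2 h3] [h4 h5] [eI eV eD] tle1]]].
(* [init_spec] only promises some rounded square root and logarithm; the two-sided bounds determine
   both uniquely. *)
have er : r' = r.
  case: (ltngtP r' r) => // h.
    have : r' * r' <= r.-1 * r.-1 by apply: leq_mul; lia.
    by lia.
  have : r * r <= r'.-1 * r'.-1 by apply: leq_mul; lia.
  by lia.
have el : l' = l.
  case: (ltngtP l' l) => // h.
    have : 2 ^ l'.+1 <= 2 ^ l by rewrite leq_exp2l.
    by rewrite expnS; lia.
  have : 2 ^ l.+1 <= 2 ^ l' by rewrite leq_exp2l.
  by rewrite expnS; lia.
subst r' l'; move=> {h1 h2 h3 h4 h5}.
have a1 a i : arrs s1 a i = arrs s a i by rewrite fa1.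
have eN1 : vars s1 xN = n by rewrite fv1.
have eM1 : vars s1 xM = m by rewrite fv1.
have ed i : i < m -> tl i < n /\ hd i < n by move=> /edgeP [].
apply: wp_seq; apply: (wp_coins (P := link_edges)) => //.
  apply: (link_edges_spec w0 n0 (tl := tl) (hd := hd) (ln := ln) eM1 eN1) => // i; by rewrite a1 ?sT ?sH ?sL ?sZ.
move=> t2 s2 [fv2 fa2] cs2 [adj2 tle2].
have aT2 i : arrs s2 aTail i = tl i by rewrite fa2 // a1.
have eM2 : vars s2 xM = m by rewrite fv2.
have eD2 : vars s2 xDraws = N by rewrite fv2.
have mW4 : 4 * m + 4 < 2 ^ w by lia.
have NW : N + 1 < 2 ^ w.
  apply: leq_ltn_trans regW; apply: (@leq_trans (2 * N + n + 4)); first by lia.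
  by rewrite leq_pmulr.
have c2 : coins s2 = coins s by rewrite cs2.
apply: wp_seq; apply: wp_frame.
  by apply: (draw_samples_spec w0 n0 eM2 eD2 aT2) => //; rewrite c2.
rewrite c2 -/smp => t3 s3 [fv3 fa3] [eC sN3 aS3 tle3].
have cs3 : consts n INF smp s3 by split=> //; rewrite fv3 //= fv2.
have regW' : (2 * size smp + n + 4) * V < 2 ^ w.
  by apply: leq_ltn_trans regW; rewrite leq_mul2r; apply/orP; right; lia.
have Vlg : 2 * V <= 2 ^ l.+2 by rewrite !expnS; lia.
have smpP x : x \in smp -> x < n.
  by case/mapP => y; rewrite mem_filter => /andP[ym _] ->; have [] := edgeP ym.
have INF0 : 0 < INF by lia.
have adj3 : adjacency w V out s3.
  by apply: adjacency_ext adj2 => a i; rewrite !inE => h;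
     repeat case/orP: h => [/eqP ->|h]; rewrite ?(eqP h) fa3.
have z3 a i : a \in [:: aOut; aC; aT; aSeen] -> arrs s3 a i = 0.
  by rewrite !inE => h; repeat case/orP: h => [/eqP ->|h]; rewrite ?(eqP h) fa3 //= fa2 //= a1 sZ.
have g3 : graph_ok w n m tl hd ln smp s3.
  split=> //; split=> [v vV|i hi]; first by rewrite z3.
  by rewrite !z3.
have aC3 i : arrs s3 aC i = 0 by rewrite z3.
apply: wp_seq; apply: wp_frame.
  exact: (sample_dists_spec w0 n0 INF0 INFW VW regW' Vlg mW4 edgeI dP smpP cs3 g3 aC3).
move=> t4 s4 [fv4 fa4] [h4 d4 C4 tle4].
have cs4 : consts n INF smp s4 by case: cs3 => ? ? ? ?; split; rewrite fv4.
have g4 : graph_ok w n m tl hd ln smp s4.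
  split=> // [|j jc]; last by rewrite fa4 // aS3.
  by apply: adjacency_ext adj3 => a i; rewrite !inE => h;
     repeat case/orP: h => [/eqP ->|h]; rewrite ?(eqP h) fa4.
have eM4 : vars s4 xM = m by rewrite fv4 //= fv3.
have aT4 i : arrs s4 aTail i = tl i by rewrite fa4 // fa3.
have o4 u : arrs s4 aOut u = 0 by rewrite fa4 // z3.
have e4 u : arrs s4 aSeen u = 0 by rewrite fa4 // z3.
apply: wp_frame.
  exact: (all_estimates_spec w0 n0 INF0 INFW VW regW' Vlg mW4 edgeI dP smpP cs4 g4 d4 eM4 aT4 C4 o4 e4).
move=> t5 s5 _ [res [S [S1 S2 S3 tle5]]]; split=> //; exists S; split=> //.
have : size smp * (l.+3 * (2 * m).+1) <= N * (l.+3 * (2 * m).+1) by rewrite leq_mul2r sN3 orbT.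
move: tle1 tle2 tle3 tle4 tle5; set sm := \sum_(_ <- _) _.
set x := size smp * _; set y := N * (l.+3 * _); set z := N * b.+1; set zb := N * b.
by clear; lia.
Qed.

End Run.

(** * Good samples: their probability and the resulting total time *)

Section Counting.
Variables (n m INF r l c : nat) (tl hd ln : nat -> nat) (d : nat -> nat -> nat).
Local Notation out := (doubled n tl hd ln m).
Local Notation b := (up_log 2 m).
Local Notation Q := (2 ^ b).
Local Notation L := (c * l).
Local Notation N := (2 * r * L).
Hypotheses (n1 : 1 < n) (c0 : 0 < c) (r0 : 0 < r).
Hypotheses (rn : n <= r * r) (ln1 : n <= 2 ^ l).
Hypothesis edgeP : forall i, i < m -> [/\ tl i < n, hd i < n & 0 < ln i].
Hypothesis mn : m <= n * n.
Hypothesis dP : is_dist INF out d.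

Definition samples (ys : seq nat) := [seq tl y | y <- ys & y < m].

Definition candidate u g R x := [&& x != u, d u x < INF & all (survives d u g x (d u x)) R].

(** A set of draws rather than of vertices: a vertex is weighted by its outdegree, so that halving
    the set halves the number of edges to be scanned. *)
Definition remaining u g R : {set 'I_Q} := [set y : 'I_Q | (y < m) && candidate u g R (tl y)].

Definition good_run u g (ys : seq nat) :=
  let R := pivots INF d u g (samples ys) in
  (r * #|remaining u g R| < Q) && (size R < L).

Definition good (ys : seq nat) :=
  [forall u : 'I_n, good_run u (radius INF d (samples ys) u) ys].

Definition beats u g (y x : 'I_Q) := survives d u g (tl y) (d u (tl y)) (tl x).

Lemma beats_asym u g x y : beats u g x y -> ~~ beats u g y x.
Proof. exact: survives_asym. Qed.

(** A draw y >= m is never in [remaining], so it leaves the greedy state unchanged. Rejected draws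
    are thus harmless misses, and no conditioning on acceptance is needed. *)
Lemma greedy_pivots u g (ys : seq 'I_Q) : foldl (greedy (beats u g)) (remaining u g [::], 0) ys =
  let R := pivots INF d u g (samples (map val ys)) in (remaining u g R, size R).
Proof.
elim/last_ind: ys => [//|ys y IH].
rewrite foldl_rcons IH /= /samples map_rcons filter_rcons.
set sm := [seq _ | _ <- _ & _] in IH *; set R := pivots _ _ _ _ sm.
rewrite /greedy /= inE; case: (ltnP y m) => ym //=.
rewrite map_rcons pivots_rcons -/sm -/R /pivot_step -/(candidate u g R (tl y)).
case: (boolP (candidate u g R (tl y))) => // cy; rewrite size_rcons; congr (_, _).
apply/setP => z; rewrite !inE /candidate all_rcons /beats.
by rewrite (andbC (survives _ _ _ _ _ _)) !andbA.
Qed.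

Lemma logn_gt0 : 0 < l.
Proof. by rewrite lt0n; apply/eqP => e; move: ln1; rewrite e; lia. Qed.

(** The least power of two that is at least m is below 2 m once m > 1; the summand 1 covers m = 0,
    where Q = 1. *)
Lemma draw_range : Q <= (2 * m).+1.
Proof.
have [m1|m1] := leqP m 1.
  by have /eqP -> : b == 0; rewrite ?up_log_eq0 ?m1 ?orbT // expn0.
have b0 : 0 < b by rewrite up_log_gt0.
by have := up_log_gtn (isT : 1 < 2) m1; rewrite -{2}(prednK b0) expnS; lia.
Qed.

Lemma draw_bits : b <= 2 * l.
Proof.
apply: up_log_min => //; apply: leq_trans mn _.
by rewrite mul2n -addnn expnD leq_mul.
Qed.

Lemma sum_out (P : pred nat) k : (forall i, i < k -> tl i < n /\ hd i < n) ->
  \sum_(x <- iota 0 n | P x) size (doubled n tl hd ln k x) = \sum_(y < k | P (tl y)) 1.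
Proof.
rewrite big_mkcond [RHS]big_mkcond /=; elim: k => [|k IH] hk.
  by rewrite big_ord0 big1 // => x _; case: ifP.
rewrite big_ord_recr /= -IH; last by move=> i ik; apply: hk; lia.
have [tk _] := hk k (ltnSn k).
have -> : (if P (tl k) then 1 else 0) = \sum_(x <- iota 0 n) (if P x then (tl k == x : nat) else 0).
  rewrite (bigD1_seq (tl k)) ?iota_uniq ?mem_iota //= eqxx big1 ?addn0 // => x.
  by rewrite eq_sym => /negbTE ->; case: ifP.
rewrite -big_split; apply: eq_big_seq => x; rewrite mem_iota /= add0n => xn.
case: ifP => // _; rewrite !size_cat.
have -> : n + hd k == x = false by apply/eqP; lia.
by rewrite addnC add0n; case: (tl k == x).
Qed.

Lemma scan_remaining u g R :
  scan_size n m INF tl hd ln d u g R <= size (out u) + #|remaining u g R|.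
Proof.
rewrite /scan_size leq_add2l sum_out; last by move=> i /edgeP [].
have mQ : m <= Q by apply: up_logP.
have -> : \sum_(y < m | candidate u g R (tl y)) 1 =
    \sum_(y < Q | candidate u g R (tl y) && (y < m)) 1.
  exact: (big_ord_widen_cond Q (fun y => candidate u g R (tl y)) (fun=> 1) mQ).
rewrite -sum1_card.
rewrite big_mkcond [leqRHS]big_mkcond leq_sum // => y _.
by rewrite inE andbC.
Qed.

(** The union of two bad events, too many remaining draws and too many pivots, of weights Q and Q +
    1. The number of draws is 2 s c for s = r and c = L, as [greedy_large] wants. *)
Lemma bad_runs u g :
  2 ^ L * sumseq N (fun ys : seq 'I_Q => ~~ good_run u g (map val ys) : nat) <= Q ^ N * (2 * Q).+1.
Proof.
have Q0 : 0 < #|'I_Q| by rewrite card_ord expn_gt0.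
have h1 := greedy_large (@beats_asym u g) (remaining u g [::]) L r0 Q0.
have h2 := greedy_count (@beats_asym u g) (remaining u g [::]) N L.
rewrite card_ord in h1 h2.
set f1 := sumseq _ _ in h1; set f2 := sumseq _ _ in h2.
apply: (@leq_trans (2 ^ L * (f1 + f2))).
  rewrite leq_mul2l; apply/orP; right; rewrite /f1 /f2 -sumseqD; apply: leq_sumseq => ys.
  rewrite greedy_pivots /= /good_run negb_and -!leqNgt.
  by case: (_ <= r * _); case: (_ <= size _).
by rewrite mulnDr; apply: leq_trans (leq_add h1 h2) _; rewrite -mulnDr leq_mul2l; apply/orP; right; lia.
Qed.

(* The radius depends on the samples, but takes at most n + 1 values, and the union
   bound ranges over all of them. *)
Definition guess u (pt : option 'I_n) :=
  ((if pt is Some x then d x u + d u x else INF) - 1) %/ 2.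

Lemma radius_guess u ys : exists pt, radius INF d (samples ys) u = guess u pt.
Proof.
rewrite /radius; case: (rt_min_attained INF d u (samples ys)) => [->|[x [xs _ ->]]].
  by exists None.
have xn : x < n by case/mapP: xs => y; rewrite mem_filter => /andP[/edgeP[h _ _] _] ->.
by exists (Some (Ordinal xn)).
Qed.

Lemma bad_total :
  2 ^ L * sumseq N (fun ys : seq 'I_Q => ~~ good (map val ys) : nat) <=
  n * n.+1 * (Q ^ N * (2 * Q).+1).
Proof.
apply: (@leq_trans (2 ^ L * \sum_(u : 'I_n) \sum_(pt : option 'I_n)
    sumseq N (fun ys : seq 'I_Q => ~~ good_run u (guess u pt) (map val ys) : nat))).
  rewrite leq_mul2l; apply/orP; right.
  under [leqRHS]eq_bigr do rewrite -sumseq_sum.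
  rewrite -sumseq_sum; apply: leq_sumseq => ys.
  case: (boolP (good _)) => // /forallPn[u bad].
  have [pt ept] := radius_guess u (map val ys); rewrite ept in bad.
  by rewrite (bigD1 u) //= (bigD1 pt) //= bad; lia.
rewrite big_distrr /=.
apply: (@leq_trans (\sum_(u : 'I_n) n.+1 * (Q ^ N * (2 * Q).+1))); last first.
  by rewrite sum_nat_const card_ord mulnA.
apply: leq_sum => u _; rewrite big_distrr /=.
apply: (@leq_trans (\sum_(pt : option 'I_n) (Q ^ N * (2 * Q).+1))); last first.
  by rewrite sum_nat_const card_option card_ord.
by apply: leq_sum => pt _; apply: bad_runs.
Qed.

(** Origin of the 8: the union bound costs n (n + 1) (2 Q + 1) <= 16 n ^ 4, and n ^ 8 pays for it
    because n >= 2. The remaining n ^ d0 of 2 ^ L >= n ^ c is the claimed success rate. *)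
Lemma bad_fraction d0 : c = d0 + 8 ->
  n ^ d0 * sumseq N (fun ys : seq 'I_Q => ~~ good (map val ys) : nat) <= Q ^ N.
Proof.
move=> ec; have := bad_total; set bad := sumseq _ _ => tot.
have p1 : n ^ d0 * (16 * n ^ 4) <= 2 ^ L.
  rewrite mulnC [2 ^ _]expnM; apply: (@leq_trans (n ^ c)).
    rewrite ec expnD mulnC leq_mul2l; apply/orP; right.
    rewrite -[8]/(4 + 4) expnD leq_mul2r; apply/orP; right.
    by rewrite -[16]/(2 ^ 4) leq_exp2r.
  by rewrite -expnM mulnC expnM leq_exp2r.
have p2 : n * n.+1 * (Q ^ N * (2 * Q).+1) <= 16 * n ^ 4 * Q ^ N.
  have q1 := draw_range.
  have q2 : (2 * Q).+1 <= 8 * (n * n) by move: q1 mn n1; clear; nia.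
  have q3 : n.+1 <= 2 * n by lia.
  rewrite mulnCA mulnC leq_mul2r; apply/orP; right.
  apply: (@leq_trans (n * (2 * n) * (8 * (n * n)))).
    by apply: leq_mul => //; rewrite leq_mul2l q3 orbT.
  by rewrite !expnS expn0; clear; lia.
have n4 : 0 < 16 * n ^ 4 by rewrite muln_gt0 expn_gt0; lia.
rewrite -(leq_pmul2l n4); apply: leq_trans p2; apply: leq_trans tot.
by rewrite mulnA (mulnC _ (n ^ d0)) leq_mul2r p1 orbT.
Qed.

Lemma sum_degrees S : uniq S -> {subset S <= iota 0 n} ->
  \sum_(u <- S) size (out u) + \sum_(u <- S) size (out (n + u)) <= 2 * m.
Proof.
move=> US Sn.
rewrite -(size_doubled (tl := tl) (hd := hd) ln (n := n) (k := m)); last by move=> i /edgeP [].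
have -> : iota 0 (2 * n) = iota 0 n ++ iota (0 + n) n by rewrite -iotaD mul2n addnn.
rewrite big_cat /= add0n; apply: leq_add.
  by apply: (uniq_sub_le_big leqnn (fun x y => leq_addr y x)) => //; exact: iota_uniq.
have -> : iota n n = map (addn n) (iota 0 n) by rewrite -iotaDl addn0.
rewrite big_map.
by apply: (uniq_sub_le_big leqnn (fun x y => leq_addr y x)) => //; exact: iota_uniq.
Qed.

(** Only as many coins are supplied as there are steps in the time bound, so the coins needed for
    the draws must fit in it. *)
Lemma draws_time : N * b <= 2000 * 50 * (c * c) * (m.+1 * r * (l * l)).
Proof.
apply: (@leq_trans (4 * (c * (r * (l * l))))).
  by apply: (@leq_trans (N * (2 * l))); [rewrite leq_mul2l draw_bits orbT|lia].
rewrite -(mulnA (2000 * 50)); apply: leq_mul => //.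
apply: leq_mul; first by rewrite leq_pmulr.
by rewrite -mulnA leq_pmull.
Qed.

Lemma total_time ys S : good ys -> size (samples ys) <= N -> uniq S -> {subset S <= iota 0 n} ->
  size S <= m ->
  30 * (r + l + 1) + 80 * m.+1 + 50 * (N * b.+1).+1 + 2000 * (N * (l.+3 * (2 * m).+1)).+1 +
  30 * m.+1 + \sum_(u <- S) (vertex_time n m INF l.+2 tl hd ln d (samples ys) u + 20) <=
  2000 * 50 * (c * c) * (m.+1 * r * (l * l)).
Proof.
move=> gd sN US Sn Sm; have lp := logn_gt0; have bl := draw_bits.
set smp := samples ys in sN *.
pose B u := #|remaining u (radius INF d smp u) (vertex_pivots INF d smp u)|.
have uS u : u \in S -> r * B u < Q /\ size (vertex_pivots INF d smp u) < L.
  move=> /Sn; rewrite mem_iota /= add0n => un; apply/andP.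
  exact: (forallP gd (Ordinal un)).
have vt u : u \in S -> vertex_time n m INF l.+2 tl hd ln d smp u + 20 <=
   (2000 * (L * N.+1 + l.+3 * L + 1) + 20) + 2000 * (l.+3 * L * (size (out u) + B u) + size (out (n + u))).
  move=> /uS [_ KL]; rewrite /vertex_time; set K := (size _).+1.
  have sc := scan_remaining u (radius INF d smp u) (vertex_pivots INF d smp u).
  set scn := scan_size _ _ _ _ _ _ _ _ _ _ in sc *; rewrite -/(B u) in sc.
  have e1 : K * (size smp).+1 <= L * N.+1 by apply: leq_mul.
  have e2 : l.+3 * K * scn.+1 <= l.+3 * L * (size (out u) + B u).+1.
    by apply: leq_mul => //; rewrite leq_mul2l KL orbT.
  by rewrite mulnS in e2; move: e1 e2; clear; lia.
(* This is where sqrt n enters: each of at most n searches scans fewer than Q / r <= 2 m / r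
   remaining edges, rounding aside, and n <= r * r turns n * 2 m / r into 2 m r. *)
have sumB : \sum_(u <- S) B u <= 2 * m * r.
  have h : r * (\sum_(u <- S) B u) <= n * (2 * m).
    rewrite big_distrr /= -[n in n * _](size_iota 0 n).
    apply: (@leq_trans (size S * (2 * m))).
      rewrite mulnC -iter_addn_0 -(count_predT S) -big_const_seq big_seq [leqRHS]big_seq.
      by apply: leq_sum => u /uS [h _]; have := draw_range; lia.
    by rewrite leq_mul2r; apply/orP; right; apply: uniq_leq_size.
  rewrite -(leq_pmul2l r0); apply: leq_trans h _.
  by rewrite [leqRHS]mulnCA [leqRHS]mulnC leq_mul2r rn orbT.
have dg := sum_degrees US Sn.
set D1 := \sum_(u <- S) size (out u) in dg; set D2 := \sum_(u <- S) size (out (n + u)) in dg.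
have sumV : \sum_(u <- S) (vertex_time n m INF l.+2 tl hd ln d smp u + 20) <=
   m * (2000 * (L * N.+1 + l.+3 * L + 1) + 20) + 2000 * (l.+3 * L * (2 * m + 2 * m * r) + 2 * m).
  rewrite big_seq.
  apply: (@leq_trans (\sum_(u <- S) ((2000 * (L * N.+1 + l.+3 * L + 1) + 20) +
      2000 * (l.+3 * L * (size (out u) + B u) + size (out (n + u)))))).
    by rewrite [leqRHS]big_seq; apply: leq_sum.
  rewrite big_split /= big_const_seq count_predT iter_addn_0 mulnC; apply: leq_add.
    by rewrite leq_mul2r Sm orbT.
  rewrite -big_distrr /= leq_mul2l /= big_split /= -big_distrr /= big_split /= -/D1 -/D2.
  move: sumB dg; set SB := \sum_(u <- S) B u; clearbody D1 D2 SB => sumB dg.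
  apply: leq_add; last by move: dg; clear; lia.
  by rewrite leq_mul2l; apply/orP; right; move: dg sumB; clear; lia.
apply: leq_trans (leq_add (leqnn _) sumV) _.
set X := m.+1 * r * (l * l).
have X1 : m.+1 * r <= X by rewrite leq_pmulr // muln_gt0 lp.
have X2 : r <= X by apply: leq_trans X1; rewrite leq_pmull.
have X3 : m.+1 <= X by apply: leq_trans X1; rewrite leq_pmulr.
have X4 : l <= X by rewrite /X mulnA leq_pmull // !muln_gt0 r0 lp.
have cX e f : e <= c -> f <= X -> e * f <= c * X by exact: leq_mul.
have ccX : c * X <= c * c * X by rewrite leq_mul2r leq_pmulr ?orbT.
have X0 : X <= c * X by rewrite leq_pmull.
have LX : L <= c * X by rewrite leq_mul2l X4 orbT.
have rll : r * (l * l) <= X by rewrite /X -mulnA leq_pmull.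
have NX : N * b.+1 <= 6 * (c * X).
  apply: (@leq_trans (N * (3 * l))); first by rewrite leq_mul2l; apply/orP; right; lia.
  have -> : N * (3 * l) = 6 * (c * (r * (l * l))) by clear; lia.
  by rewrite !leq_mul2l rll !orbT.
have NX2 : N * (l.+3 * (2 * m).+1) <= 16 * (c * X).
  apply: (@leq_trans (N * (4 * l * (2 * m.+1)))).
    by rewrite leq_mul2l; apply/orP; right; apply: leq_mul; lia.
  by have -> : N * (4 * l * (2 * m.+1)) = 16 * (c * X) by rewrite /X; clear; lia.
have LN : m * (L * N) <= 2 * (c * c * X).
  have -> : m * (L * N) = 2 * (c * c * (m * r * (l * l))) by clear; lia.
  by rewrite !leq_mul2l /X -!mulnA leq_mul2r leqnSn !orbT.
have mL : m * L <= c * X.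
  rewrite mulnCA leq_mul2l; apply/orP; right; rewrite /X -mulnA; apply: leq_mul => //.
  by rewrite mulnA leq_pmull // muln_gt0 r0 lp.
have lL : m * r * (l.+3 * L) <= 4 * (c * X).
  apply: (@leq_trans (m.+1 * r * (4 * l * L))).
    by apply: leq_mul; [rewrite leq_mul2r leqnSn orbT|rewrite leq_mul2r; apply/orP; right; lia].
  by have -> : m.+1 * r * (4 * l * L) = 4 * (c * X) by rewrite /X; clear; lia.
have lL2 : m * (l.+3 * L) <= 4 * (c * X).
  by apply: leq_trans lL; rewrite leq_mul2r leq_pmulr ?orbT.
move: NX NX2 LN mL lL lL2 LX X0 X1 X2 X3 X4 ccX.
have -> : m * (2000 * (L * N.+1 + l.+3 * L + 1) + 20) =
   2000 * (m * (L * N) + m * L + m * (l.+3 * L) + m) + 20 * m by clear; lia.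
have -> : l.+3 * L * (2 * m + 2 * m * r) = 2 * (m * (l.+3 * L)) + 2 * (m * r * (l.+3 * L)) by clear; lia.
rewrite -(mulnA (2000 * 50)).
clear.
set a1 := N * b.+1; set a2 := N * (_ * _); set a3 := m * (L * N); set a4 := m * L.
set a5 := m * r * _; set a6 := m * (_ * L); set cx := c * X; set ccx := c * c * X.
lia.
Qed.

End Counting.

(** [find] returns the length INF of the list when no walk is shorter, which is the truncation that
    [is_dist] asks for. *)
Definition dist INF out u v := find (fun a => `[< walk out u v a >]) (iota 0 INF).

Lemma distP INF out : is_dist INF out (dist INF out).
Proof.
move=> u v; rewrite /dist; set p := fun a => _.
have le : find p (iota 0 INF) <= INF by rewrite -[leqRHS](size_iota 0) find_size.
split=> // [lt|a wa].
  have := nth_find 0 (a := p) (s := iota 0 INF); rewrite has_find size_iota => /(_ lt).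
  by rewrite nth_iota // => /asboolP.
case: (leqP INF a) => [|aI]; first exact: leq_trans.
rewrite leqNgt; apply/negP => /(before_find 0); rewrite nth_iota // add0n.
by move/asboolP.
Qed.

Section Probability.
Local Open Scope ring_scope.

Lemma coin_prob_ge (R : realType) (T n d : nat) (E : T.-tuple bool -> Prop)
    (good : pred (seq bool)) : (0 < n)%N ->
  (forall r : T.-tuple bool, good r -> E r) ->
  (n ^ d * sumseq T (fun r => ~~ good r : nat) <= 2 ^ T)%N ->
  1 - (n%:R ^+ d)^-1 <= coin_prob R E.
Proof.
move=> n0 goodE bad; rewrite /coin_prob.
have count : (2 ^ T <= #|[set r : T.-tuple bool | `[< E r >]]| + sumseq T (fun r => ~~ good r : nat))%N.
  rewrite -sumseq_tuple -[leqLHS]muln1 -card_bool -card_tuple -sum_nat_const -sum1_card.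
  rewrite [X in (_ <= X + _)%N]big_mkcond -big_split /= leq_sum // => r _.
  by rewrite inE; case: (boolP (good r)) => [/goodE /asboolP ->|] //=; rewrite addnC.
have T0 : 0 < 2 ^+ T :> R by rewrite exprn_gt0.
have nd0 : 0 < n%:R ^+ d :> R by rewrite exprn_gt0 // ltr0n.
rewrite ler_pdivlMr // mulrBl mul1r lerBlDr.
set A := #|_| in count *; set B := sumseq _ _ in bad count.
have bad' : B%:R <= (n%:R ^+ d)^-1 * 2 ^+ T :> R.
  by rewrite mulrC ler_pdivlMr // mulrC -natrX -natrM -natrX ler_nat.
apply: le_trans (lerD (lexx _) bad').
by rewrite -natrX -natrD ler_nat.
Qed.

End Probability.

(** * Comparison with the real-valued time bound *)

Section Time.
Local Open Scope ring_scope.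
Variable R : realType.

(** From exp(-1/2) >= 1 - 1/2, which says that exp(1/2) <= 2. *)
Lemma ln2_ge : 1 / 2 <= ln 2 :> R.
Proof.
have h : 2^-1 <= expR (- (1 / 2)) :> R by apply: le_trans (expR_ge1Dx _); lra.
rewrite -ler_expR lnK; last by rewrite posrE.
rewrite -[leLHS]invrK -expRN -[leRHS]invrK lef_pV2 ?posrE ?expR_gt0 ?invr_gt0 //.
Qed.

(** The 64 is 2 * 16 * 2, from r <= 2 sqrt n, l <= 4 ln (n + 1) taken twice, and 1 <= 2 ln (M +
    1). *)
Lemma time_bound_ge (c n m M r l : nat) : (1 < n)%N -> (0 < M)%N -> (0 < r)%N ->
  (r.-1 * r.-1 < n)%N -> (2 ^ l < 2 * n)%N -> (0 < l)%N ->
  (c * (m.+1 * r * (l * l)) <= time_bound R (64 * c) 2 n m M)%N.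
Proof.
move=> n1 M0 r0 rn ln2n l0; rewrite /time_bound.
have n0 : (0 < n)%N by apply: leq_trans n1.
have h2 := ln2_ge.
have lnM : 1 / 2 <= ln M.+1%:R :> R.
  by apply: le_trans h2 _; rewrite ler_ln ?posrE ?ltr0n // ler_nat.
have lnn : 1 / 2 <= ln n.+1%:R :> R.
  by apply: le_trans h2 _; rewrite ler_ln ?posrE ?ltr0n // ler_nat ltnS ltnW.
have sn : 1 <= Num.sqrt n%:R :> R by rewrite -[leLHS]sqrtr1 ler_sqrt ?ler1n ?ler0n.
have hr : r%:R <= 2 * Num.sqrt n%:R :> R.
  have : r.-1%:R <= Num.sqrt n%:R :> R.
    rewrite -[leLHS]ger0_norm ?ler0n // -sqrtr_sqr ler_sqrt ?ler0n // -natrX ler_nat.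
    by rewrite -mulnn ltnW.
  by rewrite -[in r%:R](prednK r0) -natr1; lra.
have hl : l%:R <= 4 * ln n.+1%:R :> R.
  have e : (l.-1)%:R * ln 2 <= ln n.+1%:R :> R.
    rewrite mulr_natl -lnXn // ler_ln ?posrE ?exprn_gt0 ?ltr0n // -natrX ler_nat.
    by move: ln2n; rewrite -{1}(prednK l0) expnS ltn_pmul2l //; lia.
  have : (l.-1)%:R * (1 / 2) <= (l.-1)%:R * ln 2 :> R by rewrite ler_wpM2l ?ler0n.
  by rewrite -[in l%:R](prednK l0) -(natr1 l.-1); lra.
set a := ln n.+1%:R in lnn hl *; set b := ln M.+1%:R in lnM *; set s := Num.sqrt _ in sn hr *.
rewrite truncn_ge_nat; last by rewrite !mulr_ge0 ?exprn_ge0 ?ler0n //; lra.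
rewrite !natrM.
have ll : l%:R * l%:R <= 16 * a ^+ 2.
  have -> : 16 * a ^+ 2 = (4 * a) * (4 * a) by rewrite expr2; lra.
  by rewrite ler_pM ?ler0n.
have rl : r%:R * (l%:R * l%:R) <= 2 * s * (16 * a ^+ 2).
  by rewrite ler_pM // ?mulr_ge0 ?ler0n.
have rl2 : r%:R * (l%:R * l%:R) <= 64 * s * b * a ^+ 2.
  apply: le_trans rl _; have : 0 <= s * a ^+ 2 * (2 * b - 1).
    by rewrite !mulr_ge0 ?exprn_ge0 //; lra.
  by lra.
have : c%:R * m.+1%:R * (r%:R * (l%:R * l%:R)) <= c%:R * m.+1%:R * (64 * s * b * a ^+ 2).
  by rewrite ler_wpM2l // mulr_ge0 ?ler0n.
lra.
Qed.

End Time.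

Section Estimate.
Local Open Scope ring_scope.

Lemma estimate_correct (R : realType) (eps : R) n (e : rel 'I_n)
    (wt : 'I_n -> 'I_n -> nat) es M s (v : 'I_n) D
    (INF := (2 * (n * M) + 2)%N) :
  0 < eps -> edge_listing e es -> (forall u v, e u v -> (1 <= wt u v <= M)%N) ->
  vertex_result n (size es) INF (tail_of es) (head_of es) (weight_of wt es) v D ->
  arrs s 3 v = (if (D < INF)%N then D else 0%N) ->
  (SC R e wt v <= estimate R s v)%E /\
  (estimate R s v <= (2 + eps)%:E * SC R e wt v)%E.
Proof.
move=> eps0 esP wtP [Dsound Dapprox] out; rewrite /estimate out.
have cyc p : cycles_through e v p -> (D <= 2 * cycle_weight wt p)%N /\ (2 * cycle_weight wt p < INF)%N.
  move=> [cp vp]; have small : (2 * cycle_weight wt p < INF)%N.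
    have : (cycle_weight wt p <= n * M)%N.
      by apply: cycle_weight_bound cp => a b /wtP /andP[].
    by rewrite /INF; lia.
  split=> //; apply: Dapprox => //.
  have [u [a [l [un wv vu aS]]]] := cycle_walk wt esP cp vp.
  by exists u, a, l.
case: ltnP => DI.
  have [u [a [l [un wv vu aS]]]] := Dsound DI.
  (* Weights are positive, so a finite result is never mistaken for the code 0 of infinity. *)
  have D0 : D != 0%N.
    move/mem_doubled: (vu) => [i [im [_ el]]].
    have [x [y [xy _ _ ew]]] := edge_index wt esP im.
    by have := wtP _ _ xy; rewrite -ew -el; lia.
  rewrite (negbTE D0).
  have half : ((D%:R / 2)%:E <= SC R e wt v)%E.
    apply/ereal_infP => _ [p pv <-]; rewrite lee_fin ler_pdivrMr // -natrM ler_nat mulnC.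
    by have [] := cyc p pv.
  split.
    have [p [cp vp le]] : exists p, [/\ ucycle e p, v \in p & (cycle_weight wt p <= a + l)%N].
      exact: (walk_cycle esP (v := Ordinal un) wv vu).
    apply: (@le_trans _ _ (cycle_weight wt p)%:R%:E); last by rewrite lee_fin ler_nat -aS.
    by apply: ereal_inf_lbound; exists p.
  have -> : (D%:R%:E = 2%:E * (D%:R / 2)%:E :> \bar R)%E.
    by rewrite -EFinM mulrC divfK.
  apply: lee_pmul => //; rewrite lee_fin ?divr_ge0 //.
  by rewrite lerDl ltW.
(* A cycle through v would have weight at most n M and force the result below INF. *)
rewrite eqxx; have -> : SC R e wt v = +oo%E.
  apply/ereal_inf_pinfty => _ [p pv <-]; have [h1 h2] := cyc p pv.
  by have := leq_trans DI h1; rewrite leqNgt h2.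
by rewrite gt0_muley ?leey // lte_fin addr_gt0.
Qed.

End Estimate.

(** With B a power of two above n M, the word range is B ^ 4 * B ^ (K - 2). Every quantity is a
    polynomial in n and n M bounded by B ^ 4 up to a factor linear in c, the largest being the
    addresses of order c n ^ 3; B ^ (K - 2) > K - 2 absorbs that factor. *)
Lemma word_size_fits c K n M N : 8 * c + 120 <= K -> 0 < n -> 0 < M ->
  N <= 2 * n * (c * n) -> forall m, m <= n * n ->
  let w := word_size K n M in
  [/\ 0 < w, 8 * (2 * (n * M) + 2) < 2 ^ w, n.+1 * n.+1 < 2 ^ w, 4 * (2 * n) < 2 ^ w & 
   [/\ c < 2 ^ w, 2 * n.+1 * (c * n) < 2 ^ w, 4 * m + 4 * n + 4 < 2 ^ w &
       (2 * N + n + 4) * (2 * n) < 2 ^ w]].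
Proof.
move=> cK n0 M0 NB m mn w.
pose B := 2 ^ (trunc_log 2 (n * M)).+1.
have nM0 : 0 < n * M by rewrite muln_gt0 n0.
have nMB : n * M < B by apply: trunc_log_ltn.
have B2 : 2 <= B by rewrite /B expnS leq_pmulr // expn_gt0.
have wE : 2 ^ w = B ^ 4 * B ^ (K - 2).
  by rewrite -expnD /B -expnM /w /word_size mulnC; congr (2 ^ (_ * _)); lia.
have nB : n < B by apply: leq_ltn_trans nMB; rewrite leq_pmulr.
have BK : 8 * c + 119 <= B ^ (K - 2).
  apply: (@leq_trans (2 ^ (K - 2))); last by rewrite leq_exp2r //; lia.
  by apply: leq_trans (_ : K - 2 < _); [lia|apply: ltn_expl].
have B4 : B <= B ^ 4 by rewrite -{1}(expn1 B) leq_pexp2l //; lia.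
have n2 : n * n <= B ^ 4.
  apply: (@leq_trans (B ^ 2)); first by rewrite -mulnn leq_mul // ltnW.
  by rewrite leq_pexp2l //; lia.
have n3 : n * (n * n) <= B ^ 4.
  apply: (@leq_trans (B ^ 3)); last by rewrite leq_pexp2l //; lia.
  by rewrite -[3]/(1 + 2) expnD expn1 -mulnn !leq_mul // ltnW.
have WB : (8 * c + 119) * B ^ 4 <= 2 ^ w by rewrite wE mulnC leq_mul2l BK orbT.
have c3 : c * (n * (n * n)) <= c * B ^ 4 by rewrite leq_mul2l n3 orbT.
have c2 : c * (n * n) <= c * B ^ 4 by rewrite leq_mul2l n2 orbT.
have c1 : c * n <= c * B ^ 4 by rewrite leq_mul2l orbC (leq_trans (ltnW nB)).
have c0 : c <= c * B ^ 4 by rewrite leq_pmulr //; lia.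
have Nn : N * n <= 2 * (c * (n * (n * n))).
  by apply: (@leq_trans (2 * n * (c * n) * n)); [rewrite leq_mul2r NB orbT|lia].
rewrite mulnDl in WB; move: (B ^ 4) (2 ^ w) B4 n2 n3 WB c3 c2 c1 c0 => P W B4 n2 n3 WB c3 c2 c1 c0.
have e1 : n.+1 * n.+1 = n * n + 2 * n + 1 by lia.
have e2 : 2 * n.+1 * (c * n) = 2 * (c * (n * n)) + 2 * (c * n) by lia.
have e3 : (2 * N + n + 4) * (2 * n) = 4 * (N * n) + 2 * (n * n) + 8 * n by lia.
rewrite e1 e2 e3.
move: nMB B2 nB B4 n2 n3 WB c3 c2 c1 c0 Nn mn.
set q1 := n * M; set q2 := n * n; set q3 := n * q2; set q4 := N * n; set q5 := c * P.
set q6 := c * q3; set q7 := c * q2; set q8 := c * n.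
clear; move=> *; split; [by rewrite /w /word_size muln_gt0|lia|lia|lia|split; lia].
Qed.

Local Open Scope ring_scope.

Theorem theorem19 (R : realType) (eps : R) (heps : 0 < eps) (d : nat) :
  exists (P : cmd) (K C k : nat),
    forall (n M : nat) (e : rel 'I_n) (wt : 'I_n -> 'I_n -> nat)
           (es : seq ('I_n * 'I_n)),
      (0 < n)%N -> (0 < M)%N ->
      (forall u v, e u v -> (1 <= wt u v <= M)%N) ->
      edge_listing e es ->
      let T := time_bound R C k n (size es) M in
      1 - (n%:R ^+ d)^-1 <=
      coin_prob R (fun r : T.-tuple bool =>
        exists (t : nat) (s : state),
          [/\ exec (word_size K n M) P (input_state wt M es r) t s,
              (t <= T)%N &
              forall v : 'I_n,
                (SC R e wt v <= estimate R s v)%E /\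
                (estimate R s v <= (2 + eps)%:E * SC R e wt v)%E]).
Proof.
pose c := (d + 8)%N.
(* The second witness is the word factor of [word_size_fits]; the third multiplies the constant of
   [total_time] by the 64 of [time_bound_ge]; the exponent 2 comes from l * l. *)
exists (algorithm c), (8 * c + 120)%N, (64 * (2000 * 50 * (c * c)))%N, 2%N.
move=> n M e wt es n0 M0 wtP esP /=.
set m := size es; set T := time_bound _ _ _ _ _ _.
(* For n = 1 the required probability is 0. *)
have [n1|n1] := leqP n 1.
  have -> : n%:R ^+ d = 1 :> R by rewrite (_ : n = 1%N) ?expr1n //; lia.
  by rewrite invr1 subrr /coin_prob divr_ge0 ?exprn_ge0 ?ler0n.
have mn : (m <= n * n)%N.
  rewrite -[n in (n * _)%N]card_ord -[n in (_ * n)%N]card_ord -card_prod.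
  by rewrite /m -(card_uniqP esP.1) max_card.
have exr : exists r, (n <= r * r)%N by exists n; rewrite leq_pmulr.
pose r := ex_minn exr.
have rn : (n <= r * r)%N by rewrite /r; case: ex_minnP.
have rmin q : (n <= q * q)%N -> (r <= q)%N by rewrite /r; case: ex_minnP => q' _; apply.
have r_gt0 : (0 < r)%N by rewrite lt0n; apply/eqP => er; move: rn; rewrite er; lia.
have rn' : (r.-1 * r.-1 < n)%N by rewrite ltnNge; apply/negP => /rmin; lia.
have r_le : (r <= n)%N by apply: rmin; rewrite leq_pmulr.
pose l := up_log 2 n.
have ln1 : (n <= 2 ^ l)%N by apply: up_logP.
have l0 : (0 < l)%N by rewrite up_log_gt0.
have ln2' : (2 ^ l < 2 * n)%N.
  by have := up_log_gtn (isT : 1 < 2)%N n1; rewrite -/l -{2}(prednK l0) expnS ltn_pmul2l.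
have l_le : (l <= n)%N by apply: up_log_min => //; apply/ltnW/ltn_expl.
pose N := (2 * r * (c * l))%N.
have NB : (N <= 2 * n * (c * n))%N.
  by rewrite /N; apply: leq_mul; rewrite leq_mul2l ?r_le ?l_le orbT.
have [w0 W1 W2 W3 [W4 W5 W6 W7]] := word_size_fits (leqnn _) n0 M0 NB mn.
set w := word_size _ n M in w0 W1 W2 W3 W4 W5 W6 W7 *.
pose tl := tail_of es; pose hd := head_of es; pose ln := weight_of wt es.
pose INF := (2 * (n * M) + 2)%N.
have edgeP i : (i < m)%N -> [/\ (tl i < n)%N, (hd i < n)%N & (0 < ln i <= M)%N].
  move=> /(edge_index wt esP) [u [v [uv e1 e2 e3]]].
  by rewrite /tl /hd /ln e1 e2 e3 !ltn_ord; split=> //; apply: wtP.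
have edgeP' i : (i < m)%N -> [/\ (tl i < n)%N, (hd i < n)%N & (0 < ln i)%N].
  by move=> /edgeP [h1 h2 /andP[h3 _]].
pose out := doubled n tl hd ln m.
have dP := distP INF out; set dd := dist INF out in dP.
pose b := up_log 2 m.
have c_gt0 : (0 < c)%N by rewrite /c addnS.
pose gd ys := good n m INF r l c tl dd ys.
have TB : (2000 * 50 * (c * c) * (m.+1 * r * (l * l)) <= T)%N by apply: time_bound_ge.
have run (cs : seq bool) : (N * b <= size cs)%N -> gd (draws b N cs) ->
    exists t s, [/\ exec w (algorithm c) (input_state wt M es cs) t s, (N * b <= t <= T)%N &
      forall v : 'I_n, (SC R e wt v <= estimate R s v)%E /\
                (estimate R s v <= (2 + eps)%:E * SC R e wt v)%E].
  move=> csN gcs; pose s0 := input_state wt M es cs.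
  have sZ a i : (2 < a)%N -> arrs s0 a i = 0%N.
    by case: a => [|[|[|a]]] // _; rewrite /s0 /= nth_nil nth_nil.
  have [t [s [ex [res [S [S1 S2 S3 S4 /andP[tN tT]]]]]]] :=
    algorithm_spec w0 n0 M0 rn rn' r_gt0 ln1 ln2' W1 W2 W3 W4 W5 W6 W7 edgeP dP
      (s := s0) erefl erefl erefl (fun _ => erefl) (fun _ => erefl) (fun _ => erefl) sZ csN.
  exists t, s; split=> //.
    rewrite tN; apply: leq_trans tT (leq_trans _ TB).
    exact: (total_time n1 c_gt0 r_gt0 rn ln1 edgeP' mn gcs S4 S1 S2 S3).
  move=> v; have [D hD out_v] := res v (ltn_ord v).
  exact: (estimate_correct heps esP wtP hD out_v).
have NbT : (N * b <= T)%N.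
  by apply: leq_trans TB; apply: (draws_time n1 c_gt0 r_gt0 rn ln1 mn).
(* The good event reads only the first N * b of the T coins; the others contribute the same factor 2
   ^ (T - N * b) to both sides. *)
apply: (@coin_prob_ge R T n d _ (fun cs => gd (draws b N (take (N * b) cs)))) => //.
  move=> cs gcs; have szcs : size (take (N * b) cs) = (N * b)%N.
    by rewrite size_takel // size_tuple.
  have gcs' : gd (draws b N cs).
    by rewrite -(cat_take_drop (N * b) cs) draws_cat.
  have [|t [s [ex /andP[_ tT] res]]] := run cs _ gcs'; first by rewrite size_tuple.
  by exists t, s.
rewrite -{1}(subnKC NbT) sumseq_cat.
have -> : sumseq (N * b) (fun xs => sumseq (T - N * b)
    (fun ys => ~~ gd (draws b N (take (N * b) (xs ++ ys))) : nat)) =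
  (2 ^ (T - N * b) * sumseq (N * b) (fun xs => ~~ gd (draws b N xs) : nat))%N.
  rewrite -sumseq_scale; apply: sumseq_size => xs xsN.
  by rewrite -card_bool -sumseq_const; apply: eq_sumseq => ys; rewrite -xsN take_size_cat.
rewrite (sumseq_draws b N (fun ys => ~~ gd ys : nat)) mulnCA.
have -> : (2 ^ T = 2 ^ (T - N * b) * (2 ^ b) ^ N)%N.
  by rewrite -expnM (mulnC b) -expnD subnK.
rewrite leq_mul2l; apply/orP; right.
exact: (bad_fraction INF dd n1 c_gt0 r_gt0 rn ln1 edgeP' mn erefl).
Qed.
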